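(* Let $C$ be a DG open Frobenius algebra of degree $m$ over $\mathbb{Q}$, with differential $d$, counit $\varepsilon$ and coaugmentation $\mathbb{Q}\hookrightarrow C$. Then the shifted reduced Hochschild homology $\widetilde{HH}_*(C)[1-m]$ is a Batalin-Vilkovisky coalgebra, with differential induced by Connes' operator $B$ and coproduct induced by $\vee$.
   Context: All vector spaces are over $\mathbb{Q}$; signs follow the Koszul rule (switching $a\otimes b\mapsto b\otimes a$ costs $(-1)^{|a||b|}$). For a graded space $X$, $(X[r])_k=X_{k+r}$. **DG open Frobenius algebra of degree $m$.** A chain complex $(C,d)$ with a DG commutative algebra structure whose product is of degree $-m$, and a DG cocommutative coalgebra structure $\Delta(x)=x'\otimes x''$ (Sweedler notation, sum suppressed), such that for all $x,y\in C$: $(x\cdot y)'\otimes(x\cdot y)''=(x\cdot y')\otimes y''=(-1)^{m|x'|}x'\otimes(x''\cdot y)$. Here $C$ also has a counit $\varepsilon:C\to\mathbb{Q}$ and a coaugmentation $\mathbb{Q}\hookrightarrow C$. **Hochschild complex of the coalgebra $C$.** Let $\overline{C}=C/\mathbb{Q}\simeq\ker\varepsilon$, and let $\Sigma$ be desuspension (degrees shifted down by one). Put $CC_*(C)=\prod_{n\ge0}C\otimes(\Sigma\overline{C})^{\otimes n}$, with elements written $a_0[a_1|\cdots|a_n]$ and $|[a_1|\cdots|a_n]|=\sum_i(|a_i|-1)$. Entries in brackets are elements of $\overline C$, identified with $\ker\varepsilon$ when they are multiplied by elements of $C$. The differential is $$b(a_0[a_1|\cdots|a_n])=da_0[a_1|\cdots|a_n]+\sum_{i=1}^n(-1)^{|a_0|+|[a_1|\cdots|a_{i-1}]|}a_0[a_1|\cdots|da_i|\cdots|a_n]$$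 $$+\sum_{i=1}^n(-1)^{|a_0|+|[a_1|\cdots|a_{i-1}|a_i']|}a_0[a_1|\cdots|a_i'|a_i''|\cdots|a_n]+(-1)^{|a_0'|}a_0'\Big([a_0''|a_1|\cdots|a_n]-(-1)^{(|a_0''|-1)|[a_1|\cdots|a_n]|}[a_1|\cdots|a_n|a_0'']\Big).$$ Connes' operator $B:CC_*(C)\to CC_{*+1}(C)$ is $$B(a_0[a_1|\cdots|a_n])=\sum_{i=1}^n(-1)^{|[a_i|\cdots|a_n]||[a_1|\cdots|a_{i-1}]|}\varepsilon(a_0)a_i[a_{i+1}|\cdots|a_n|a_1|\cdots|a_{i-1}].$$ One has $b^2=B^2=bB+Bb=0$. The reduced Hochschild homology $\widetilde{HH}_*(C)$ is the homology of $\widetilde{CC}_*(C)=CC_*(C)/C=\prod_{n\ge1}C\otimes(\Sigma\overline C)^{\otimes n}$ with the induced $b$; $B$ also descends to it. **Coproduct.** $\vee:\widetilde{CC}_*(C)\to\widetilde{CC}_*(C)\otimes\widetilde{CC}_*(C)$, $$\vee(a_0[a_1|\cdots|a_n])=\sum_{i=2}^{n-1}(-1)^{\epsilon(i)}(a_0a_i)'[a_1|\cdots|a_{i-1}]\otimes(a_0a_i)''[a_{i+1}|\cdots|a_n],$$ $\epsilon(i)=|a_0|+(1+|a_i|+|(a_0a_i)''|)\,|[a_1|\cdots|a_{i-1}]|$. **Batalin-Vilkovisky coalgebra.** A graded cocommutative (coassociative, not necessarily counital) coalgebra $(V,\vee)$ with a linear map $\Delta:V_*\to V_{*+1}$ such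 that $\Delta\circ\Delta=0$ and for all $a\in V$ $$(\Delta\otimes id^{\otimes2}+id\otimes\Delta\otimes id+id^{\otimes2}\otimes\Delta)\circ(\vee\otimes id)\circ\vee(a)=(\tau^2+\tau+id)\circ(\vee\circ\Delta\otimes id)\circ\vee(a)-(\vee\otimes id)\circ\vee\circ\Delta(a),$$ where $\tau:a\otimes b\otimes c\mapsto c\otimes a\otimes b$ is the cyclic permutation with Koszul sign.
   Formalization: The terms a_0[..|da_i|..] of b carry the opposite sign (the desuspension differential [a] -> -[da]), needed for b^2=0; tensor powers of the complex are completed, and V⊗V, V⊗V⊗V are read as homology of the completed square and cube, since ∨ need not land in the algebraic tensor product. *)

(* Defs.v *)
From HB Require Import structures.
From mathcomp Require Import all_boot all_order all_algebra.
From mathcomp.multinomials Require Import freeg.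
From mathcomp Require Import boolp functions.

Set Implicit Arguments.
Unset Strict Implicit.
Unset Printing Implicit Defensive.

Import GRing.Theory.
Local Open Scope ring_scope.
Local Open Scope quotient_scope.

Section Subquotient.
Variable U : lmodType rat.

Record subspace := Subspace {
  in_subspace :> U -> Prop;
  subspace0 : in_subspace 0;
  subspaceP : forall a x y,
    in_subspace x -> in_subspace y -> in_subspace (a *: x + y) }.

Definition submem (Z : subspace) : {pred U} := [pred x | `[< Z x >]].

Lemma submem_closed Z : submod_closed (submem Z).
Proof.
split=> [|a x y]; rewrite ?inE; first by apply/asboolP; exact: subspace0.
by move=> /asboolP Zx /asboolP Zy; apply/asboolP; exact: subspaceP.
Qed.

HB.instance Definition _ Z :=
  GRing.isSubmodClosed.Build rat U (submem Z) (submem_closed Z).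

Definition subsp Z := {x | x \in submem Z}.
HB.instance Definition _ Z := Choice.on (subsp Z).
HB.instance Definition _ Z := SubType.on (subsp Z).
HB.instance Definition _ Z := [SubChoice_isSubLmodule of subsp Z by <:].

Variables Z B : subspace.

Definition presub : {pred subsp Z} := [pred z | val z \in submem B].

Lemma presub_closed : submod_closed presub.
Proof.
split=> [|a x y]; rewrite !inE ?raddf0; first exact: (rpred0 (submem B)).
by move=> Bx By; rewrite linearP; apply: (@rpredD _ (submem B)) => //; apply: rpredZ.
Qed.

HB.instance Definition _ :=
  GRing.isSubmodClosed.Build rat (subsp Z) presub presub_closed.
HB.instance Definition _ :=
  GRing.isZmodClosed.Build (subsp Z) presub (GRing.submod_closedB presub_closed).

Definition subquot := Quotient.quot presub.
HB.instance Definition _ := GRing.Zmodule.on subquot.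

Definition subq_class (z : subsp Z) : subquot := \pi z.

Definition subq_scale (a : rat) (x : subquot) : subquot := subq_class (a *: repr x).

Lemma subq_classZ a z : subq_scale a (subq_class z) = subq_class (a *: z).
Proof.
apply/eqP; rewrite /subq_scale /subq_class -Quotient.idealrBE -scalerBr.
by apply: rpredZ; rewrite Quotient.idealrBE reprK.
Qed.

Lemma subq_classD y z : subq_class (y + z) = subq_class y + subq_class z.
Proof. exact: raddfD. Qed.

Lemma subq_classE (x : subquot) : x = subq_class (repr x).
Proof. by rewrite /subq_class reprK. Qed.

Fact subq_scaleA a b x : subq_scale a (subq_scale b x) = subq_scale (a * b) x.
Proof. by rewrite (subq_classE x) !subq_classZ scalerA. Qed.
Fact subq_scale1 x : subq_scale 1 x = x.
Proof. by rewrite (subq_classE x) subq_classZ scale1r. Qed.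
Fact subq_scaleDr a x y : subq_scale a (x + y) = subq_scale a x + subq_scale a y.
Proof.
by rewrite (subq_classE x) (subq_classE y) -subq_classD !subq_classZ scalerDr subq_classD.
Qed.
Fact subq_scaleDl x a b : subq_scale (a + b) x = subq_scale a x + subq_scale b x.
Proof. by rewrite (subq_classE x) !subq_classZ scalerDl subq_classD. Qed.

HB.instance Definition _ := GRing.Zmodule_isLmodule.Build rat subquot
  subq_scaleA subq_scale1 subq_scaleDr subq_scaleDl.

End Subquotient.

Notation sgn z := ((-1 : rat) ^ (z : int)).

Section FreeLift.
Variables (K : choiceType) (M : lmodType rat) (f : K -> M).

Lemma fglift_linear : linear (fglift f : {freeg K / rat} -> M).
Proof.
have fgD u v : fglift f (u + v) = fglift f u + fglift f v.
  have fB := lift_is_additive f.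
  have fN w : fglift f (- w) = - fglift f w.
    by rewrite -sub0r fB -{1}(subrr w) fB subrr sub0r.
  by rewrite -{1}[v]opprK fB fN opprK.
have fg0 : fglift f 0 = 0 by apply: (@addrI _ (fglift f 0)); rewrite -fgD !addr0.
move=> a u v; rewrite fgD; congr (_ + _).
rewrite -[u]freeg_sumE scaler_sumr !(big_morph _ fgD fg0) scaler_sumr.
apply: eq_bigr => x _.
have -> : a *: << coeff x u *g x >> = << a * coeff x u *g x >> :> {freeg K / rat}.
  by apply/eqP/freeg_eqP => y; rewrite coeffZ !coeffU mulrA.
by rewrite !liftU scalerA.
Qed.

HB.instance Definition _ :=
  GRing.isLinear.Build rat {freeg K / rat} M _ (fglift f) fglift_linear.
End FreeLift.

Section Homogeneous.
Variable C : int -> lmodType rat.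

(* A homogeneous element bundled with its degree, so that the zero vectors of
   different degrees stay distinct. *)
Definition helt := {k : int & C k}.
Definition hom k (x : C k) : helt := Tagged C x.
Definition deg (x : helt) : int := tag x.

(* The degree k component of x, viewed in the direct sum of the C k; it spares
   casts between degrees that are only provably equal. *)
Definition comp_at (x : helt) (k : int) : C k :=
  untag (0 : C k) (fun y : C k => y) x.

Definition multilinear (phi : seq helt -> rat) : Prop :=
  forall s t k (a : rat) (x y : C k),
    phi (s ++ hom (a *: x + y) :: t) =
    a * phi (s ++ hom x :: t) + phi (s ++ hom y :: t).

(* The word [:: x1; ...; xn] stands for x1 (x) ... (x) xn.  Two combinations of
   words are equal in the tensor algebra of C iff all multilinear functionals
   agree on them. *)
Definition tens (s : seq helt) : {freeg (seq helt) / rat} := << s >>.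
Definition eq_tens (u v : {freeg (seq helt) / rat}) : Prop :=
  forall phi, multilinear phi ->
    fglift (phi : _ -> rat^o) u = fglift (phi : _ -> rat^o) v.

End Homogeneous.

Notation "u =T v" := (eq_tens u v) (at level 70, no associativity).

(* cop x lists the pairs (x', x'') of a Sweedler presentation of the coproduct
   of x.  The choice of presentation is immaterial: cop is only constrained
   through eq_tens. *)
Record frobData (m : int) := FrobData {
  space :> int -> lmodType rat;
  dif : forall k, {linear space k -> space (k - 1)};
  mul : forall i j, space i -> space j -> space (i + j - m);
  cop : forall k, space k -> seq (helt space * helt space);
  eps : forall k, {linear space k -> rat^o};
  one : space 0 }.

Arguments dif {m f k}.
Arguments eps {m f k}.
Arguments cop {m f k}.
Arguments mul {m f i j}.
Arguments one {m}.

Section FrobOps.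
Variables (m : int) (C : frobData m).
Implicit Types x y : helt C.

Definition hdif x : helt C := hom (dif (tagged x)).
Definition hmul x y : helt C := hom (mul (tagged x) (tagged y)).
Definition hcop x : seq (helt C * helt C) := cop (tagged x).
Definition heps x : rat := eps (tagged x).
Definition hone : helt C := hom (one C).
Definition hscale (a : rat) x : helt C := hom (a *: tagged x).

(* The product of the shifted complex C[m], in which x has degree |x| - m: it is
   obtained from the degree -m product of C by conjugating with the shift, under
   the Koszul rule. *)
Definition smul x y : helt C := hscale (sgn (m * deg x)) (hmul x y).
Definition sdeg x : int := deg x - m.

(* The representative in ker eps of the class of x modulo the coaugmentation. *)
Definition hred x : helt C :=
  hom (tagged x - heps x *: comp_at hone (deg x)).

End FrobOps.

(* "Commutative DG algebra with product of degree -m" means that C[m] is a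
   commutative DG algebra, not necessarily unital.  The sign conventions this
   gives on C are the ones forced by the two Frobenius identities: by the
   counit, they imply (x y) z = (-1)^(m |x| + m) x (y z). *)
Record dgOpenFrobenius (m : int) := DGOpenFrobenius {
  frob_data :> frobData m;
  dif_dif : forall k (x : frob_data k), dif (dif x) = 0;
  mul_linear_l : forall i j (y : frob_data j),
    linear (fun x : frob_data i => mul x y);
  mul_linear_r : forall i j (x : frob_data i),
    linear (fun y : frob_data j => mul x y);
  smulC : forall (x y : helt frob_data) k,
    comp_at (smul x y) k = sgn (sdeg x * sdeg y) *: comp_at (smul y x) k;
  smulA : forall (x y z : helt frob_data) k,
    comp_at (smul (smul x y) z) k = comp_at (smul x (smul y z)) k;
  dif_smul : forall (x y : helt frob_data) k,
    comp_at (hdif (smul x y)) k =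
    comp_at (smul (hdif x) y) k + sgn (sdeg x) *: comp_at (smul x (hdif y)) k;
  cop_deg : forall k (x : frob_data k) p,
    p \in cop x -> deg p.1 + deg p.2 = k;
  cop_linear : forall k (a : rat) (x y : frob_data k),
    \sum_(p <- cop (a *: x + y)) tens [:: p.1; p.2] =T
    a *: (\sum_(p <- cop x) tens [:: p.1; p.2]) +
    \sum_(p <- cop y) tens [:: p.1; p.2];
  cop_dif : forall k (x : frob_data k),
    \sum_(p <- cop (dif x)) tens [:: p.1; p.2] =T
    \sum_(p <- cop x) (tens [:: hdif p.1; p.2] +
                       sgn (deg p.1) *: tens [:: p.1; hdif p.2]);
  copA : forall k (x : frob_data k),
    \sum_(p <- cop x) \sum_(q <- hcop p.1) tens [:: q.1; q.2; p.2] =T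
    \sum_(p <- cop x) \sum_(q <- hcop p.2) tens [:: p.1; q.1; q.2];
  copC : forall k (x : frob_data k),
    \sum_(p <- cop x) tens [:: p.1; p.2] =T
    \sum_(p <- cop x) sgn (deg p.1 * deg p.2) *: tens [:: p.2; p.1];
  frobenius_l : forall x y : helt frob_data,
    \sum_(p <- hcop (hmul x y)) tens [:: p.1; p.2] =T
    \sum_(p <- hcop y) tens [:: hmul x p.1; p.2];
  frobenius_r : forall x y : helt frob_data,
    \sum_(p <- hcop (hmul x y)) tens [:: p.1; p.2] =T
    \sum_(p <- hcop x) sgn (m * deg p.1) *: tens [:: p.1; hmul p.2 y];
  eps_deg : forall k (x : frob_data k), k != 0 -> eps x = 0;
  eps_dif : forall k (x : frob_data k), eps (dif x) = 0;
  counit_l : forall (x : helt frob_data) k,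
    \sum_(p <- hcop x) heps p.1 *: comp_at p.2 k = comp_at x k;
  counit_r : forall (x : helt frob_data) k,
    \sum_(p <- hcop x) heps p.2 *: comp_at p.1 k = comp_at x k;
  dif_one : dif (one frob_data) = 0;
  eps_one : eps (one frob_data) = 1;
  cop_one :
    \sum_(p <- cop (one frob_data)) tens [:: p.1; p.2] =T
    tens [:: hone frob_data; hone frob_data] }.

Section Hochschild.
Variables (m : int) (C : dgOpenFrobenius m).

(* The block (a0, [:: a1; ...; an]) is a0[a1|...|an]; the word [:: B1; ...; Br]
   is B1 (x) ... (x) Br. *)
Definition block := (helt C * seq (helt C))%type.
Definition word := seq block.
Definition shape (w : word) : seq nat := [seq size B.2 | B <- w].

Definition bdeg (s : seq (helt C)) : int := \sum_(a <- s) (deg a - 1).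
Definition block_deg (B : block) : int := deg B.1 + bdeg B.2.

(* Degree in the tensor powers of the shift by c: (X[c])_k = X_(k + c). *)
Definition word_deg (c : int) (w : word) : int :=
  \sum_(B <- w) (block_deg B - c).

(* Functionals on words that are multilinear and vanish as soon as a bracket
   entry is the coaugmentation element, i.e. functionals on tensor products of
   copies of C (entries a0) and of C/Q (bracket entries). *)
Definition reduced_form (phi : word -> rat) : Prop :=
  [/\ forall u v s k (a : rat) (x y : C k),
        phi (u ++ (hom (a *: x + y), s) :: v) =
        a * phi (u ++ (hom x, s) :: v) + phi (u ++ (hom y, s) :: v),
      forall u v a0 s t k (a : rat) (x y : C k),
        phi (u ++ (a0, s ++ hom (a *: x + y) :: t) :: v) =
        a * phi (u ++ (a0, s ++ hom x :: t) :: v) +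
        phi (u ++ (a0, s ++ hom y :: t) :: v) &
      forall u v a0 s t, phi (u ++ (a0, s ++ hone C :: t) :: v) = 0].

(* A combination of words that vanishes in the tensor product. *)
Definition null (u : {freeg word / rat}) : Prop :=
  forall phi, reduced_form phi -> fglift (phi : _ -> rat^o) u = 0.

Definition blk (a0 : helt C) (s : seq (helt C)) : {freeg word / rat} :=
  << [:: (a0, s)] >>.

Local Notation entry := (nth (hone C)).

(* Brackets are entries of the desuspension, whose differential is
   [a] |-> - [da]; this is the sign in front of the second summand. *)
Definition b_block (B : block) : {freeg word / rat} :=
  let: (a0, s) := B in
  blk (hdif a0) s
  - \sum_(i < size s) sgn (deg a0 + bdeg (take i s)) *:
      blk a0 (take i s ++ hdif (entry s i) :: drop i.+1 s)
  + \sum_(i < size s) \sum_(p <- hcop (entry s i))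
      sgn (deg a0 + bdeg (rcons (take i s) p.1)) *:
      blk a0 (take i s ++ p.1 :: p.2 :: drop i.+1 s)
  + \sum_(p <- hcop a0) sgn (deg p.1) *:
      (blk p.1 (p.2 :: s)
       - sgn ((deg p.2 - 1) * bdeg s) *: blk p.1 (rcons s p.2)).

Definition B_block (B : block) : {freeg word / rat} :=
  let: (a0, s) := B in
  \sum_(i < size s) (sgn (bdeg (drop i s) * bdeg (take i s)) * heps a0) *:
    blk (hred (entry s i)) (drop i.+1 s ++ take i s).

(* Bracket entries are numbered from 0, so the bounds 2 <= i <= n - 1 become
   1 <= i < n - 1. *)
Definition vee_block (B : block) : {freeg word / rat} :=
  let: (a0, s) := B in
  \sum_(1 <= i < (size s).-1) \sum_(p <- hcop (hmul a0 (hred (entry s i))))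
    sgn (deg a0 + (1 + deg (entry s i) + deg p.2) * bdeg (take i s)) *:
    << [:: (p.1, take i s); (p.2, drop i.+1 s)] >>.

(* The coproduct on the shift by c: vee conjugated with the shift s, where
   (s (x) s)(x (x) y) = (-1)^(c |x|) s x (x) s y. *)
Definition shift2 (c : int) (w : word) : {freeg word / rat} :=
  if w is B :: _ then sgn (c * block_deg B) *: << w >> else << w >>.
Definition veeS_block (c : int) (B : block) : {freeg word / rat} :=
  fglift (shift2 c) (vee_block B).

(* id^(x)i (x) G (x) id^(x)j for an operation G of degree e, with the Koszul
   sign. *)
Definition at_slot (c e : int) (i : nat) (G : block -> {freeg word / rat})
    (w : word) : {freeg word / rat} :=
  if drop i w is B :: v then
    sgn (e * word_deg c (take i w)) *:
    fglift (fun t => << take i w ++ t ++ v >> : {freeg word / rat}) (G B)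
  else 0.

Definition swap_word (c : int) (w : word) : {freeg word / rat} :=
  if w is [:: x; y] then
    sgn (word_deg c [:: x] * word_deg c [:: y]) *: << [:: y; x] >>
  else 0.
Definition rot_word (c : int) (w : word) : {freeg word / rat} :=
  if w is [:: x; y; z] then
    sgn (word_deg c [:: x; y] * word_deg c [:: z]) *: << [:: z; x; y] >>
  else 0.

(* The reduced complex is a product over n >= 1, and its tensor powers are the
   completed ones, i.e. products over all shapes (n1, ..., nr) with ni >= 1: on
   an infinite sum of chains, vee need not take values in the algebraic tensor
   product. *)
Definition family := seq nat -> {freeg word / rat}.

Definition is_chain (c : int) (r : nat) (k : int) (f : family) : Prop :=
  forall ns w, w \in dom (f ns) ->
    [/\ size ns = r, 0%N \notin ns, shape w = ns & word_deg c w = k].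

Definition null_family (f : family) : Prop := forall ns, null (f ns).

Definition keep (ns : seq nat) (w : word) : {freeg word / rat} :=
  if (shape w == ns) && (0%N \notin ns) then << w >> else 0.

(* The continuous extension of a word operation G to families.  All the
   operations below send a word of shape (n1, ..., nr) to words of total bracket
   length at least ni - 1 for every i, so the sum collects every contribution to
   the component of shape ns; discarding the shapes with an entry 0 is the
   passage to the quotient by C. *)
Definition extend (r : nat) (G : word -> {freeg word / rat}) (f : family) :
    family :=
  fun ns => \sum_(t : r.-tuple 'I_(sumn ns).+2)
    fglift (keep ns) (fglift G (f [seq val i | i <- t])).

Definition b_total (c : int) (r : nat) : family -> family :=
  extend r (fun w => \sum_(i < r) at_slot c 1 i b_block w).

Definition is_cycle c r k f := is_chain c r k f /\ null_family (b_total c r f).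
Definition is_boundary c r k f := is_chain c r k f /\
  exists2 g, is_chain c r (k + 1) g & null_family (f - b_total c r g).

Lemma null0 : null 0.
Proof. by move=> phi _; rewrite raddf0. Qed.

Lemma nullP a u v : null u -> null v -> null (a *: u + v).
Proof. by move=> nu nv phi hphi; rewrite linearP /= (nu _ hphi) (nv _ hphi) scaler0 addr0. Qed.

Lemma is_chain0 c r k : is_chain c r k 0.
Proof. by move=> ns w; rewrite dom0. Qed.

Lemma is_chainP c r k a f g :
  is_chain c r k f -> is_chain c r k g -> is_chain c r k (a *: f + g).
Proof.
move=> hf hg ns w; have [wf _|wf] := boolP (w \in dom (f ns)); first exact: hf.
have [wg _|wg] := boolP (w \in dom (g ns)); first exact: hg.
by rewrite mem_dom coeffD coeffZ !coeff_outdom // mulr0 addr0 eqxx.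
Qed.

Lemma extend_linear r G : linear (extend r G).
Proof.
move=> a f g; apply/funext => ns.
rewrite -[RHS]/(a *: extend r G f ns + extend r G g ns).
rewrite /extend scaler_sumr -big_split /=; apply: eq_bigr => t _.
set ns' := map _ _.
by rewrite (_ : (a *: f + g) ns' = a *: f ns' + g ns') // !linearP.
Qed.

HB.instance Definition _ r G :=
  GRing.isLinear.Build rat family family _ (extend r G) (extend_linear r G).
HB.instance Definition _ c r := GRing.Linear.on (b_total c r).

Lemma is_cycle0 c r k : is_cycle c r k 0.
Proof.
by split=> [|ns]; [exact: is_chain0 | rewrite raddf0; exact: null0].
Qed.

Lemma is_cycleP c r k a f g :
  is_cycle c r k f -> is_cycle c r k g -> is_cycle c r k (a *: f + g).
Proof.
move=> [cf nf] [cg ng]; split=> [|ns]; first exact: is_chainP.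
by rewrite linearP; apply: nullP; [exact: nf | exact: ng].
Qed.

Lemma is_boundary0 c r k : is_boundary c r k 0.
Proof.
split; first exact: is_chain0.
by exists 0; [exact: is_chain0 | move=> ns; rewrite raddf0 subr0; exact: null0].
Qed.

Lemma is_boundaryP c r k a f g :
  is_boundary c r k f -> is_boundary c r k g -> is_boundary c r k (a *: f + g).
Proof.
move=> [cf [x cx nx]] [cg [y cy ny]]; split; first exact: is_chainP.
exists (a *: x + y); first exact: is_chainP.
move=> ns; rewrite linearP opprD addrACA -scalerBr.
by apply: nullP; [exact: nx | exact: ny].
Qed.

Definition cycles c r k := Subspace (is_cycle0 c r k) (@is_cycleP c r k).
Definition boundaries c r k :=
  Subspace (is_boundary0 c r k) (@is_boundaryP c r k).

(* Degree k of the homology of the r-th completed tensor power of the shifted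
   reduced Hochschild complex; r = 1 gives the shift by c of the reduced
   Hochschild homology.  Boundaries contain the null families, which accounts
   for passing from combinations of words to tensors. *)
Definition HHt (c : int) (r : nat) (k : int) : lmodType rat :=
  subquot (cycles c r k) (boundaries c r k).

(* F is well defined by F [z] = [f z] on homology classes. *)
Definition induced c r k r' k' (f : family -> family)
    (F : HHt c r k -> HHt c r' k') : Prop :=
  forall z : subsp (cycles c r k), exists2 z' : subsp (cycles c r' k'),
    val z' = f (val z) & F (subq_class _ z) = subq_class _ z'.

Definition vee_at r i : family -> family :=
  extend r (at_slot (1 - m) 0 i (veeS_block (1 - m))).
Definition B_at r i : family -> family :=
  extend r (at_slot (1 - m) 1 i B_block).

End Hochschild.

Arguments HHt {m}.
Arguments vee_at {m}.
Arguments B_at {m}.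
Arguments swap_word {m C}.
Arguments rot_word {m C}.
Arguments extend {m C}.
Arguments induced {m C c r k r' k'}.

(* The operations entering the definition of a Batalin-Vilkovisky coalgebra V1,
   where V2 and V3 stand for the tensor square and cube of V1; for homology they
   are the homologies of the completed tensor square and cube of the complex. *)
Record bvOps (V1 V2 V3 : int -> lmodType rat) := BVOps {
  bv_vee : forall k, {linear V1 k -> V2 k};
  bv_vee_id : forall k, {linear V2 k -> V3 k};
  bv_id_vee : forall k, {linear V2 k -> V3 k};
  bv_swap : forall k, {linear V2 k -> V2 k};
  bv_tau : forall k, {linear V3 k -> V3 k};
  bv_Delta : forall k, {linear V1 k -> V1 (k + 1)};
  bv_Delta_id : forall k, {linear V2 k -> V2 (k + 1)};
  bv_Delta_id_id : forall k, {linear V3 k -> V3 (k + 1)};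
  bv_id_Delta_id : forall k, {linear V3 k -> V3 (k + 1)};
  bv_id_id_Delta : forall k, {linear V3 k -> V3 (k + 1)} }.

Record is_BV_coalgebra (V1 V2 V3 : int -> lmodType rat) (S : bvOps V1 V2 V3) :
    Prop := IsBVCoalgebra {
  bv_cocommutative : forall k (a : V1 k),
    bv_swap S k (bv_vee S k a) = bv_vee S k a;
  bv_coassociative : forall k (a : V1 k),
    bv_vee_id S k (bv_vee S k a) = bv_id_vee S k (bv_vee S k a);
  bv_Delta_Delta : forall k (a : V1 k),
    bv_Delta S (k + 1) (bv_Delta S k a) = 0;
  bv_relation : forall k (a : V1 k),
    let vv := bv_vee_id S k (bv_vee S k a) in
    let vDv := bv_vee_id S (k + 1) (bv_Delta_id S k (bv_vee S k a)) in
    bv_Delta_id_id S k vv + bv_id_Delta_id S k vv + bv_id_id_Delta S k vv =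
    bv_tau S (k + 1) (bv_tau S (k + 1) vDv) + bv_tau S (k + 1) vDv + vDv -
    bv_vee_id S (k + 1) (bv_vee S (k + 1) (bv_Delta S k a)) }.

Record induced_by_vee_and_B (m : int) (C : dgOpenFrobenius m)
    (S : bvOps (HHt C (1 - m) 1) (HHt C (1 - m) 2) (HHt C (1 - m) 3)) :
    Prop := InducedByVeeAndB {
  ind_vee : forall k, induced (vee_at C 1 0) (bv_vee S k);
  ind_vee_id : forall k, induced (vee_at C 2 0) (bv_vee_id S k);
  ind_id_vee : forall k, induced (vee_at C 2 1) (bv_id_vee S k);
  ind_swap : forall k, induced (extend 2 (swap_word (1 - m))) (bv_swap S k);
  ind_tau : forall k, induced (extend 3 (rot_word (1 - m))) (bv_tau S k);
  ind_Delta : forall k, induced (B_at C 1 0) (bv_Delta S k);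
  ind_Delta_id : forall k, induced (B_at C 2 0) (bv_Delta_id S k);
  ind_Delta_id_id : forall k, induced (B_at C 3 0) (bv_Delta_id_id S k);
  ind_id_Delta_id : forall k, induced (B_at C 3 1) (bv_id_Delta_id S k);
  ind_id_id_Delta : forall k, induced (B_at C 3 2) (bv_id_id_Delta S k) }.

(* Main.v *)
(* Chains are tested against functionals, so every operation is replaced by its
   transpose and an identity between operations becomes an identity of scalars.
   Write V for vee, s for the swap, and V0, V1, B0, B1, ... for the operations
   applied to one tensor factor. Up to signs, on the chain level V is coassociative, B squares
   to zero, and there are homotopies
     s V - V = [b, h],
     V B - B0 V - s B0 V - L = [b, G + s G]   where L = h + s h,
     V0 L - s12 L0 V - L1 V = [b, k'],
   k' being a permutation of the operation k that cuts two blocks out of a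
   bracket. Thus L is a chain operation, dual to the Gerstenhaber bracket up to
   shifts; the second relation says that it is the defect of B, and the third
   that it is a coderivation of V. The seven-term relation follows formally. *)

From HB Require Import structures.
From mathcomp Require Import all_boot all_order all_algebra.
From mathcomp.multinomials Require Import freeg.
From mathcomp Require Import boolp functions.
From mathcomp Require Import ring zify.
From Stdlib Require Import Btauto.
Require Import Defs.

Set Implicit Arguments.
Unset Strict Implicit.
Unset Printing Implicit Defensive.

Import GRing.Theory.
Local Open Scope ring_scope.

(** * Signs and functionals on the Frobenius algebra *)

(** Two obstacles shape the proof. The complex is a product over all bracket lengths, so a chain is
    an infinite family; but each operation shortens brackets by a bounded number of letters, so its
    transpose preserves functionals supported on finitely many shapes, and every pairing is a finite
    sum. Secondly, bracket letters live in C/Q while products use representatives in ker eps.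
    Subtracting eps(a) 1 makes the extraction of a letter commute with the bar differential only up
    to unit terms. By the counit these telescope along the bracket and survive only at its two ends,
    where they meet the letters inserted by the coproduct of a0; this is where V and s V enter the
    homotopy formulas. In the formal step, V0 V B is expanded by the second relation and by the
    coderivation property. The second relation, applied in a single tensor slot, then eliminates L0
    V and L1 V. On homology, cocommutativity and coassociativity make V0 V invariant under all
    permutations of the three factors, so L drops out and the seven terms remain. Signs are compared
    through parities, where an identity becomes a Boolean tautology. *)

Definition par (z : int) : bool := sgn z == -1.

Lemma sgnE z : sgn z = (-1) ^+ par z.
Proof.
rewrite /par; suff /orP[/eqP->|/eqP->] : (sgn z == 1) || (sgn z == -1) by [].
case: z => n; rewrite ?NegzE -?exprnP -?exprnN ?(signr_odd _ n) -1?signr_odd.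
  by case: (odd n).
by rewrite -signr_odd; case: (odd _); rewrite /= ?expr0 ?expr1.
Qed.

Lemma parD x y : par (x + y) = par x (+) par y.
Proof.
by rewrite {1}/par expfzDr // !sgnE; case: (par x); case: (par y).
Qed.

Lemma parM x y : par (x * y) = par x && par y.
Proof.
rewrite {1}/par -exprz_exp (sgnE x); case: (par x) => //=.
by rewrite expr0 exp1rz.
Qed.

Lemma parN x : par (- x) = par x.
Proof. by rewrite -mulN1r parM. Qed.

Lemma par0 : par 0 = false. Proof. by []. Qed.
Lemma par1 : par 1 = true. Proof. by []. Qed.

Definition parE := (parD, parM, parN, par0, par1).

Lemma sgnD x y : sgn (x + y) = sgn x * sgn y.
Proof. exact: expfzDr. Qed.

Lemma sgn_par x y : par x = par y -> sgn x = sgn y.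
Proof. by rewrite !sgnE => ->. Qed.

Lemma sgnMsgn x : sgn x * sgn x = 1.
Proof. by rewrite sgnE; case: (par x). Qed.

Lemma fgliftE (K : choiceType) (f : K -> rat) (u : {freeg K / rat}) :
  fglift (f : _ -> rat^o) u = \sum_(x <- dom u) coeff x u * f x.
Proof.
rewrite -{1}[u]freeg_sumE raddf_sum; apply: eq_bigr => x _.
by rewrite /= liftU.
Qed.

Lemma fglift1 (K : choiceType) (f : K -> rat) (x : K) :
  fglift (f : _ -> rat^o) << x >> = f x.
Proof. by rewrite liftU scale1r. Qed.

Lemma fglift_comp (K L : choiceType) (f : L -> rat) (g : K -> {freeg L / rat})
    (u : {freeg K / rat}) :
  fglift (f : _ -> rat^o) (fglift g u) =
  fglift ((fun x => fglift (f : _ -> rat^o) (g x)) : _ -> rat^o) u.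
Proof.
rewrite -{1 2}[u]freeg_sumE !raddf_sum /=; apply: eq_bigr => x _.
by rewrite !liftU linearZ.
Qed.

(** [btauto] recognises [xorb], not the [addb] in which [parD] is stated. *)
Lemma parD_xorb x y : par (x + y) = xorb (par x) (par y).
Proof. by rewrite parD; case: (par x); case: (par y). Qed.
Lemma parM_andb x y : par (x * y) = andb (par x) (par y).
Proof. exact: parM. Qed.
Lemma sgn_parN x y : par x = negb (par y) -> sgn x = - sgn y.
Proof. by rewrite !sgnE => ->; case: (par y). Qed.
Definition parEb := (parD_xorb, parM_andb, parN, par0, par1).

(** * Linear functionals on homogeneous elements *)

Section Linear.
Variable C : int -> lmodType rat.
Implicit Types (f : helt C -> rat) (F : helt C -> helt C -> rat).

Definition lin1 f := forall k (a : rat) (x y : C k),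
  f (hom (a *: x + y)) = a * f (hom x) + f (hom y).

Lemma lin1_0 f k : lin1 f -> f (hom (0 : C k)) = 0.
Proof.
move=> lf; have := lf k 1 0 0; rewrite scale1r addr0 mul1r => e.
by apply: (@addrI _ (f (hom (0 : C k)))); rewrite addr0 -e.
Qed.

Lemma lin1_Z f k a (x : C k) : lin1 f -> f (hom (a *: x)) = a * f (hom x).
Proof. by move=> lf; rewrite -[a *: x]addr0 lf lin1_0 // addr0. Qed.

Lemma comp_at_deg (x : helt C) : comp_at x (deg x) = tagged x.
Proof.
by rewrite /comp_at /untag /= /etagged; case: eqP => // e; rewrite (eq_axiomK e).
Qed.

Lemma comp_at_neq (x : helt C) k : k != deg x -> comp_at x k = 0.
Proof. by rewrite /comp_at /untag => /negPf; rewrite eq_sym /deg; case: eqP. Qed.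

(** The axioms compare elements of only provably equal degrees through their components. A finite
    list [K] containing all degrees involved turns such a comparison into one between values of
    [f]. *)
Lemma lin1_comp_at f (x : helt C) (K : seq int) : lin1 f -> uniq K -> deg x \in K ->
  f x = \sum_(k <- K) f (hom (comp_at x k)).
Proof.
move=> lf uK xK; rewrite (bigD1_seq (deg x)) //= big1 ?addr0 => [|k kx].
  by rewrite comp_at_deg; case: x xK.
by rewrite comp_at_neq // lin1_0.
Qed.

Lemma lin1_eq f x y a : lin1 f ->
  (forall k, comp_at x k = a *: comp_at y k) -> f x = a * f y.
Proof.
move=> lf e; pose K := undup [:: deg x; deg y].
rewrite !(@lin1_comp_at f _ K) ?undup_uniq ?mem_undup ?inE ?eqxx ?orbT //.
by rewrite mulr_sumr; apply: eq_bigr => k _; rewrite e lin1_Z.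
Qed.

Lemma lin1_eq2 f x y z a : lin1 f ->
  (forall k, comp_at x k = comp_at y k + a *: comp_at z k) -> f x = f y + a * f z.
Proof.
move=> lf e; pose K := undup [:: deg x; deg y; deg z].
rewrite !(@lin1_comp_at f _ K) ?undup_uniq ?mem_undup ?inE ?eqxx ?orbT //.
rewrite mulr_sumr -big_split; apply: eq_bigr => k _ /=.
by rewrite e (addrC (comp_at y k)) lf addrC.
Qed.

Lemma lin1D f g : lin1 f -> lin1 g -> lin1 (fun x => f x + g x).
Proof. by move=> lf lg k a x y; rewrite lf lg; ring. Qed.
Lemma lin1B f g : lin1 f -> lin1 g -> lin1 (fun x => f x - g x).
Proof. by move=> lf lg k a x y; rewrite lf lg; ring. Qed.
Lemma lin1N f : lin1 f -> lin1 (fun x => - f x).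
Proof. by move=> lf k a x y; rewrite lf; ring. Qed.
Lemma lin1_const0 : lin1 (fun _ => 0).
Proof. by move=> k a x y; ring. Qed.
Lemma lin1_scale f (g : int -> rat) : lin1 f -> lin1 (fun x => g (deg x) * f x).
Proof. by move=> lf k a x y; rewrite lf /=; ring. Qed.
Lemma lin1_mulr f c : lin1 f -> lin1 (fun x => f x * c).
Proof. by move=> lf k a x y; rewrite lf /=; ring. Qed.
Lemma lin1_sum (I : Type) (r : seq I) (G : I -> helt C -> rat) :
  (forall i, lin1 (G i)) -> lin1 (fun x => \sum_(i <- r) G i x).
Proof.
move=> lG k a x y; rewrite mulr_sumr -big_split; apply: eq_bigr => i _; exact: lG.
Qed.

Definition bilin F := (forall y, lin1 (F^~ y)) /\ (forall x, lin1 (F x)).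

(** Extended by zero to words of other lengths, so that [eq_tens] applies to a bilinear form. *)
Definition form_of2 F (s : seq (helt C)) : rat :=
  if s is [:: x; y] then F x y else 0.
Definition form_of3 (T : helt C -> helt C -> helt C -> rat) (s : seq (helt C)) : rat :=
  if s is [:: x; y; z] then T x y z else 0.

Lemma multilinear_of2 F : bilin F -> multilinear (form_of2 F).
Proof.
move=> [l1 l2] s t k a x y; case: s t => [|s1 [|s2 s]] [|t1 [|t2 t]] //=;
  rewrite ?mulr0 ?addr0 //; try by [exact: l1 | exact: l2].
all: by case: s => [|? ?] /=; rewrite ?mulr0 ?addr0.
Qed.

Definition trilin (T : helt C -> helt C -> helt C -> rat) :=
  [/\ forall y z, lin1 (fun x => T x y z), forall x z, lin1 (fun y => T x y z) &
      forall x y, lin1 (T x y)].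

Lemma multilinear_of3 T : trilin T -> multilinear (form_of3 T).
Proof.
move=> [l1 l2 l3] s t k a x y.
case: s t => [|s1 [|s2 [|s3 s]]] [|t1 [|t2 [|t3 t]]] //=; rewrite ?mulr0 ?addr0 //;
  try by [exact: l1 | exact: l2 | exact: l3].
all: by case: s => [|? ?] /=; rewrite ?mulr0 ?addr0.
Qed.

End Linear.

Lemma linear_scale (U V : lmodType rat) (f : U -> V) a x :
  linear f -> f (a *: x) = a *: f x.
Proof.
move=> lf; have f0 : f 0 = 0.
  by have := lf 1 0 0; rewrite !scale1r addr0 -{1}[f 0]addr0 => /addrI.
by rewrite -[a *: x]addr0 lf f0 addr0.
Qed.

Lemma sgn_scaleI (V : lmodType rat) a b (x y : V) :
  sgn a *: x = sgn b *: y -> x = sgn (a + b) *: y.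
Proof.
move=> /(congr1 (fun v => sgn a *: v)); rewrite !scalerA sgnMsgn scale1r => ->.
by rewrite sgnD.
Qed.

(** * The Frobenius axioms tested against functionals *)

Section Frob.
Variables (m : int) (C : dgOpenFrobenius m).
Implicit Types (x y z : helt C) (f : helt C -> rat) (F : helt C -> helt C -> rat).

Lemma lin1_mull f y : lin1 f -> lin1 (fun x => f (hmul x y)).
Proof. by move=> lf k a x x'; rewrite /hmul /= mul_linear_l lf. Qed.
Lemma lin1_mulr' f x : lin1 f -> lin1 (fun y => f (hmul x y)).
Proof. by move=> lf k a y y'; rewrite /hmul /= mul_linear_r lf. Qed.
Lemma lin1_dif f : lin1 f -> lin1 (fun x => f (hdif x)).
Proof. by move=> lf k a x y; rewrite /hdif /= linearP lf. Qed.
Lemma lin1_eps : lin1 (@heps _ C).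
Proof. by move=> k a x y; rewrite /heps /= linearP. Qed.

Lemma heps_deg x : deg x != 0 -> heps x = 0.
Proof. by case: x => k x /= ?; rewrite /heps eps_deg. Qed.

Lemma heps_one : heps (hone C) = 1.
Proof. exact: eps_one. Qed.

(** Outside degree 0 the counit vanishes and with it the correction; in degree 0 the component of
    [hone C] is the unit itself. *)
Lemma hred_lin f x : lin1 f -> f (hred x) = f x - heps x * f (hone C).
Proof.
case: x => k x lf; rewrite /hred /= addrC -scaleNr.
case: (eqVneq k 0) => [k0|k0].
  by subst k; rewrite lf -[0]/(deg (hone C)) comp_at_deg /= ; ring.
by rewrite lf (@heps_deg (existT _ k x)) //= oppr0 mul0r add0r /hom; ring.
Qed.

Lemma lin1_hred f : lin1 f -> lin1 (fun x => f (hred x)).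
Proof. by move=> lf k a x y; rewrite !hred_lin // lf lin1_eps; ring. Qed.

Lemma heps_hred x : heps (hred x) = 0.
Proof. by rewrite hred_lin ?heps_one ?mulr1 ?subrr //; exact: lin1_eps. Qed.

Lemma hred_one f : lin1 f -> f (hred (hone C)) = 0.
Proof. by move=> lf; rewrite hred_lin // heps_one mul1r subrr. Qed.

Lemma heps_dif x : heps (hdif x) = 0.
Proof. exact: eps_dif. Qed.

Lemma lin1_dif_one f : lin1 f -> f (hdif (hone C)) = 0.
Proof. by move=> lf; rewrite /hdif /= dif_one lin1_0. Qed.

Lemma deg_hmul x y : deg (hmul x y) = deg x + deg y - m. Proof. by []. Qed.
Lemma deg_hdif x : deg (hdif x) = deg x - 1. Proof. by []. Qed.
Lemma deg_hred x : deg (hred x) = deg x. Proof. by []. Qed.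
Lemma deg_hone : deg (hone C) = 0. Proof. by []. Qed.
Definition degE := (deg_hmul, deg_hdif, deg_hred, deg_hone).

Lemma comp_atZ a x k : comp_at (hscale a x) k = a *: comp_at x k.
Proof.
have [e|ne] := eqVneq k (deg x); last by rewrite !comp_at_neq ?scaler0.
by rewrite e comp_at_deg -[deg x]/(deg (hscale a x)) comp_at_deg.
Qed.

(** Commutativity of C[m] read back on C: the shift signs in |x| and |y| cancel, and m * m leaves
    the parity of m. *)
Lemma mulC_lin f x y : lin1 f ->
  f (hmul x y) = sgn (deg x * deg y + m) * f (hmul y x).
Proof.
move=> lf; apply: lin1_eq => // k; have := smulC x y k.
rewrite /smul !comp_atZ => /(congr1 (fun v => sgn (m * deg x) *: v)).
rewrite !scalerA sgnMsgn scale1r => ->; congr (_ *: _).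
rewrite -!sgnD; apply: sgn_par; rewrite /sdeg !parE.
by do 3! case: (par _).
Qed.

Lemma mulA_lin f x y z : lin1 f ->
  f (hmul (hmul x y) z) = sgn (m * deg x + m) * f (hmul x (hmul y z)).
Proof.
move=> lf; apply: lin1_eq => // k; have := smulA x y z k.
have cl (u v : helt C) (a : rat) : hmul (hscale a u) v = hscale a (hmul u v).
  by rewrite /hmul /= (linear_scale _ _ (mul_linear_l (tagged v))).
have cr (u v : helt C) (a : rat) : hmul u (hscale a v) = hscale a (hmul u v).
  by rewrite /hmul /= (linear_scale _ _ (mul_linear_r (tagged u))).
rewrite /smul !comp_atZ cl cr !comp_atZ /= => e.
move: e; rewrite !scalerA -!sgnD => /sgn_scaleI ->; congr (_ *: _).
apply: sgn_par; rewrite -!/(deg _) !parE.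
by do 3! case: (par _).
Qed.

Lemma dif_mul_lin f x y : lin1 f ->
  f (hdif (hmul x y)) = sgn m * f (hmul (hdif x) y) + sgn (deg x + m) * f (hmul x (hdif y)).
Proof.
move=> lf; have lf' := lin1_dif lf.
have s1 a u : f (hdif (hscale a u)) = a * f (hdif u) by exact: (lin1_Z a (tagged u) lf').
have := dif_smul x y => e.
have e2 : f (hdif (smul x y)) = f (smul (hdif x) y) + sgn (sdeg x) * f (smul x (hdif y)).
  exact: lin1_eq2.
move: e2; rewrite /smul s1 => /(congr1 (fun v => sgn (m * deg x) * v)).
rewrite mulrA sgnMsgn mul1r => ->.
have s2 a u : f (hscale a u) = a * f u by rewrite /hscale (lin1_Z _ _ lf); case: u.
rewrite !s2 /sdeg !degE !sgnE !parE; case: (par m); case: (par (deg x)); rewrite /=; ring.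
Qed.

Definition cosum x F : rat := \sum_(p <- hcop x) F p.1 p.2.

Lemma cosum_fg x F :
  fglift (form_of2 F : _ -> rat^o) (\sum_(p <- hcop x) tens [:: p.1; p.2]) = cosum x F.
Proof. by rewrite raddf_sum; apply: eq_bigr => p _; rewrite /= fglift1. Qed.

Lemma cosum_lin F : bilin F -> lin1 (fun x => cosum x F).
Proof.
move=> bF k a x y; have := cop_linear a x y (multilinear_of2 bF).
rewrite linearD linearZ /=.
by rewrite -[cop (a *: x + y)]/(hcop (hom (a *: x + y))) -[cop x]/(hcop (hom x))
  -[cop y]/(hcop (hom y)) !cosum_fg.
Qed.

Lemma cosum_eq x F G : (forall p q, deg p + deg q = deg x -> F p q = G p q) ->
  cosum x F = cosum x G.
Proof. by move=> e; apply: eq_big_seq => p /cop_deg; apply: e. Qed.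

Lemma cosumD x F G : cosum x (fun p q => F p q + G p q) = cosum x F + cosum x G.
Proof. exact: big_split. Qed.
Lemma cosumN x F : cosum x (fun p q => - F p q) = - cosum x F.
Proof. exact: sumrN. Qed.
Lemma cosumB x F G : cosum x (fun p q => F p q - G p q) = cosum x F - cosum x G.
Proof. exact: sumrB. Qed.
Lemma cosumZ x F a : cosum x (fun p q => a * F p q) = a * cosum x F.
Proof. by rewrite /cosum mulr_sumr. Qed.

Lemma cosum_dif x F : bilin F ->
  cosum (hdif x) F = cosum x (fun p q => F (hdif p) q + sgn (deg p) * F p (hdif q)).
Proof.
move=> bF; have := cop_dif (tagged x) (multilinear_of2 bF).
rewrite -[cop (dif _)]/(hcop (hdif x)) cosum_fg => ->.
rewrite raddf_sum; apply: eq_bigr => p _; rewrite /= linearD linearZ /=.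
by rewrite !fglift1.
Qed.

Lemma cosumC x F : bilin F ->
  cosum x F = cosum x (fun p q => sgn (deg p * deg q) * F q p).
Proof.
move=> bF; have := copC (tagged x) (multilinear_of2 bF).
rewrite -[cop _]/(hcop x) cosum_fg => ->.
by rewrite raddf_sum; apply: eq_bigr => p _; rewrite /= linearZ /= !fglift1.
Qed.

Lemma cosumA x T : trilin T ->
  cosum x (fun p q => cosum p (fun p1 p2 => T p1 p2 q)) =
  cosum x (fun p q => cosum q (fun q1 q2 => T p q1 q2)).
Proof.
move=> tT; have := copA (tagged x) (multilinear_of3 tT).
rewrite -[cop _]/(hcop x) !raddf_sum /= => e.
transitivity (\sum_(p <- hcop x) fglift (form_of3 T : _ -> rat^o)
   (\sum_(q <- hcop p.1) tens [:: q.1; q.2; p.2])).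
  by apply: eq_bigr => p _; rewrite raddf_sum; apply: eq_bigr => q _; rewrite /= fglift1.
rewrite e; apply: eq_bigr => p _; rewrite raddf_sum; apply: eq_bigr => q _.
by rewrite /= fglift1.
Qed.

Lemma cosum_mull x y F : bilin F ->
  cosum (hmul x y) F = cosum y (fun p q => F (hmul x p) q).
Proof.
move=> bF; have := frobenius_l x y (multilinear_of2 bF); rewrite cosum_fg => ->.
by rewrite raddf_sum; apply: eq_bigr => p _; rewrite /= fglift1.
Qed.

Lemma cosum_mulr x y F : bilin F ->
  cosum (hmul x y) F = cosum x (fun p q => sgn (m * deg p) * F p (hmul q y)).
Proof.
move=> bF; have := frobenius_r x y (multilinear_of2 bF); rewrite cosum_fg => ->.
by rewrite raddf_sum; apply: eq_bigr => p _; rewrite /= linearZ /= fglift1.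
Qed.

Lemma cosum_one F : bilin F -> cosum (hone C) F = F (hone C) (hone C).
Proof.
move=> bF; have := cop_one (multilinear_of2 bF).
by rewrite -[cop _]/(hcop (hone C)) cosum_fg /= fglift1.
Qed.

(** The axiom is stated in components. A left factor of nonzero degree is killed by the counit;
    otherwise the right factor has the degree of x and [comp_at] returns it unchanged. *)
Lemma cosum_counitl x f : lin1 f -> cosum x (fun p q => heps p * f q) = f x.
Proof.
move=> lf; pose k := deg x.
transitivity (\sum_(p <- hcop x) f (hom (heps p.1 *: comp_at p.2 k))).
  apply: eq_big_seq => -[p q] /cop_deg /= e; rewrite lin1_Z //.
  have [p0|/heps_deg->] := eqVneq (deg p) 0; last by rewrite !mul0r.
  have -> : k = deg q by rewrite /k -[deg x]/(tag x) -e p0 add0r.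
  by rewrite comp_at_deg; case: q {e}.
have := counit_l x k; rewrite comp_at_deg.
rewrite -(big_morph (fun v : C k => f (hom v)) (op2 := +%R) (id2 := 0) _ (lin1_0 _ lf));
  last by move=> u v; rewrite -[u]scale1r lf scale1r mul1r.
by move=> ->; rewrite /k; case: (x).
Qed.

Lemma cosum_counitr x f : lin1 f -> cosum x (fun p q => heps q * f p) = f x.
Proof.
move=> lf; pose k := deg x.
transitivity (\sum_(p <- hcop x) f (hom (heps p.2 *: comp_at p.1 k))).
  apply: eq_big_seq => -[p q] /cop_deg /= e; rewrite lin1_Z //.
  have [p0|/heps_deg->] := eqVneq (deg q) 0; last by rewrite !mul0r.
  have -> : k = deg p by rewrite /k -[deg x]/(tag x) -e p0 addr0.
  by rewrite comp_at_deg; case: p {e}.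
have := counit_r x k; rewrite comp_at_deg.
rewrite -(big_morph (fun v : C k => f (hom v)) (op2 := +%R) (id2 := 0) _ (lin1_0 _ lf));
  last by move=> u v; rewrite -[u]scale1r lf scale1r mul1r.
by move=> ->; rewrite /k; case: (x).
Qed.

End Frob.

(** * Functionals on brackets *)

Section Splits.
Variable T : Type.
Implicit Types (s l r : seq T) (F G : seq T -> T -> seq T -> rat).

(* The sum of F l a r over all splittings s = l ++ a :: r. *)
Fixpoint ex s F : rat :=
  if s is a :: r then F [::] a r + ex r (fun l => F (a :: l)) else 0.

Lemma ex_cat s t F :
  ex (s ++ t) F = ex s (fun l a r => F l a (r ++ t)) + ex t (fun l => F (s ++ l)).
Proof. by elim: s F => [|x s IH] F /=; rewrite ?add0r // IH addrA. Qed.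

Lemma ex_rcons s x F :
  ex (rcons s x) F = ex s (fun l a r => F l a (rcons r x)) + F s x [::].
Proof.
rewrite -cats1 ex_cat /= addr0 cats0; congr (_ + _).
by congr ex; do 3! apply/funext => ?; rewrite cats1.
Qed.

Lemma ex_eq s F G : (forall l a r, s = l ++ a :: r -> F l a r = G l a r) ->
  ex s F = ex s G.
Proof.
elim: s F G => //= x s IH F G e; rewrite (e [::]) //; congr (_ + _).
by apply: IH => l a r es; apply: e; rewrite es.
Qed.

Lemma exD s F G : ex s (fun l a r => F l a r + G l a r) = ex s F + ex s G.
Proof. by elim: s F G => [|x s IH] F G /=; rewrite ?addr0 // IH; ring. Qed.
Lemma exZ s c F : ex s (fun l a r => c * F l a r) = c * ex s F.
Proof. by elim: s F => [|x s IH] F /=; rewrite ?mulr0 // IH; ring. Qed.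
Lemma exN s F : ex s (fun l a r => - F l a r) = - ex s F.
Proof. by elim: s F => [|x s IH] F /=; rewrite ?oppr0 // IH; ring. Qed.
Lemma exB s F G : ex s (fun l a r => F l a r - G l a r) = ex s F - ex s G.
Proof. by rewrite exD exN. Qed.
Lemma ex0 s : ex s (fun _ _ _ => 0) = 0.
Proof. by elim: s => //= x s ->; rewrite addr0. Qed.

Lemma ex_sum (I : Type) (q : seq I) s (F : I -> seq T -> T -> seq T -> rat) :
  \sum_(i <- q) ex s (F i) = ex s (fun l a r => \sum_(i <- q) F i l a r).
Proof.
elim: q => [|i q IH]; first by rewrite big_nil -[LHS](ex0 s); apply: ex_eq => *; rewrite big_nil.
by rewrite big_cons IH -exD; apply: ex_eq => *; rewrite big_cons.
Qed.

(** Both sides run over s = l1 ++ b :: l2 ++ a :: r; the right letter is chosen first on one side,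
    the left letter on the other. *)
Lemma ex_nest s (F : seq T -> T -> seq T -> T -> seq T -> rat) :
  ex s (fun l a r => ex l (fun l1 b l2 => F l1 b l2 a r)) =
  ex s (fun l1 b t => ex t (fun l2 a r => F l1 b l2 a r)).
Proof. by elim: s F => //= x s IH F; rewrite exD IH add0r. Qed.

Lemma ex_ord x0 s F :
  \sum_(i < size s) F (take i s) (nth x0 s i) (drop i.+1 s) = ex s F.
Proof.
elim: s F => [|x s IH] F; first by rewrite big_ord0.
by rewrite /= big_ord_recl /= drop0 -IH.
Qed.
End Splits.

Section BracketSums.
Variables (m : int) (C : dgOpenFrobenius m).
Implicit Types (s : seq (helt C)) (f : seq (helt C) -> rat).

(* As ex, with the extracted letter moved to ker eps, as is done before it is
   multiplied or becomes the entry a0 of a block. *)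
Definition exr s (F : seq (helt C) -> helt C -> seq (helt C) -> rat) : rat := ex s (fun l a r => F l (hred a) r).

(* The transpose of the differential of the bar construction. *)
Definition Dl f s : rat :=
  ex s (fun l a r => - (sgn (bdeg l) * f (l ++ hdif a :: r)) +
    cosum a (fun p q => sgn (bdeg l + deg p - 1) * f (l ++ p :: q :: r))).

End BracketSums.

Ltac gring := repeat match goal with
  | |- context [cosum ?x ?F] => move: (cosum x F) => ?
  | |- context [exr ?x ?F] => move: (exr x F) => ?
  | |- context [ex ?x ?F] => move: (ex x F) => ?
  | |- context [Dl ?x ?F] => move: (Dl x F) => ?
  | |- context [(-1 : rat) ^ ?z] => move: ((-1 : rat) ^ z) => ?
  end; ring.

(** * The bar differential and the extraction of a letter *)

Section Brackets.
Variables (m : int) (C : dgOpenFrobenius m).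
Implicit Types (x a b : helt C) (s l r t : seq (helt C)) (f : seq (helt C) -> rat).
Implicit Types (F G : seq (helt C) -> helt C -> seq (helt C) -> rat).

Lemma bdeg_nil : bdeg ([::] : seq (helt C)) = 0. Proof. exact: big_nil. Qed.
Lemma bdeg_cons x s : bdeg (x :: s) = deg x - 1 + bdeg s. Proof. exact: big_cons. Qed.
Lemma bdeg_cat s t : bdeg (s ++ t) = bdeg s + bdeg t. Proof. exact: big_cat. Qed.
Lemma bdeg_rcons s x : bdeg (rcons s x) = bdeg s + (deg x - 1).
Proof. by rewrite -cats1 bdeg_cat bdeg_cons bdeg_nil addr0. Qed.
Definition bdegE := (bdeg_nil, bdeg_cat, bdeg_rcons, bdeg_cons).

(** Functionals on bar words with letters in C/Q. *)
Definition brform f :=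
  (forall s t, lin1 (fun x => f (s ++ x :: t))) /\
  (forall s t, f (s ++ hone C :: t) = 0).

Lemma brform_lin f s t : brform f -> lin1 (fun x => f (s ++ x :: t)).
Proof. by case. Qed.

Lemma brform_ctx f l r : brform f -> brform (fun s => f (l ++ s ++ r)).
Proof.
move=> [lf rf]; split=> s t.
  by move=> k a x y; have := lf (l ++ s) (t ++ r) k a x y; rewrite -!catA.
by have := rf (l ++ s) (t ++ r); rewrite -!catA.
Qed.
Lemma brform_catl f l : brform f -> brform (fun s => f (l ++ s)).
Proof.
by move=> /(@brform_ctx f l [::]) [lf rf]; split=> s t; [move: (lf s t)|move: (rf s t)];
  rewrite ?cats0 // => h k a x y; have := h k a x y; rewrite !cats0.
Qed.
Lemma brform_catr f r : brform f -> brform (fun s => f (s ++ r)).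
Proof. by move=> /(@brform_ctx f [::] r). Qed.
Lemma brform_cons f x : brform f -> brform (fun s => f (x :: s)).
Proof. by move=> /(@brform_catl f [:: x]). Qed.
Lemma brform_rcons f x : brform f -> brform (fun s => f (rcons s x)).
Proof.
by move=> /(@brform_catr f [:: x]) [lf rf]; split=> s t; [move=> k a u v; have := lf s t k a u v|move: (rf s t)];
  rewrite ?cats1.
Qed.

Lemma brform_lin_cons f t : brform f -> lin1 (fun x => f (x :: t)).
Proof. by case=> /(_ [::] t). Qed.
Lemma brform_lin_rcons f t : brform f -> lin1 (fun x => f (rcons t x)).
Proof. by case=> /(_ t [::]) h _ k a x y; have := h k a x y; rewrite !cats1. Qed.
Lemma brform_red_cons f t : brform f -> f (hone C :: t) = 0.
Proof. by case=> _ /(_ [::] t). Qed.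

Lemma brformD f g : brform f -> brform g -> brform (fun s => f s + g s).
Proof.
move=> [lf rf] [lg rg]; split=> s t; last by rewrite rf rg addr0.
exact: lin1D.
Qed.
Lemma brformN f : brform f -> brform (fun s => - f s).
Proof. by move=> [lf rf]; split=> s t; [exact: lin1N | rewrite rf oppr0]. Qed.
Lemma brformB f g : brform f -> brform g -> brform (fun s => f s - g s).
Proof. by move=> bf bg; apply: brformD => //; apply: brformN. Qed.
Lemma brform0 : brform (fun _ => 0).
Proof. by split=> // s t; exact: lin1_const0. Qed.
Lemma brform_scale f (g : int -> rat) : brform f -> brform (fun s => g (bdeg s) * f s).
Proof.
move=> [lf rf]; split=> s t; last by rewrite rf mulr0.
by move=> k a x y; rewrite lf !bdeg_cat !bdeg_cons /=; ring.
Qed.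
Lemma brform_sum (I : Type) (q : seq I) (g : I -> seq (helt C) -> rat) :
  (forall i, brform (g i)) -> brform (fun s => \sum_(i <- q) g i s).
Proof.
move=> bg; split=> s t; last by rewrite big1 // => i _; case: (bg i).
by apply: lin1_sum => i; case: (bg i).
Qed.

(** The extracted letter is only required to enter linearly: F may be nonzero when it is the unit,
    and these values are the corrections recorded by [Dl_exr]. *)
Definition triform F :=
  [/\ forall a r, brform (fun l => F l a r),
      forall l r, lin1 (fun a => F l a r) &
      forall l a, brform (F l a)].

Lemma exr_eq s F G : (forall l a r, heps a = 0 -> bdeg s = bdeg l + (deg a - 1) + bdeg r ->
   F l a r = G l a r) -> exr s F = exr s G.
Proof.
move=> e; apply: ex_eq => l a r es; apply: e; first exact: heps_hred.
by rewrite es !bdegE deg_hred; ring.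
Qed.

Lemma exrD s F G : exr s (fun l a r => F l a r + G l a r) = exr s F + exr s G.
Proof. exact: exD. Qed.
Lemma exrN s F : exr s (fun l a r => - F l a r) = - exr s F.
Proof. exact: exN. Qed.
Lemma exrB s F G : exr s (fun l a r => F l a r - G l a r) = exr s F - exr s G.
Proof. exact: exB. Qed.
Lemma exrZ s c F : exr s (fun l a r => c * F l a r) = c * exr s F.
Proof. exact: exZ. Qed.
Lemma exr_cons x s F : exr (x :: s) F = F [::] (hred x) s + exr s (fun l => F (x :: l)).
Proof. by []. Qed.
Lemma exr_rcons s x F :
  exr (rcons s x) F = exr s (fun l a r => F l a (rcons r x)) + F s (hred x) [::].
Proof. exact: ex_rcons. Qed.
Lemma exr_cat s t F :
  exr (s ++ t) F = exr s (fun l a r => F l a (r ++ t)) + exr t (fun l => F (s ++ l)).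
Proof. exact: ex_cat. Qed.
Lemma exr_nest s (F : seq (helt C) -> helt C -> seq (helt C) -> helt C -> seq (helt C) -> rat) :
  exr s (fun l a r => exr l (fun l1 b l2 => F l1 b l2 a r)) =
  exr s (fun l1 b t => exr t (fun l2 a r => F l1 b l2 a r)).
Proof. exact: (ex_nest _ (fun l1 b l2 a r => F l1 (hred b) l2 (hred a) r)). Qed.

Lemma lin1_ex s (F : helt C -> seq (helt C) -> helt C -> seq (helt C) -> rat) :
  (forall l a r, lin1 (fun x => F x l a r)) -> lin1 (fun x => ex s (F x)).
Proof.
elim: s F => [|y s IH] F lF /=; first exact: lin1_const0.
by apply: lin1D => //; apply: IH => l a r; apply: lF.
Qed.

Lemma brform_ex s (F : seq (helt C) -> seq (helt C) -> helt C -> seq (helt C) -> rat) :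
  (forall l a r, brform (fun u => F u l a r)) -> brform (fun u => ex s (F u)).
Proof.
elim: s F => [|y s IH] F lF /=; first exact: brform0.
by apply: brformD => //; apply: IH => l a r; apply: lF.
Qed.

(** If the unit is the extracted letter, [hred] sends it to zero; in any other position F is already
    reduced. *)
Lemma brform_exr F : triform F -> brform (fun s => exr s F).
Proof.
move=> [F1 F2 F3]; split=> s t.
  have -> : (fun x => exr (s ++ x :: t) F) = (fun x =>
     exr s (fun l a r => F l a (r ++ x :: t)) + (F s (hred x) t +
     exr t (fun l a r => F (s ++ x :: l) a r))).
    by apply/funext => x; rewrite exr_cat exr_cons cats0.
  apply: lin1D; first by apply: lin1_ex => l a r; apply: brform_lin (F3 _ _).
  apply: lin1D; first exact: (lin1_hred (F2 _ _)).
  by apply: lin1_ex => l a r; apply: brform_lin (F1 _ _).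
rewrite exr_cat exr_cons cats0 (hred_one (F2 _ _)) add0r.
rewrite /exr (ex_eq (G := fun _ _ _ => 0)) ?ex0 ?add0r => [|l a r _]; last by case: (F3 l (hred a)).
rewrite (ex_eq (G := fun _ _ _ => 0)) ?ex0 // => l a r _.
by case: (F1 (hred a) r) => _ /(_ s l).
Qed.

Lemma Dl_nil f : Dl f [::] = 0. Proof. by []. Qed.

Lemma cosumZ' x (F : helt C -> helt C -> rat) (c : rat) : c * cosum x F = cosum x (fun p q => c * F p q).
Proof. by rewrite cosumZ. Qed.

Lemma Dl_cons f x s : Dl f (x :: s) = - f (hdif x :: s) +
  cosum x (fun p q => sgn (deg p - 1) * f (p :: q :: s)) +
  sgn (deg x - 1) * Dl (fun t => f (x :: t)) s.
Proof.
rewrite /Dl /= bdeg_nil expr0z mul1r -exZ; congr (_ + _ + _).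
  by apply: cosum_eq => p q _; rewrite add0r.
apply: ex_eq => l a r _; rewrite mulrDr mulrN mulrA -sgnD -bdeg_cons; congr (_ + _).
rewrite cosumZ'; apply: cosum_eq => p q _; rewrite mulrA -sgnD bdeg_cons.
by congr (sgn _ * _); ring.
Qed.

Lemma Dl_eq f g s : f =1 g -> Dl f s = Dl g s.
Proof. by move=> /funext ->. Qed.

Lemma DlD f g s : Dl (fun t => f t + g t) s = Dl f s + Dl g s.
Proof.
rewrite /Dl -exD; apply: ex_eq => l a r _.
have -> : cosum a (fun p q => sgn (bdeg l + deg p - 1) * (f (l ++ p :: q :: r) + g (l ++ p :: q :: r))) =
    cosum a (fun p q => sgn (bdeg l + deg p - 1) * f (l ++ p :: q :: r))
  + cosum a (fun p q => sgn (bdeg l + deg p - 1) * g (l ++ p :: q :: r)).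
  by rewrite -cosumD; apply: cosum_eq => p q _; rewrite mulrDr.
by rewrite mulrDr; gring.
Qed.
Lemma DlZ f c s : Dl (fun t => c * f t) s = c * Dl f s.
Proof.
rewrite /Dl -exZ; apply: ex_eq => l a r _; rewrite mulrDr cosumZ'.
congr (_ + _); first by gring.
by apply: cosum_eq => p q _; gring.
Qed.
Lemma Dl0 s : Dl (fun _ => 0) s = 0.
Proof. by rewrite (Dl_eq (g := fun _ => 0 * 0)) ?DlZ ?mul0r // => ?; rewrite mulr0. Qed.
Lemma Dl_sum (I : Type) (q : seq I) (g : I -> seq (helt C) -> rat) s :
  Dl (fun t => \sum_(i <- q) g i t) s = \sum_(i <- q) Dl (g i) s.
Proof.
elim: q => [|i q IH]; first by rewrite big_nil -[RHS](Dl0 s); apply: Dl_eq => t; rewrite big_nil.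
by rewrite big_cons -IH -DlD; apply: Dl_eq => t; rewrite big_cons.
Qed.

Lemma Dl_cat f s t : Dl f (s ++ t) =
  Dl (fun l => f (l ++ t)) s + sgn (bdeg s) * Dl (fun r => f (s ++ r)) t.
Proof.
elim: s f => [|x s IH] f; first by rewrite Dl_nil bdeg_nil expr0z mul1r add0r.
by rewrite /= !Dl_cons IH /= mulrDr mulrA -sgnD bdeg_cons; gring.
Qed.

Lemma Dl_ex s t (F : seq (helt C) -> seq (helt C) -> helt C -> seq (helt C) -> rat) :
  Dl (fun u => ex t (F u)) s = ex t (fun l a r => Dl (fun u => F u l a r) s).
Proof.
elim: t F => [|x t IH] F /=; first exact: Dl0.
by rewrite DlD IH.
Qed.

Lemma lin1_Dl s (f : helt C -> seq (helt C) -> rat) :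
  (forall t, lin1 (fun x => f x t)) -> lin1 (fun x => Dl (f x) s).
Proof.
move=> lf; apply: lin1_ex => l a r; apply: lin1D.
  by apply: lin1N; apply: (lin1_scale (fun _ => _)).
by apply: lin1_sum => p; apply: (lin1_scale (fun _ => _)).
Qed.

Lemma brform_Dl f : brform f -> brform (Dl f).
Proof.
move=> bf; split=> s t.
  have -> : (fun x => Dl f (s ++ x :: t)) = (fun x => Dl (fun l => f (l ++ x :: t)) s +
     sgn (bdeg s) * (- f (s ++ hdif x :: t) +
  cosum x (fun p q => sgn (deg p - 1) * f (s ++ p :: q :: t)) +
  sgn (deg x - 1) * Dl (fun r => f (s ++ x :: r)) t)).
    by apply/funext => x; rewrite Dl_cat Dl_cons.
  apply: lin1D; first by apply: lin1_Dl => l; apply: brform_lin.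
  apply: (lin1_scale (fun _ => _)).
  apply: lin1D; first apply: lin1D.
  - by apply: lin1N; apply: (lin1_dif (brform_lin _ _ bf)).
  - apply: cosum_lin; split=> u; first by apply: (lin1_scale (fun d => sgn (d - 1))); apply: brform_lin.
    apply: (lin1_scale (fun _ => _)) => k a x y.
    by have := (bf.1 (rcons s u) t) k a x y; rewrite !cat_rcons.
  - apply: (lin1_scale (fun d => sgn (d - 1))); apply: lin1_Dl => r; exact: brform_lin.
rewrite Dl_cat Dl_cons (Dl_eq (g := fun _ => 0)) ?Dl0 => [|l]; last by case: bf.
rewrite (lin1_dif_one (brform_lin _ _ bf)) (Dl_eq (g := fun _ => 0)) ?Dl0 => [|l]; last by case: bf.
rewrite cosum_one; first by case: bf => _ ->; gring.
split=> u; first by apply: (lin1_scale (fun d => sgn (d - 1))); apply: brform_lin.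
apply: (lin1_scale (fun _ => _)) => k a x y.
by have := (bf.1 (rcons s u) t) k a x y; rewrite !cat_rcons.
Qed.

(* The transpose of the differential on a bracket with one extracted letter: by
   Dl_exr, exr commutes with it up to the two terms in which the coproduct of
   the extracted letter creates a unit. *)
Definition DF F l a r : rat :=
  Dl (fun l' => F l' a r) l - sgn (bdeg l) * F l (hdif a) r
  + sgn (bdeg l + deg a - 1) * Dl (F l a) r
  + cosum a (fun p q => sgn (bdeg l + deg p - 1) * (F (rcons l p) q r + F l p (q :: r))).

(** Induction on the bracket: the unit corrections of neighbouring letters telescope, and only those
    at the two ends remain. *)
Lemma Dl_exr F s : triform F ->
  Dl (fun s => exr s F) s =
  exr s (DF F) + F [::] (hone C) s - sgn (bdeg s) * F s (hone C) [::].
Proof.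
elim: s F => [|x s IH] F tF.
  by rewrite Dl_nil bdeg_nil /exr /= expr0z; gring.
have [F1 F2 F3] := tF.
have tFx : triform (fun l => F (x :: l)) by split=> // a r; apply: brform_cons (F1 a r).
rewrite Dl_cons bdeg_cons.
have -> : Dl (fun t => exr (x :: t) F) s =
   Dl (F [::] (hred x)) s + Dl (fun t => exr t (fun l => F (x :: l))) s.
  by rewrite -DlD.
rewrite IH //.
have -> : cosum x (fun p q => sgn (deg p - 1) * exr (p :: q :: s) F) =
  cosum x (fun p q => sgn (deg p - 1) * (F [::] (hred p) (q :: s) + F [:: p] (hred q) s)) +
  exr s (fun l a r => cosum x (fun p q => sgn (deg p - 1) * F (p :: q :: l) a r)).
  transitivity (cosum x (fun p q => sgn (deg p - 1) * (F [::] (hred p) (q :: s) + F [:: p] (hred q) s))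
     + cosum x (fun p q => exr s (fun l a r => sgn (deg p - 1) * F (p :: q :: l) a r))).
    by rewrite -cosumD; apply: cosum_eq => p q _; rewrite exrZ !exr_cons; gring.
  by congr (_ + _); rewrite /cosum /exr ex_sum.
have -> : exr s (fun l a r => cosum x (fun p q => sgn (deg p - 1) * F (p :: q :: l) a r)) =
    exr s (fun l => DF F (x :: l)) + exr s (fun l => F (hdif x :: l))
    - sgn (deg x - 1) * exr s (DF (fun l => F (x :: l))).
  rewrite -exrZ -exrD -exrB; apply: exr_eq => l a r _ _.
  rewrite /DF Dl_cons bdeg_cons /=.
  have -> : cosum a (fun p q => sgn (deg x - 1 + bdeg l + deg p - 1) *
       (F (x :: rcons l p) q r + F (x :: l) p (q :: r))) =
     sgn (deg x - 1) * cosum a (fun p q => sgn (bdeg l + deg p - 1) *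
       (F (x :: rcons l p) q r + F (x :: l) p (q :: r))).
    rewrite cosumZ'; apply: cosum_eq => p q _; rewrite mulrA -sgnD; congr (sgn _ * _); ring.
  by rewrite !sgnD; gring.
have lF l u := lin1_hred (F2 l u).
pose G p q := sgn (0 + deg p - 1) * (F [:: p] q s + F [::] p (q :: s)).
have bG : bilin G.
  split=> u; [apply: (lin1_scale (fun d => sgn (0 + d - 1)))|apply: (lin1_scale (fun _ => _))].
    by apply: lin1D; [exact: brform_lin_cons (F1 _ _) | exact: F2].
  by apply: lin1D; [exact: F2 | exact: brform_lin_cons (F3 _ _)].
have G1 : G (hone C) (hone C) = 0.
  by rewrite /G (brform_red_cons _ (F1 _ _)) (brform_red_cons _ (F3 _ _)) addr0 mulr0.
(* Passing to [hred x] changes nothing, because both terms of G at the unit have a unit among their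
   bracket letters. *)
have eG : cosum (hred x) G = cosum x G.
  by rewrite (hred_lin _ (cosum_lin bG)) cosum_one // G1 mulr0 subr0.
(* The coproduct of x puts [hred p] or [hred q] in the extracted place. By the counit the two
   corrections become a unit extracted just before or just after x; the latter cancels the left end
   term of the induction hypothesis. *)
have -> : cosum x (fun p q => sgn (deg p - 1) * (F [::] (hred p) (q :: s) + F [:: p] (hred q) s)) =
   cosum x G + F [::] (hone C) (x :: s) - sgn (deg x - 1) * F [:: x] (hone C) s.
  have <- := cosum_counitl x (brform_lin_cons s (F3 [::] (hone C))).
  have <- : cosum x (fun p q => heps q * (sgn (deg p - 1) * F [:: p] (hone C) s)) =
     sgn (deg x - 1) * F [:: x] (hone C) s.
    by apply: (@cosum_counitr _ _ x (fun p => sgn (deg p - 1) * F [:: p] (hone C) s));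
      apply: (lin1_scale (fun d => sgn (d - 1))); exact: brform_lin_cons (F1 _ _).
  rewrite -cosumD -cosumB; apply: cosum_eq => p q _.
  rewrite /G add0r !(hred_lin _ (F2 _ _)).
  have [/eqP p0|/heps_deg->] := boolP (deg p == 0); last by gring.
  by rewrite p0 sub0r (_ : sgn (-1) = -1) //; gring.
have eDF : DF F [::] (hred x) s =
    - F [::] (hdif x) s + sgn (deg x - 1) * Dl (F [::] (hred x)) s + cosum x G.
  rewrite -eG /DF -[deg (hred x)]/(deg x) Dl_nil bdeg_nil.
  rewrite (hred_lin _ (lin1_dif (F2 _ _))) (lin1_dif_one (F2 _ _)) mulr0 subr0.
  by rewrite expr0z !add0r mul1r.
rewrite !exr_cons eDF (hred_lin _ (F2 _ _)) heps_dif mul0r subr0 !sgnD.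
by gring.
Qed.
End Brackets.

Ltac parity := rewrite ?parEb; btauto.
Ltac sgneq := apply: sgn_par; parity.
(** Merges each product of signs into one sign, then identifies signs of equal or opposite parity,
    so that [ring] sees a single variable for them. *)
Ltac sgnring :=
  rewrite ?(@mulrDr rat, @mulrN rat, @mulNr rat, @mul0r rat, @mulr0 rat, @addr0 rat, @subr0 rat, @oppr0 rat);
  rewrite ?(@mulrA rat) -?sgnD;
  repeat match goal with |- context [(-1 : rat) ^ ?S] =>
    let s := fresh "s" in let H := fresh "H" in
    assert (H : exists s, s = sgn S) by (eexists; reflexivity); destruct H as [s H];
    rewrite -H;
    repeat match goal with |- context [(-1 : rat) ^ ?e] =>
      first [ rewrite (_ : sgn e = s); [| rewrite H; apply: sgn_par; parity]
            | rewrite (_ : sgn e = - s); [| rewrite H; apply: sgn_parN; parity]] end; clear H end;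
  gring.
Ltac sgncases := rewrite ?sgnE ?parE /=; repeat match goal with
  | |- context [par ?x] => move: (par x) => [] end; rewrite /=; gring.

Arguments deg : simpl never.

(** * Cutting a block out of a bracket *)

Section Cut.
Variables (m : int) (C : dgOpenFrobenius m).
Implicit Types (x a b : helt C) (s l r t w : seq (helt C)) (B : block C).
Implicit Types (f : seq (helt C) -> block C -> seq (helt C) -> rat).

Definition bform (g : block C -> rat) :=
  (forall s, lin1 (fun a => g (a, s))) /\ (forall a, brform (fun s => g (a, s))).

(* The transpose of b. *)
Definition bd (g : block C -> rat) (B : block C) : rat :=
  let: (a0, s) := B in
  g (hdif a0, s) + sgn (deg a0) * Dl (fun t => g (a0, t)) s +
  cosum a0 (fun p q => sgn (deg p) *
    (g (p, q :: s) - sgn ((deg q - 1) * bdeg s) * g (p, rcons s q))).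

Arguments bd : simpl never.

Lemma bdE (g : block C -> rat) a0 s : bd g (a0, s) =
  g (hdif a0, s) + sgn (deg a0) * Dl (fun t => g (a0, t)) s +
  cosum a0 (fun p q => sgn (deg p) *
    (g (p, q :: s) - sgn ((deg q - 1) * bdeg s) * g (p, rcons s q))).
Proof. by []. Qed.

(* The homotopies below cut l a w b r into the bracket l r and the block
   (a b)[w]; kap is the Koszul sign of this cut. *)
Definition kap l a w b r : int :=
  (deg b - 1) * bdeg w + bdeg r * (deg a + deg b + bdeg w) + bdeg l + bdeg r + deg a.

Definition cut1 f l a t : rat :=
  exr t (fun w b r => sgn (kap l a w b r) * f l (hmul a b, w) r).
Definition cut f s : rat := exr s (cut1 f).

(** The last clause says that the cut block lives in the reduced complex; cuts at two adjacent
    letters then contribute nothing. *)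
Definition cutform f :=
  [/\ forall B r, brform (fun l => f l B r), forall l r, bform (fun B => f l B r),
      forall l B, brform (f l B) & forall l a r, f l (a, [::]) r = 0].

(** The transpose of the differential on the bracket l ++ r followed by the block B; the exponent
    [m + 1] has the parity of the shift [1 - m]. *)
Definition cutD f l B r : rat :=
  Dl (fun l => f l B r) l + sgn (bdeg l) * Dl (f l B) r +
  sgn (bdeg l + bdeg r + m + 1) * bd (fun B => f l B r) B.

(** The two ways in which a factor of the coproduct of a b leaves the block: as last letter of l,
    from the coproduct of a, or as first letter of r, from that of b. *)
Definition cutI f l B r : rat :=
  cosum B.1 (fun p y => sgn ((m + bdeg r + 1) * deg p + bdeg l) *
    (f (rcons l p) (y, B.2) r - f l (y, B.2) (p :: r))).

Lemma Dl_sgn (g : int -> rat) (h : seq (helt C) -> rat) s :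
  Dl (fun t => g (bdeg t) * h t) s = g (bdeg s - 1) * Dl h s.
Proof.
rewrite /Dl -exZ; apply: ex_eq => l a r es; rewrite mulrDr cosumZ'; congr (_ + _).
  rewrite (_ : bdeg (l ++ hdif a :: r) = bdeg s - 1); first by gring.
  by rewrite es !bdegE deg_hdif; ring.
apply: cosum_eq => p q e; rewrite (_ : bdeg (l ++ p :: q :: r) = bdeg s - 1); first by gring.
by rewrite es !bdegE -e; ring.
Qed.

Lemma cosum_exr a s (F : helt C -> helt C -> seq (helt C) -> helt C -> seq (helt C) -> rat) :
  cosum a (fun p q => exr s (F p q)) = exr s (fun l b r => cosum a (fun p q => F p q l b r)).
Proof. exact: ex_sum. Qed.

(** With cocommutativity the two Frobenius axioms yield two more forms, so that a coproduct of a or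
    of b can be traded for one of a b whichever factor receives the product. *)
Lemma cosum_mulL a b (G : helt C -> helt C -> rat) : bilin G ->
  cosum (hmul a b) G = cosum a (fun p q => sgn (deg q * deg b) * G (hmul p b) q).
Proof.
move=> bG; have [G1 G2] := bG; rewrite cosumC // cosum_mulr; last first.
  split=> y; [apply: (lin1_scale (fun d => sgn (d * deg y))) | apply: (lin1_scale (fun d => sgn (_ * d)))] => //.
rewrite cosumC; last first.
  split=> y; [apply: (lin1_scale (fun d => sgn (m * d))) | apply: (lin1_scale (fun _ => _))].
    by apply: (lin1_scale (fun d => sgn (d * deg (hmul y b)))).
  apply: (lin1_mull (f := fun z => sgn (deg y * deg z) * G z y)).
  exact: (lin1_scale (fun d => sgn (_ * d))).
apply: cosum_eq => p q _; rewrite !mulrA -!sgnD; congr (_ * _).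
by rewrite deg_hmul; sgneq.
Qed.

Lemma cosum_mulR a b (G : helt C -> helt C -> rat) : bilin G ->
  cosum (hmul a b) G = cosum b (fun p q => sgn (deg p * deg q) * G (hmul a q) p).
Proof.
move=> bG; have [G1 G2] := bG; rewrite cosum_mull // cosumC //.
by split=> y //; apply: (lin1_mulr' (f := fun z => G z y)).
Qed.

Lemma bform_lin g s : bform g -> lin1 (fun a => g (a, s)). Proof. by case. Qed.
Lemma bform_br g a : bform g -> brform (fun s => g (a, s)). Proof. by case. Qed.

Section CutForm.
Variables (f : seq (helt C) -> block C -> seq (helt C) -> rat) (cf : cutform f).

Let cl B r : brform (fun l => f l B r). Proof. by case: cf. Qed.
Let cB l r : bform (fun B => f l B r). Proof. by case: cf. Qed.
Let cr l B : brform (f l B). Proof. by case: cf. Qed.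
Let c0 l a r : f l (a, [::]) r = 0. Proof. by case: cf. Qed.

Definition cut2 l a w b r := sgn (kap l a w b r) * f l (hmul a b, w) r.

Lemma triform_cut2 l a : triform (cut2 l a).
Proof.
split=> [b r|w r|w b]; rewrite /cut2 /kap.
- by apply: (brform_scale (fun d => sgn ((deg b - 1) * d + bdeg r * (deg a + deg b + d) + bdeg l + bdeg r + deg a)));
    apply: (bform_br _ (cB _ _)).
- apply: (lin1_scale (fun d => sgn ((d - 1) * bdeg w + bdeg r * (deg a + d + bdeg w) + bdeg l + bdeg r + deg a))).
  by apply: (lin1_mulr' (f := fun y => f l (y, w) r)); apply: bform_lin (cB _ _).
- apply: (brform_scale (fun d => sgn ((deg b - 1) * bdeg w + d * (deg a + deg b + bdeg w) + bdeg l + d + deg a))).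
  exact: cr.
Qed.

Lemma triform_cut1 : triform (cut1 f).
Proof.
split=> [a t|l t|l a].
- apply: brform_ex => w b r; rewrite /kap.
  by apply: (brform_scale (fun d => sgn ((deg (hred b) - 1) * bdeg w + bdeg r * (deg a + deg (hred b) + bdeg w) + d + bdeg r + deg a)));
    apply: cl.
- apply: lin1_ex => w b r; rewrite /kap.
  apply: (lin1_scale (fun d => sgn ((deg (hred b) - 1) * bdeg w + bdeg r * (d + deg (hred b) + bdeg w) + bdeg l + bdeg r + d))).
  by apply: (lin1_mull (f := fun y => f l (y, w) r)); apply: bform_lin (cB _ _).
- by apply: brform_exr; apply: triform_cut2.
Qed.

(** The coproducts of a and b give four insertions, each a coproduct of a b by a Frobenius identity:
    two leave the block ([cutI]), two enter its bracket and are part of [bd]. Extracting b adds the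
    end terms of [Dl_exr]: at the left end the block is empty, at the right end the product with the
    unit stays. *)
Lemma DF_cut1 l a t :
  DF (cut1 f) l a t = exr t (fun w b r => sgn (kap l a w b r) *
    (cutI f l (hmul a b, w) r - cutD f l (hmul a b, w) r)) + f l (hmul a (hone C), t) [::].
Proof.
rewrite /DF.
have -> : Dl (fun l' => cut1 f l' a t) l =
    exr t (fun w b r => - sgn (kap l a w b r) * Dl (fun l' => f l' (hmul a b, w) r) l).
  rewrite /cut1 Dl_ex; apply: ex_eq => w b r _.
  rewrite (Dl_sgn (fun d => sgn ((deg (hred b) - 1) * bdeg w + bdeg r * (deg a + deg (hred b) + bdeg w) + d + bdeg r + deg a))).
  by congr (_ * _); rewrite /kap; sgncases.
rewrite (Dl_exr _ (triform_cut2 l a)).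
have -> : cut2 l a [::] (hone C) t = 0 by rewrite /cut2 c0 mulr0.
have -> : cosum a (fun p q => sgn (bdeg l + deg p - 1) *
     (cut1 f (rcons l p) q t + cut1 f l p (q :: t))) =
  exr t (fun w b r => sgn (kap l a w b r) * cosum (hmul a b) (fun p y =>
      sgn ((m + bdeg r + 1) * deg p + bdeg l) * f (rcons l p) (y, w) r)) +
  exr t (fun w b r => sgn (kap l a w b r + bdeg l + bdeg r + m) * cosum (hmul a b) (fun p q =>
      sgn (deg p) * f l (p, q :: w) r)).
  rewrite -exrD.
  transitivity (cosum a (fun p q => exr t (fun w b r => sgn (bdeg l + deg p - 1) *
     (sgn (kap (rcons l p) q w b r) * f (rcons l p) (hmul q b, w) r +
      sgn (kap l p (q :: w) b r) * f l (hmul p b, q :: w) r)))).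
    apply: cosum_eq => p q _; rewrite exrZ exrD; congr (_ * (_ + _)).
    by rewrite /cut1 exr_cons c0 mulr0 add0r.
  rewrite cosum_exr; apply: exr_eq => w b r _ _.
  rewrite cosum_mulr; last first.
    split=> y; first by apply: (lin1_scale (fun d => sgn (_ * d + _))); apply: brform_lin_rcons (cl _ _).
    by apply: (lin1_scale (fun d => _)); apply: bform_lin (cB _ _).
  rewrite cosum_mulL; last first.
    split=> y; first by apply: (lin1_scale (fun d => sgn d)); apply: bform_lin (cB _ _).
    by apply: (lin1_scale (fun _ => _)); apply: brform_lin_cons (bform_br _ (cB _ _)).
  rewrite !cosumZ' -cosumD; apply: cosum_eq => p q e.
  rewrite mulrDr !mulrA -!sgnD; congr (_ * _ + _ * _).
    by rewrite /kap !bdegE -e; sgneq.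
  by rewrite /kap !bdegE deg_hmul -e; sgneq.
have eb w b r : cosum b (fun p q => sgn (bdeg w + deg p - 1) *
    (cut2 l a (rcons w p) q r + cut2 l a w p (q :: r))) =
   sgn (kap l a w b r + bdeg l + deg a - 1) * (
     - (sgn (bdeg l + bdeg r + m + 1) * cosum (hmul a b) (fun p q =>
      - (sgn (deg p + (deg q - 1) * bdeg w) * f l (p, rcons w q) r))) -
     cosum (hmul a b) (fun p y =>
      sgn ((m + bdeg r + 1) * deg p + bdeg l) * f l (y, w) (p :: r))).
  rewrite cosum_mulR; last first.
    split=> y; apply: lin1N.
      by apply: (lin1_scale (fun d => sgn (d + _))); apply: bform_lin (cB _ _).
    by apply: (lin1_scale (fun d => sgn (_ + (d - 1) * _))); apply: brform_lin_rcons (bform_br _ (cB _ _)).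
  rewrite [cosum (hmul a b) _]cosumC; last first.
    split=> y; first by apply: (lin1_scale (fun d => sgn (_ * d + _))); apply: brform_lin_cons (cr _ _).
    by apply: (lin1_scale (fun d => _)); apply: bform_lin (cB _ _).
  rewrite cosum_mull; last first.
    split=> y.
      by apply: (lin1_scale (fun d => sgn (d * _))); apply: (lin1_scale (fun _ => _)); apply: bform_lin (cB _ _).
    by apply: (lin1_scale (fun d => sgn (_ * d))); apply: (lin1_scale (fun d => sgn (_ * d + _))); apply: brform_lin_cons (cr _ _).
  rewrite cosumZ' -!cosumN -cosumD cosumZ'; apply: cosum_eq => p q e.
  rewrite /cut2 /kap !bdegE deg_hmul -e.
  by sgncases.
have e1 : sgn (bdeg l + deg a - 1) * (- (sgn (bdeg t) * cut2 l a t (hone C) [::])) =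
    f l (hmul a (hone C), t) [::].
  rewrite mulrN /cut2 !mulrA -!sgnD -mulN1r mulrA -[-1]/(sgn 1) -sgnD.
  by rewrite -[RHS]mul1r; congr (_ * _); rewrite -[RHS]/(sgn 0) /kap bdeg_nil deg_hone; sgneq.
rewrite addr0 mulrDr e1; set E := f l _ [::].
rewrite [_ + (_ + E)]addrA [_ + E + _]addrAC; congr (_ + E); rewrite {E e1} /cut1.
rewrite -!exrZ -exrB -!exrD; apply: exr_eq => w b r _ _.
rewrite {1}/DF eb /cutI /cutD /bd.
rewrite (dif_mul_lin _ _ (bform_lin _ (cB _ _))).
rewrite /cut2 (Dl_sgn (fun d => sgn ((deg b - 1) * d + bdeg r * (deg a + deg b + d) + bdeg l + bdeg r + deg a))).
rewrite (Dl_sgn (fun d => sgn ((deg b - 1) * bdeg w + d * (deg a + deg b + bdeg w) + bdeg l + d + deg a))).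
set I1 := cosum _ (fun p y => sgn _ * f (rcons l p) _ _).
set I2 := cosum _ (fun p y => sgn _ * f l _ (p :: r)).
have -> : cosum (hmul a b, w).1 (fun p y => sgn ((m + bdeg r + 1) * deg p + bdeg l) *
  (f (rcons l p) (y, (hmul a b, w).2) r - f l (y, (hmul a b, w).2) (p :: r))) = I1 - I2.
  by rewrite -cosumB; apply: cosum_eq => p q _; rewrite mulrBr.
set I3 := cosum _ (fun p q => sgn (deg p) * f l (p, q :: w) r).
set I4 := cosum _ (fun p q => - _).
have -> : cosum (hmul a b) (fun p q => sgn (deg p) * (f l (p, q :: w) r -
   sgn ((deg q - 1) * bdeg w) * f l (p, rcons w q) r)) = I3 + I4.
  by rewrite -cosumD; apply: cosum_eq => p q _; rewrite mulrBr mulrA -sgnD.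
move: I1 I2 I3 I4 => I1 I2 I3 I4.
rewrite /kap !degE.
by sgncases.
Qed.

(** The last two terms extract the unit as a at the left end, or as b at the right end. Each use of
    the lemma pairs them with a letter inserted at that end. *)
Lemma Dl_cut s : Dl (cut f) s =
  cut (fun l B r => cutI f l B r - cutD f l B r) s +
  exr s (fun w b r => sgn (kap [::] (hone C) w b r) * f [::] (hmul (hone C) b, w) r) +
  exr s (fun l a w => f l (hmul a (hone C), w) [::]).
Proof.
rewrite (Dl_exr _ triform_cut1) /cut [exr s (DF _)](_ : _ =
  exr s (cut1 (fun l B r => cutI f l B r - cutD f l B r)) +
  exr s (fun l a w => f l (hmul a (hone C), w) [::])); last first.
  by rewrite -exrD; apply: exr_eq => l a r _ _; rewrite DF_cut1.
(* A unit extracted as a at the right end leaves no letter for b. *)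
by rewrite {3}/cut1 /exr /= mulr0 subr0 addrAC.
Qed.
End CutForm.
End Cut.

Arguments bd : simpl never.
Arguments deg : simpl never.

(** * Transposes of the operations *)

Section Words.
Variables (m : int) (C : dgOpenFrobenius m).
Implicit Types (x y a b : helt C) (s l r t : seq (helt C)) (B : block C).
Implicit Types (phi psi : word C -> rat).

(* Reduced functionals that also vanish on blocks with an empty bracket, i.e.
   functionals on tensor powers of the reduced complex. *)
Definition nform phi :=
  (forall u v, bform (fun B => phi (u ++ B :: v))) /\
  (forall u a v, phi (u ++ (a, [::]) :: v) = 0).

Lemma reduced_formP phi : reduced_form phi <-> forall u v, bform (fun B => phi (u ++ B :: v)).
Proof.
split=> [[h1 h2 h3] u v|h].
  split=> [s k a x y|a0]; first exact: h1.
  by split=> s t; [move=> k a x y; apply: h2 | apply: h3].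
split=> [u v s k a x y|u v a0 s t k a x y|u v a0 s t].
- by case: (h u v) => /(_ s k a x y).
- by case: (h u v) => _ /(_ a0) [/(_ s t k a x y)].
- by case: (h u v) => _ /(_ a0) [_ /(_ s t)].
Qed.

Section Nform.
Variables (phi : word C -> rat) (nf : nform phi).
Lemma nf_b1 v : bform (fun B => phi (B :: v)).
Proof. by case: nf => /(_ [::] v). Qed.
Lemma nf_b2 B v : bform (fun B' => phi (B :: B' :: v)).
Proof. by case: nf => /(_ [:: B] v). Qed.
Lemma nf_b3 B B' v : bform (fun B'' => phi (B :: B' :: B'' :: v)).
Proof. by case: nf => /(_ [:: B; B'] v). Qed.
Lemma nf_l1 s v : lin1 (fun a => phi ((a, s) :: v)).
Proof. exact: (nf_b1 v).1. Qed.
Lemma nf_l2 B s v : lin1 (fun a => phi (B :: (a, s) :: v)).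
Proof. exact: (nf_b2 B v).1. Qed.
Lemma nf_l3 B B' s v : lin1 (fun a => phi (B :: B' :: (a, s) :: v)).
Proof. exact: (nf_b3 B B' v).1. Qed.
Lemma nf_r1 a v : brform (fun s => phi ((a, s) :: v)).
Proof. exact: (nf_b1 v).2. Qed.
Lemma nf_r2 B a v : brform (fun s => phi (B :: (a, s) :: v)).
Proof. exact: (nf_b2 B v).2. Qed.
Lemma nf_r3 B B' a v : brform (fun s => phi (B :: B' :: (a, s) :: v)).
Proof. exact: (nf_b3 B B' v).2. Qed.
Lemma nf_01 a v : phi ((a, [::]) :: v) = 0.
Proof. exact: (nf.2 [::] a v). Qed.
Lemma nf_02 B a v : phi (B :: (a, [::]) :: v) = 0.
Proof. exact: (nf.2 [:: B] a v). Qed.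
Lemma nf_03 B B' a v : phi (B :: B' :: (a, [::]) :: v) = 0.
Proof. exact: (nf.2 [:: B; B'] a v). Qed.
End Nform.

(** The transpose of the total differential on a tensor product of copies shifted by c; recursion on
    the word exposes the Koszul sign of its first factor. *)
Fixpoint bt (c : int) phi w : rat :=
  if w is B :: v then
    bd (fun B' => phi (B' :: v)) B + sgn (block_deg B - c) * bt c (fun v' => phi (B :: v')) v
  else 0.

Lemma bt1E c phi B : bt c phi [:: B] = bd (fun B' => phi [:: B']) B.
Proof. by rewrite /= mulr0 addr0. Qed.
Lemma bt2E c phi B1 B2 : bt c phi [:: B1; B2] =
  bd (fun B' => phi [:: B'; B2]) B1 + sgn (block_deg B1 - c) * bd (fun B' => phi [:: B1; B']) B2.
Proof. by rewrite /= mulr0 addr0. Qed.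
Lemma bt3E c phi B1 B2 B3 : bt c phi [:: B1; B2; B3] =
  bd (fun B' => phi [:: B'; B2; B3]) B1 + sgn (block_deg B1 - c) *
  (bd (fun B' => phi [:: B1; B'; B3]) B2 + sgn (block_deg B2 - c) * bd (fun B' => phi [:: B1; B2; B']) B3).
Proof. by rewrite /= mulr0 addr0. Qed.

(* Transposes of vee and B on the complex shifted by c, and of three homotopies:
   h (a0[..]) cuts a block (a b)[w] out of the bracket, G first rotates the
   bracket and replaces a0, as B does, and k cuts out two blocks. *)
Definition veed (c : int) phi (B : block C) : rat :=
  let: (a0, s) := B in
  exr s (fun l a r => cosum (hmul a0 a) (fun p q =>
    sgn (deg a0 + (1 + deg a + deg q) * bdeg l + c * (deg p + bdeg l)) *
    phi [:: (p, l); (q, r)])).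

Definition Bd phi (B : block C) : rat :=
  let: (a0, s) := B in
  heps a0 * exr s (fun l a r => sgn ((deg a - 1 + bdeg r) * bdeg l) * phi [:: (a, r ++ l)]).

Definition hd phi (B : block C) : rat :=
  let: (a0, s) := B in
  sgn (deg a0 + m + 1) * cut (fun l B r => phi [:: (a0, l ++ r); B]) s.

Definition Gd phi (B : block C) : rat :=
  let: (a0, s) := B in
  heps a0 * exr s (fun k a t => cut (fun l B r =>
    sgn (bdeg k * (deg a - 1 + bdeg l + bdeg r) + deg a + bdeg k + m + 1) *
    phi [:: (a, l ++ r ++ k); B]) t).

Definition kd (c : int) phi (B : block C) : rat :=
  let: (a0, s) := B in
  cut (fun l X r' => cut (fun r Y t =>
    sgn (bdeg l + (block_deg X - c) * (block_deg Y - c)) *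
    phi [:: (a0, l ++ r ++ t); X; Y]) r') s.

Lemma lin1_sgn (e : helt C -> int) (f : helt C -> rat) :
  (forall k (x y : C k), e (hom x) = e (hom y)) -> lin1 f -> lin1 (fun x => sgn (e x) * f x).
Proof. by move=> he lf k a x y; rewrite lf (he k _ x) (he k y x); gring. Qed.

Lemma lin1_deg (f : int -> helt C -> rat) :
  (forall d, lin1 (f d)) -> lin1 (fun x => f (deg x) x).
Proof. by move=> lf k a x y; apply: lf. Qed.

Lemma lin1_Zl (c : rat) (f : helt C -> rat) : lin1 f -> lin1 (fun x => c * f x).
Proof. exact: (lin1_scale (fun _ => c)). Qed.

Lemma lin1_cosum x (F : helt C -> helt C -> helt C -> rat) :
  (forall p q, lin1 (fun z => F z p q)) -> lin1 (fun z => cosum x (F z)).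
Proof. by move=> lF; apply: lin1_sum => p; apply: lF. Qed.

Lemma lin1_exr s (F : helt C -> seq (helt C) -> helt C -> seq (helt C) -> rat) :
  (forall l a r, lin1 (fun z => F z l a r)) -> lin1 (fun z => exr s (F z)).
Proof. by move=> lF; apply: lin1_ex => l a r; apply: lF. Qed.

Lemma brform_sgn (e : seq (helt C) -> int) (f : seq (helt C) -> rat) :
  (forall s t k (x y : C k), e (s ++ hom x :: t) = e (s ++ hom y :: t)) -> brform f ->
  brform (fun s => sgn (e s) * f s).
Proof.
move=> he [lf rf]; split=> s t; last by rewrite rf mulr0.
by move=> k a x y; rewrite lf (he s t k _ x) (he s t k y x); gring.
Qed.
Lemma brform_Zl (c : rat) (f : seq (helt C) -> rat) : brform f -> brform (fun s => c * f s).
Proof. exact: (brform_scale (fun _ => c)). Qed.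
Lemma brform_cosum x (F : seq (helt C) -> helt C -> helt C -> rat) :
  (forall p q, brform (fun z => F z p q)) -> brform (fun z => cosum x (F z)).
Proof. by move=> lF; apply: brform_sum => p; apply: lF. Qed.
Lemma brform_exr' s (F : seq (helt C) -> seq (helt C) -> helt C -> seq (helt C) -> rat) :
  (forall l a r, brform (fun z => F z l a r)) -> brform (fun z => exr s (F z)).
Proof. by move=> lF; apply: brform_ex => l a r; apply: lF. Qed.

(** The iterated coproduct. The lemmas below recognise it, for a product, in each of the ways of
    splitting first one factor and then the product with a piece of it. *)
Definition tri x (T : helt C -> helt C -> helt C -> rat) :=
  cosum x (fun u y => cosum u (fun p q => T p q y)).

Section Tri.
Variables (T : helt C -> helt C -> helt C -> rat) (tT : trilin T).
Let T1 y z : lin1 (fun x => T x y z). Proof. by case: tT. Qed.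
Let T2 x z : lin1 (fun y => T x y z). Proof. by case: tT. Qed.
Let T3 x y : lin1 (T x y). Proof. by case: tT. Qed.

Lemma bilin_tri : bilin (fun u y => cosum u (fun p q => T p q y)).
Proof. by split=> y; [apply: cosum_lin | apply: lin1_cosum]. Qed.

Lemma lin1_tri : lin1 (fun x => tri x T).
Proof. exact: cosum_lin bilin_tri. Qed.

Lemma triA x : tri x T = cosum x (fun p u => cosum u (fun q y => T p q y)).
Proof. exact: cosumA. Qed.
End Tri.

Lemma tri_swap x T : trilin T ->
  tri x T = tri x (fun p q y => sgn (deg q * deg y) * T p y q).
Proof.
move=> tT; have [T1 T2 T3] := tT; rewrite !triA //.
  by apply: cosum_eq => p u _; rewrite cosumC //; apply: cosum_eq => q y _; congr (sgn _ * _); ring.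
by split=> *; apply: lin1_sgn => // *.
Qed.

Lemma tri_mull a x T : trilin T ->
  cosum x (fun p y => cosum (hmul a p) (fun q z => T q z y)) = tri (hmul a x) T.
Proof. by move=> tT; rewrite /tri cosum_mull //; apply: bilin_tri. Qed.

Lemma tri_mulR a x T : trilin T ->
  cosum x (fun p y => sgn (deg p * deg y) * cosum (hmul a y) (fun q z => T q z p)) =
  tri (hmul a x) T.
Proof. by move=> tT; rewrite /tri cosum_mulR //; apply: bilin_tri. Qed.

Lemma tri_mulL a x T : trilin T ->
  cosum x (fun p y => sgn (deg y * deg a) * cosum (hmul p a) (fun q z => T q z y)) =
  tri (hmul x a) T.
Proof. by move=> tT; rewrite /tri cosum_mulL //; apply: bilin_tri. Qed.

End Words.

Ltac nf_base := match goal with nf : nform _ |- _ => first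
  [ exact (nf_l1 nf _ _) | exact (nf_l2 nf _ _ _) | exact (nf_l3 nf _ _ _ _)
  | exact (brform_lin_cons _ (nf_r1 nf _ _)) | exact (brform_lin_rcons _ (nf_r1 nf _ _))
  | exact (brform_lin_cons _ (nf_r2 nf _ _ _)) | exact (brform_lin_rcons _ (nf_r2 nf _ _ _))
  | exact (brform_lin_cons _ (nf_r3 nf _ _ _ _)) | exact (brform_lin_rcons _ (nf_r3 nf _ _ _ _)) ] end.
Ltac lin := lazymatch goal with
  | |- lin1 (fun x => @?A x + @?B x) => apply: (@lin1D _ A B); lin
  | |- lin1 (fun x => - @?A x) => apply: (@lin1N _ A); lin
  | |- lin1 (fun x => sgn (@?e x) * @?A x) =>
      apply: (@lin1_sgn _ _ e A); [by move=> ? ? ?; reflexivity | lin]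
  | |- lin1 (fun x => ?k * @?A x) => apply: (@lin1_Zl _ _ k A); lin
  | |- lin1 (fun x => cosum ?y _) => apply: lin1_cosum => ? ?; lin
  | |- lin1 (fun x => exr ?y _) => apply: lin1_exr => ? ? ?; lin
  | _ => nf_base
  end.

Section TriformZ.
Variables (m : int) (C : dgOpenFrobenius m).
Implicit Types F : seq (helt C) -> helt C -> seq (helt C) -> rat.

Lemma triformZ k F : triform F -> triform (fun l a r => k * F l a r).
Proof.
move=> [F1 F2 F3]; split=> *; [exact: brform_Zl | exact: lin1_Zl | exact: brform_Zl].
Qed.

Lemma DFZ k (F : seq (helt C) -> helt C -> seq (helt C) -> rat) l a r :
  DF (fun l a r => k * F l a r) l a r = k * DF F l a r.
Proof.
rewrite /DF !DlZ.
have -> : cosum a (fun p q => sgn (bdeg l + deg p - 1) * (k * F (rcons l p) q r + k * F l p (q :: r)))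
  = k * cosum a (fun p q => sgn (bdeg l + deg p - 1) * (F (rcons l p) q r + F l p (q :: r))).
  by rewrite cosumZ'; apply: cosum_eq => *; gring.
by gring.
Qed.

End TriformZ.

Section BdExr.
Variables (m : int) (C : dgOpenFrobenius m).
Variable F : helt C -> seq (helt C) -> helt C -> seq (helt C) -> rat.
Hypotheses (tF : forall a0, triform (F a0)) (lF : forall l a r, lin1 (fun a0 => F a0 l a r)).

(** The end terms of [Dl_exr] cancel against the counit part of [hred q], where q is the letter
    inserted at either end by the coproduct of a0; only the extraction of q itself is left over. *)
Lemma bd_exr a0 s : bd (fun B : block C => exr B.2 (F B.1)) (a0, s) =
  exr s (fun l a r => F (hdif a0) l a r + sgn (deg a0) * DF (F a0) l a r +
    cosum a0 (fun p q => sgn (deg p) * (F p (q :: l) a r -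
      sgn ((deg q - 1) * (bdeg l + deg a - 1 + bdeg r)) * F p l a (rcons r q)))) +
  cosum a0 (fun p q => sgn (deg p) * (F p [::] q s - sgn ((deg q - 1) * bdeg s) * F p s q [::])).
Proof.
have lFa a0' l r : lin1 (fun a => F a0' l a r) by case: (tF a0').
rewrite /bd /= (Dl_exr _ (tF a0)).
have -> : cosum a0 (fun p q => sgn (deg p) * (exr (q :: s) (F p) -
    sgn ((deg q - 1) * bdeg s) * exr (rcons s q) (F p))) =
  exr s (fun l a r => cosum a0 (fun p q => sgn (deg p) * (F p (q :: l) a r -
      sgn ((deg q - 1) * bdeg s) * F p l a (rcons r q)))) +
  (cosum a0 (fun p q => sgn (deg p) * (F p [::] q s - sgn ((deg q - 1) * bdeg s) * F p s q [::])) -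
   cosum a0 (fun p q => heps q * (sgn (deg p) * (F p [::] (hone C) s - sgn (bdeg s) * F p s (hone C) [::])))).
  rewrite -cosum_exr -cosumB -cosumD; apply: cosum_eq => p q _.
  rewrite exr_cons exr_rcons exrZ exrB exrZ !(hred_lin _ (lFa _ _ _)).
  have [/eqP q0|/heps_deg->] := boolP (deg q == 0); last by gring.
  by rewrite q0 (_ : sgn ((0 - 1) * bdeg s) = sgn (bdeg s)); [gring | sgneq].
rewrite (@cosum_counitr _ _ a0 (fun p => sgn (deg p) * (F p [::] (hone C) s - sgn (bdeg s) * F p s (hone C) [::])));
  last by apply: (lin1_scale (fun d => sgn d)); apply: lin1B => //; apply: lin1_Zl.
have -> : exr s (fun l a r => cosum a0 (fun p q => sgn (deg p) * (F p (q :: l) a r -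
      sgn ((deg q - 1) * bdeg s) * F p l a (rcons r q)))) =
  exr s (fun l a r => cosum a0 (fun p q => sgn (deg p) * (F p (q :: l) a r -
      sgn ((deg q - 1) * (bdeg l + deg a - 1 + bdeg r)) * F p l a (rcons r q)))).
  by apply: exr_eq => l a r _ ->; apply: cosum_eq => p q _; rewrite addrA.
set X := exr s (DF (F a0)); rewrite 2!exrD exrZ -/X; by gring.
Qed.
End BdExr.

(** * The coproduct is a chain map *)

Section Chain.
Variables (m : int) (C : dgOpenFrobenius m).
Local Notation c := (1 - m).
Variables (phi : word C -> rat) (nf : nform phi).

Definition vee3 (a0 : helt C) l a r : rat := cosum (hmul a0 a) (fun p q =>
    sgn (deg a0 + (1 + deg a + deg q) * bdeg l + c * (deg p + bdeg l)) *
    phi [:: (p, l); (q, r)]).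

Lemma bilin_vee3 l r d (a0 : helt C) : bilin (fun p q =>
    sgn (deg a0 + (1 + d + deg q) * bdeg l + c * (deg p + bdeg l)) *
    phi [:: (p, l); (q, r)]).
Proof. by split=> ?; lin. Qed.

Lemma triform_vee3 a0 : triform (vee3 a0).
Proof.
split=> [a r|l r|l a]; rewrite /vee3.
- apply: brform_cosum => p q; apply: brform_sgn; last exact: nf_r1.
  by move=> *; rewrite !bdegE.
- apply: (lin1_deg (f := fun d a => cosum (hmul a0 a) (fun p q =>
    sgn (deg a0 + (1 + d + deg q) * bdeg l + c * (deg p + bdeg l)) * phi [:: (p, l); (q, r)]))).
  by move=> d; apply: (lin1_mulr' (f := fun x => cosum x _)); apply: cosum_lin; apply: bilin_vee3.
- by apply: brform_cosum => p q; apply: brform_sgn; last exact: nf_r2.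
Qed.
End Chain.

Ltac trilin_tac := split=> ? ?; lin.

Section ChainV.
Variables (m : int) (C : dgOpenFrobenius m).
Local Notation c := (1 - m).
Variables (phi : word C -> rat) (nf : nform phi).
Local Notation vee3 := (vee3 phi).

Lemma vee3_0l a0 a r : vee3 a0 [::] a r = 0.
Proof. by rewrite /vee3 /cosum big1 // => p _; rewrite nf_01 ?mulr0. Qed.
Lemma vee3_0r a0 l a : vee3 a0 l a [::] = 0.
Proof. by rewrite /vee3 /cosum big1 // => p _; rewrite nf_02 ?mulr0. Qed.

Section Pt.
Variables (a0 a : helt C) (l r : seq (helt C)).

Let eqq (P Q q : helt C) : deg P + deg Q = deg (hmul a0 q) -> deg q = deg P + deg Q - deg a0 + m.
Proof. by rewrite deg_hmul => ->; ring. Qed.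
Let eqp (P Q p : helt C) : deg P + deg Q = deg (hmul p a) -> deg p = deg P + deg Q - deg a + m.
Proof. by rewrite deg_hmul => ->; ring. Qed.

(** By a Frobenius identity, a letter inserted into an output bracket by the coproduct of a or of a0
    comes from an iterated coproduct of a0 a. The four cases are the end of l, the start of r, the
    start of l and the end of r. *)
Lemma vee_ins1 : cosum a (fun p q => sgn (deg a0 + bdeg l + deg p - 1) * vee3 a0 (rcons l p) q r) =
  tri (hmul a0 a) (fun P Q y => - (sgn (deg a0 + (1 + deg a + deg y) * bdeg l + c * (deg P + deg Q + bdeg l)
     + deg P + (deg Q - 1) * bdeg l) * phi [:: (P, rcons l Q); (y, r)])).
Proof.
rewrite tri_swap; last by trilin_tac.
rewrite -tri_mulR; last by trilin_tac.
apply: cosum_eq => p q epq; rewrite /Defs.comp_at /vee3 !cosumZ'; apply: cosum_eq => P Q ePQ.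
by rewrite -epq (eqq ePQ) !bdegE; sgncases.
Qed.

Lemma vee_ins2 : cosum a (fun p q => sgn (deg a0 + bdeg l + deg p - 1) * vee3 a0 l p (q :: r)) =
  tri (hmul a0 a) (fun p P Q => sgn (deg a0 + (1 + deg a + deg P + deg Q) * bdeg l + c * (deg p + bdeg l)
     + deg p + bdeg l - c + deg P) * phi [:: (p, l); (P, Q :: r)]).
Proof.
rewrite -tri_mull; last by trilin_tac.
apply: cosum_eq => p q epq; rewrite /vee3 !cosumZ'; apply: cosum_eq => P Q ePQ.
rewrite !mulrA -!sgnD; congr (_ * _).
by rewrite -epq (eqq ePQ); sgneq.
Qed.

Lemma vee_ins3 : cosum a0 (fun p q => sgn (deg p) * vee3 p (q :: l) a r) =
  tri (hmul a0 a) (fun P Q y => sgn (deg a0 + (1 + deg a + deg y) * bdeg l + c * (deg P + deg Q + bdeg l)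
     + deg P) * phi [:: (P, Q :: l); (y, r)]).
Proof.
rewrite tri_swap; last by trilin_tac.
rewrite -tri_mulL; last by trilin_tac.
apply: cosum_eq => p q epq; rewrite /vee3 !cosumZ'; apply: cosum_eq => P Q ePQ.
rewrite !mulrA -!sgnD; congr (_ * _).
by rewrite -epq (eqp ePQ) !bdegE; sgneq.
Qed.

Lemma vee_ins4 : cosum a0 (fun p q => - (sgn (deg p + (deg q - 1) * (bdeg l + deg a - 1 + bdeg r)) * vee3 p l a (rcons r q))) =
  tri (hmul a0 a) (fun p P Q => - (sgn (deg a0 + (1 + deg a + deg P + deg Q) * bdeg l + c * (deg p + bdeg l)
     + deg p + bdeg l - c + deg P + (deg Q - 1) * bdeg r) * phi [:: (p, l); (P, rcons r Q)])).
Proof.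
rewrite -tri_mulL; last by trilin_tac.
apply: cosum_eq => p q epq; rewrite /vee3 !cosumZ' -cosumN; apply: cosum_eq => P Q ePQ.
rewrite mulrN !mulrA -!sgnD; congr (- (_ * _)).
by rewrite -epq (eqp ePQ); sgneq.
Qed.

(** For a fixed cut letter a, the four insertions are the insertions of b in the two output blocks;
    the derivation rule for a0 a together with [cosum_dif] accounts for the differentials of their
    entries. *)
Lemma vee_pt :
  cosum (hmul a0 a) (fun p q => sgn (deg a0 + (1 + deg a + deg q) * bdeg l + c * (deg p + bdeg l)) *
    bt c phi [:: (p, l); (q, r)]) =
  vee3 (hdif a0) l a r + sgn (deg a0) * DF (vee3 a0) l a r +
  cosum a0 (fun p q => sgn (deg p) * (vee3 p (q :: l) a r -
     sgn ((deg q - 1) * (bdeg l + deg a - 1 + bdeg r)) * vee3 p l a (rcons r q))).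
Proof.
have -> : cosum a0 (fun p q => sgn (deg p) * (vee3 p (q :: l) a r -
     sgn ((deg q - 1) * (bdeg l + deg a - 1 + bdeg r)) * vee3 p l a (rcons r q))) =
  cosum a0 (fun p q => sgn (deg p) * vee3 p (q :: l) a r) +
  cosum a0 (fun p q => - (sgn (deg p + (deg q - 1) * (bdeg l + deg a - 1 + bdeg r)) * vee3 p l a (rcons r q))).
  by rewrite -cosumD; apply: cosum_eq => p q _; rewrite sgnD; gring.
rewrite vee_ins3 vee_ins4 /DF mulrDr.
have -> : sgn (deg a0) * cosum a (fun p q => sgn (bdeg l + deg p - 1) * (vee3 a0 (rcons l p) q r + vee3 a0 l p (q :: r))) =
  cosum a (fun p q => sgn (deg a0 + bdeg l + deg p - 1) * vee3 a0 (rcons l p) q r) +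
  cosum a (fun p q => sgn (deg a0 + bdeg l + deg p - 1) * vee3 a0 l p (q :: r)).
  by rewrite cosumZ' -cosumD; apply: cosum_eq => p q _; rewrite !sgnD; gring.
rewrite vee_ins1 vee_ins2.
rewrite [tri _ (fun p P Q => sgn _ * phi [:: (p, l); (P, Q :: r)])]triA; last by trilin_tac.
rewrite [tri _ (fun p P Q => - (sgn _ * phi [:: (p, l); (P, rcons r Q)]))]triA; last by trilin_tac.
pose F0 p q := sgn (deg q * bdeg l + c * deg p) * phi [:: (p, l); (q, r)].
have bF0 : bilin F0 by rewrite /F0; split=> ?; lin.
have eF (x y : helt C) : vee3 x l y r = sgn (deg x + (1 + deg y + c) * bdeg l) * cosum (hmul x y) F0.
  rewrite /vee3 cosumZ'; apply: cosum_eq => p q _; rewrite /F0 mulrA -sgnD; congr (_ * _).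
  by sgneq.
rewrite [vee3 _ _ _ _ + (_ + _)]addrA.
have -> : vee3 (hdif a0) l a r + sgn (deg a0) * (
   Dl (fun l => vee3 a0 l a r) l - sgn (bdeg l) * vee3 a0 l (hdif a) r +
   sgn (bdeg l + deg a - 1) * Dl (vee3 a0 l a) r) =
  sgn (deg a0 + (1 + deg a + c) * bdeg l + c) * cosum (hdif (hmul a0 a)) F0 +
  cosum (hmul a0 a) (fun p q => sgn (deg a0 + (1 + deg a + deg q) * bdeg l + c * (deg p + bdeg l) + deg p) *
    Dl (fun l => phi [:: (p, l); (q, r)]) l) +
  cosum (hmul a0 a) (fun p q => sgn (deg a0 + (1 + deg a + deg q) * bdeg l + c * (deg p + bdeg l) +
     deg p + bdeg l - c + deg q) * Dl (fun r => phi [:: (p, l); (q, r)]) r).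
  have -> : Dl (fun l => vee3 a0 l a r) l = sgn (deg a0) * cosum (hmul a0 a) (fun p q =>
     sgn (deg a0 + (1 + deg a + deg q) * bdeg l + c * (deg p + bdeg l) + deg p) *
       Dl (fun l => phi [:: (p, l); (q, r)]) l).
    rewrite /vee3 {1}/cosum Dl_sum /cosum mulr_sumr; apply: eq_big_seq => -[p q] /cop_deg /= e.
    rewrite (Dl_sgn (fun d => sgn (_ + (_ + _) * d + c * (_ + d)))) mulrA -sgnD; congr (_ * _).
    have {}e : deg q = deg a0 + deg a - m - deg p by rewrite -e; ring.
    by rewrite e; sgneq.
  have -> : Dl (vee3 a0 l a) r = sgn (deg a0 + bdeg l + deg a - 1) * cosum (hmul a0 a) (fun p q =>
     sgn (deg a0 + (1 + deg a + deg q) * bdeg l + c * (deg p + bdeg l) +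
     deg p + bdeg l - c + deg q) * Dl (fun r => phi [:: (p, l); (q, r)]) r).
    rewrite /vee3 {1}/cosum Dl_sum /cosum mulr_sumr; apply: eq_big_seq => -[p q] /cop_deg /= e.
    rewrite DlZ mulrA -sgnD; congr (_ * _).
    have {}e : deg q = deg a0 + deg a - m - deg p by rewrite -e; ring.
    by rewrite e; sgneq.
  rewrite !eF (dif_mul_lin _ _ (cosum_lin bF0)) !degE.
  move: (cosum _ _) (cosum _ _) (cosum _ _) (cosum _ _) => X1 X2 X3 X4.
  by sgncases.
rewrite cosum_dif // /tri cosumZ' -!cosumD; apply: cosum_eq => p q e.
rewrite bt2E !bdE /block_deg /=.
have -> : cosum p (fun P Q => sgn (deg P) * (phi [:: (P, Q :: l); (q, r)] -
     sgn ((deg Q - 1) * bdeg l) * phi [:: (P, rcons l Q); (q, r)])) =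
   cosum p (fun P Q => sgn (deg P) * phi [:: (P, Q :: l); (q, r)]) -
   cosum p (fun P Q => sgn (deg P + (deg Q - 1) * bdeg l) * phi [:: (P, rcons l Q); (q, r)]).
  by rewrite -cosumB; apply: cosum_eq => *; rewrite sgnD; gring.
have -> : cosum q (fun P Q => sgn (deg P) * (phi [:: (p, l); (P, Q :: r)] -
     sgn ((deg Q - 1) * bdeg r) * phi [:: (p, l); (P, rcons r Q)])) =
   cosum q (fun P Q => sgn (deg P) * phi [:: (p, l); (P, Q :: r)]) -
   cosum q (fun P Q => sgn (deg P + (deg Q - 1) * bdeg r) * phi [:: (p, l); (P, rcons r Q)]).
  by rewrite -cosumB; apply: cosum_eq => *; rewrite sgnD; gring.
set X1 := cosum p _; set X2 := cosum p _; set X3 := cosum q _; set X4 := cosum q _.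
pose sg := deg a0 + (1 + deg a + deg q) * bdeg l + c * (deg p + bdeg l).
have -> : cosum p (fun P Q => - (sgn (deg a0 + (1 + deg a + deg q) * bdeg l + c * (deg P + deg Q + bdeg l) +
   deg P + (deg Q - 1) * bdeg l) * phi [:: (P, rcons l Q); (q, r)])) = - (sgn sg * X2).
  by rewrite cosumZ' -cosumN; apply: cosum_eq => P Q eP; rewrite mulrA -sgnD eP addrA.
have -> : cosum p (fun P Q => (sgn (deg a0 + (1 + deg a + deg q) * bdeg l + c * (deg P + deg Q + bdeg l) +
   deg P) * phi [:: (P, Q :: l); (q, r)])) = (sgn sg * X1).
  by rewrite cosumZ'; apply: cosum_eq => P Q eP; rewrite mulrA -sgnD eP.
have -> : cosum q (fun P Q => (sgn (deg a0 + (1 + deg a + deg P + deg Q) * bdeg l + c * (deg p + bdeg l) +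
   deg p + bdeg l - c + deg P) * phi [:: (p, l); (P, Q :: r)])) = (sgn (sg + deg p + bdeg l - c) * X3).
  by rewrite cosumZ'; apply: cosum_eq => P Q eP; rewrite mulrA -sgnD /sg -eP; congr (_ * _); sgneq.
have -> : cosum q (fun P Q => - (sgn (deg a0 + (1 + deg a + deg P + deg Q) * bdeg l + c * (deg p + bdeg l) +
   deg p + bdeg l - c + deg P + (deg Q - 1) * bdeg r) * phi [:: (p, l); (P, rcons r Q)])) =
   - (sgn (sg + deg p + bdeg l - c) * X4).
  by rewrite cosumZ' -cosumN; apply: cosum_eq => P Q eP; rewrite mulrA -sgnD /sg -eP; congr (- (_ * _)); sgneq.
have ea0 : deg a0 = deg p + deg q - deg a + m by rewrite e deg_hmul; ring.
rewrite {}/sg /F0 !degE ea0; move: X1 X2 X3 X4 (Dl _ _) (Dl _ _) => X1 X2 X3 X4 X5 X6.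
by sgncases.
Qed.
End Pt.

Lemma veed_bt B : veed c (bt c phi) B = bd (veed c phi) B.
Proof.
case: B => a0 s; rewrite /bd /veed.
rewrite [RHS](bd_exr (F := vee3)); last 2 first.
- exact: triform_vee3.
- move=> l a r; apply: (lin1_deg (f := fun d a0 => cosum (hmul a0 a) (fun p q =>
    sgn (d + (1 + deg a + deg q) * bdeg l + c * (deg p + bdeg l)) * phi [:: (p, l); (q, r)]))).
  by move=> d; apply: (lin1_mull (f := fun x => cosum x _)); apply: cosum_lin; split=> ?; lin.
(* The end terms of [bd_exr] have an empty bracket in one output. *)
rewrite [X in _ = _ + X](_ : _ = 0) ?addr0; last first.
  by rewrite /cosum big1 // => p _; rewrite vee3_0l vee3_0r; gring.
by apply: exr_eq => l a r _ _; apply: vee_pt.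
Qed.
End ChainV.

(** * The homotopy between the coproduct and its opposite *)

Section Homotopy.
Variables (m : int) (C : dgOpenFrobenius m).
Local Notation c := (1 - m).

Definition swapd (phi : word C -> rat) (w : word C) : rat :=
  if w is [:: x; y] then sgn ((block_deg x - c) * (block_deg y - c)) * phi [:: y; x] else 0.

Variables (phi : word C -> rat) (nf : nform phi).

Definition hf (a0 : helt C) l B r := phi [:: (a0, l ++ r); B].

Lemma cutform_hf a0 : cutform (hf a0).
Proof.
split=> [B r|l r|l B|l a r]; rewrite /hf.
- by apply: (brform_catr (f := fun s => phi [:: (a0, s); B])); apply: nf_r1.
- exact: nf_b2.
- by apply: (brform_catl (f := fun s => phi [:: (a0, s); B])); apply: nf_r1.
- by rewrite nf_02.
Qed.

(** Moving a letter from the end of l to the front of r does not change l ++ r, so the two terms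
    cancel. *)
Lemma cutI_hf a0 l B r : cutI (hf a0) l B r = 0.
Proof. by rewrite /cutI /cosum big1 // => p _; rewrite /hf cat_rcons subrr mulr0. Qed.

Definition h3 a0 l a t : rat := sgn (deg a0 + m + 1) * cut1 (hf a0) l a t.

Lemma triform_h3 a0 : triform (h3 a0).
Proof. by apply: triformZ; apply: triform_cut1; apply: cutform_hf. Qed.

Lemma lin1_h3 l a r : lin1 (fun a0 => h3 a0 l a r).
Proof. by rewrite /h3 /cut1 /hf; lin. Qed.

Lemma hdE a0 s : hd phi (a0, s) = exr s (h3 a0).
Proof. by rewrite /h3 exrZ. Qed.

Lemma h3_rcons a0 l a t q : h3 a0 l a (rcons t q) =
  exr t (fun w b r => sgn (deg a0 + m + 1 + kap l a w b (rcons r q)) * hf a0 l (hmul a b, w) (rcons r q)) +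
  sgn (deg a0 + m + 1 + (deg q - 1) * bdeg t + bdeg l + deg a) * phi [:: (a0, l); (hmul a (hred q), t)].
Proof.
rewrite /h3 /cut1 exr_rcons mulrDr -exrZ; congr (_ + _).
  by apply: exr_eq => w b r _ _; rewrite mulrA -sgnD.
rewrite mulrA -sgnD /hf cats0; congr (sgn _ * _); rewrite /kap bdeg_nil.
by ring.
Qed.

(** Here the letter q inserted last by the coproduct of a0 is the right factor of the cut, with r
    empty. The counit part of [hred q] cancels the product with the unit, and a Frobenius identity
    turns the rest into [vee]. *)
Lemma h3_vee a0 l a t :
  sgn (m + 1) * phi [:: (a0, l); (hmul a (hone C), t)] +
  cosum a0 (fun p q => - (sgn (m + 1 + (deg q - 1) * (bdeg l + deg a - 1) + bdeg l + deg a) *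
    phi [:: (p, l); (hmul a (hred q), t)])) = - vee3 phi a0 l a t.
Proof.
have lq p : lin1 (fun q => phi [:: (p, l); (hmul a q, t)]).
  by apply: (lin1_mulr' (f := fun x => phi [:: (p, l); (x, t)])); lin.
rewrite /vee3 cosum_mulr; last by split=> ?; lin.
have <- := @cosum_counitr _ _ a0 (fun p => sgn (m + 1) * phi [:: (p, l); (hmul a (hone C), t)]) _; last by lin.
rewrite -cosumN -cosumD; apply: cosum_eq => p q e.
rewrite (mulC_lin q a (f := fun x => phi [:: (p, l); (x, t)])); last by lin.
rewrite (hred_lin _ (lq p)) deg_hmul -e.
have [/eqP q0|/heps_deg->] := boolP (deg q == 0); first by rewrite q0; sgncases.
by sgncases.
Qed.

Lemma h3_pt a0 l a t :
  h3 (hdif a0) l a t + sgn (deg a0) * DF (h3 a0) l a t +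
  cosum a0 (fun p q => sgn (deg p) * (h3 p (q :: l) a t -
     sgn ((deg q - 1) * (bdeg l + deg a - 1 + bdeg t)) * h3 p l a (rcons t q))) =
  - exr t (fun w b r => sgn (deg a0 + m + 1 + kap l a w b r) * bt c phi [:: (a0, l ++ r); (hmul a b, w)]) - vee3 phi a0 l a t.
Proof.
rewrite -h3_vee DFZ (DF_cut1 (cutform_hf a0)) [hf a0 l _ [::]]/hf cats0.
have -> : cosum a0 (fun p q => sgn (deg p) * (h3 p (q :: l) a t -
     sgn ((deg q - 1) * (bdeg l + deg a - 1 + bdeg t)) * h3 p l a (rcons t q))) =
  exr t (fun w b r => cosum a0 (fun p q => sgn (deg p) * (
    sgn (deg p + m + 1 + kap (q :: l) a w b r) * phi [:: (p, q :: l ++ r); (hmul a b, w)] -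
    sgn ((deg q - 1) * (bdeg l + deg a - 1 + bdeg t) + deg p + m + 1 + kap l a w b (rcons r q)) *
      phi [:: (p, rcons (l ++ r) q); (hmul a b, w)]))) +
  cosum a0 (fun p q => - (sgn (m + 1 + (deg q - 1) * (bdeg l + deg a - 1) + bdeg l + deg a) *
    phi [:: (p, l); (hmul a (hred q), t)])).
  rewrite -cosum_exr -cosumD; apply: cosum_eq => p q e.
  rewrite h3_rcons exrZ exrB {1}/h3 /cut1 -exrZ.
  have -> : exr t (fun w b r => sgn (deg p + m + 1) * (sgn (kap (q :: l) a w b r) *
       hf p (q :: l) (hmul a b, w) r)) =
     exr t (fun w b r => sgn (deg p + m + 1 + kap (q :: l) a w b r) * phi [:: (p, q :: l ++ r); (hmul a b, w)]).
    by apply: exr_eq => w b r _ _; rewrite mulrA -sgnD.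
  have -> : exr t (fun w b r => sgn ((deg q - 1) * (bdeg l + deg a - 1 + bdeg t) + deg p + m + 1 +
       kap l a w b (rcons r q)) * phi [:: (p, rcons (l ++ r) q); (hmul a b, w)]) =
     sgn ((deg q - 1) * (bdeg l + deg a - 1 + bdeg t)) * exr t (fun w b r =>
       sgn (deg p + m + 1 + kap l a w b (rcons r q)) * hf p l (hmul a b, w) (rcons r q)).
    by rewrite -exrZ; apply: exr_eq => w b r _ _; rewrite /hf rcons_cat mulrA -sgnD !addrA.
  move: (exr _ _) (exr _ _) => X1 X2.
  by sgncases.
have -> : sgn (deg a0) * (sgn (deg a0 + m + 1) * (exr t (fun w b r => sgn (kap l a w b r) *
    (cutI (hf a0) l (hmul a b, w) r - cutD (hf a0) l (hmul a b, w) r)) +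
     phi [:: (a0, l); (hmul a (hone C), t)])) =
  exr t (fun w b r => - (sgn (m + 1 + kap l a w b r) * cutD (hf a0) l (hmul a b, w) r)) +
  sgn (m + 1) * phi [:: (a0, l); (hmul a (hone C), t)].
  rewrite mulrA -sgnD mulrDr -exrZ; congr (_ + _); last by congr (_ * _); sgneq.
  by apply: exr_eq => w b r _ _; rewrite cutI_hf; sgncases.
rewrite [h3 _ _ _ _ + (_ + _)]addrA addrACA; congr (_ + _).
rewrite /h3 /cut1 -exrZ -!exrD -exrN; apply: exr_eq => w b r _ et.
rewrite /cutD bt2E /hf [bd _ (a0, _)]bdE Dl_cat bdeg_cat.
have -> : cosum a0 (fun p q => sgn (deg p) * (
    sgn (deg p + m + 1 + kap (q :: l) a w b r) * phi [:: (p, q :: l ++ r); (hmul a b, w)] -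
    sgn ((deg q - 1) * (bdeg l + deg a - 1 + bdeg t) + deg p + m + 1 + kap l a w b (rcons r q)) *
      phi [:: (p, rcons (l ++ r) q); (hmul a b, w)])) = 
  sgn (deg a0 + m + kap l a w b r) * cosum a0 (fun p q => sgn (deg p) * (phi [:: (p, q :: l ++ r); (hmul a b, w)] -
    sgn ((deg q - 1) * (bdeg l + bdeg r)) * phi [:: (p, rcons (l ++ r) q); (hmul a b, w)])).
  rewrite cosumZ'; apply: cosum_eq => p q e; rewrite et -e /kap !bdegE.
  by sgncases.
move: (cosum _ _) (bd _ _) (Dl _ _) (Dl _ _) => X1 X2 X3 X4.
rewrite /block_deg /= bdeg_cat.
by sgncases.
Qed.

(** Both coproducts come from extracting the letter inserted by the coproduct of a0: at the right
    end, as b, it gives [vee]; at the left end, as a, it gives the opposite of [vee]. *)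
Lemma hd_homotopy B : veed c (swapd phi) B - veed c phi B = bd (hd phi) B + hd (bt c phi) B.
Proof.
case: B => a0 s; have -> : bd (hd phi) (a0, s) = bd (fun B : block C => exr B.2 (h3 B.1)) (a0, s).
  by congr bd; apply/funext => -[b0 t]; rewrite hdE.
rewrite (bd_exr triform_h3 lin1_h3).
rewrite (exr_eq (G := fun l a t => - exr t (fun w b r => sgn (deg a0 + m + 1 + kap l a w b r) *
   bt c phi [:: (a0, l ++ r); (hmul a b, w)]) - vee3 phi a0 l a t)); last first.
  by move=> l a t _ _; apply: h3_pt.
have -> : hd (bt c phi) (a0, s) = exr s (fun l a t =>
    exr t (fun w b r => sgn (deg a0 + m + 1 + kap l a w b r) * bt c phi [:: (a0, l ++ r); (hmul a b, w)])).
  rewrite /hd -exrZ; apply: exr_eq => l a t _ _; rewrite /cut1 -exrZ.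
  by apply: exr_eq => w b r _ _; rewrite mulrA -sgnD.
have -> : veed c (swapd phi) (a0, s) = cosum a0 (fun p q =>
     sgn (deg p) * (h3 p [::] q s - sgn ((deg q - 1) * bdeg s) * h3 p s q [::])).
  rewrite (cosum_eq (G := fun p q => exr s (fun w b r => sgn (m + 1 + kap [::] q w b r) *
      phi [:: (p, r); (hmul q b, w)]))); last first.
    move=> p q _; have -> : h3 p s q [::] = 0 by rewrite /h3 /cut1 /exr /= mulr0.
    rewrite mulr0 subr0 /h3 /cut1 -!exrZ.
    by apply: exr_eq => w b r _ _; rewrite /hf !mulrA -!sgnD; congr (_ * _); sgneq.
  rewrite cosum_exr; apply: exr_eq => w b r _ _.
  rewrite cosumC; last by split=> ?; rewrite /swapd /block_deg /=; lin.
  rewrite cosum_mulr; last by split=> ?; rewrite /swapd /block_deg /=; lin.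
  apply: cosum_eq => p q e; rewrite /swapd /block_deg /= !mulrA -!sgnD; congr (_ * _).
  by rewrite -e deg_hmul /kap bdeg_nil; sgneq.
rewrite exrB exrN.
have -> : exr s (vee3 phi a0) = veed c phi (a0, s) by [].
by gring.
Qed.
End Homotopy.

(** * Connes' operator anticommutes with the differential *)

Section Connes.
Variables (m : int) (C : dgOpenFrobenius m).
Local Notation c := (1 - m).
Variables (phi : word C -> rat) (nf : nform phi).

Lemma heps_sgn (x : helt C) e : sgn (e * deg x) * heps x = heps x.
Proof.
have [/eqP->|/heps_deg->] := boolP (deg x == 0); last by rewrite mulr0.
by rewrite mulr0 mul1r.
Qed.

Definition W3 l (a : helt C) r : rat := sgn ((deg a - 1 + bdeg r) * bdeg l) * phi [:: (a, r ++ l)].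

Lemma triform_W3 : triform W3.
Proof.
split=> [a r|l r|l a]; rewrite /W3.
- apply: brform_sgn; first by move=> *; rewrite !bdegE.
  by apply: (brform_catl (f := fun s => phi [:: (a, s)])); apply: nf_r1.
- by lin.
- apply: brform_sgn; first by move=> *; rewrite !bdegE.
  by apply: (brform_catr (f := fun s => phi [:: (a, s)])); apply: nf_r1.
Qed.

Lemma BdE a0 s : Bd phi (a0, s) = exr s (fun l a r => heps a0 * W3 l a r).
Proof. by rewrite /Bd exrZ. Qed.

(** The counit collapses the coproduct of a0, so a0 itself becomes the inserted letter; the term
    with the differential of a0 vanishes. *)
Lemma bd_eps_exr F a0 s : triform F ->
  bd (fun B : block C => exr B.2 (fun l a r => heps B.1 * F l a r)) (a0, s) =
  heps a0 * exr s (DF F) + exr s (fun l a r => F (a0 :: l) a r -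
     sgn ((deg a0 - 1) * (bdeg l + deg a - 1 + bdeg r)) * F l a (rcons r a0)) +
  (F [::] a0 s - sgn ((deg a0 - 1) * bdeg s) * F s a0 [::]).
Proof.
move=> tF; have [F1 F2 F3] := tF.
rewrite (bd_exr (F := fun a0 l a r => heps a0 * F l a r)); first last.
- by move=> l a r k e x y; rewrite lin1_eps; ring.
- by move=> b0; apply: triformZ.
have eps1 (x : helt C) (f g : helt C -> rat) : lin1 f -> lin1 g ->
    cosum x (fun p q => sgn (deg p) * (heps p * f q - heps p * g q)) = f x - g x.
  move=> lf lg; rewrite -(cosum_counitl x lf) -(cosum_counitl x lg) -cosumB.
  by apply: cosum_eq => p q _; rewrite -[in RHS](heps_sgn p 1) mul1r; gring.
congr (_ + _).
  rewrite -exrZ -exrD; apply: exr_eq => l a r _ _; rewrite heps_dif mul0r add0r.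
  congr (_ + _).
    rewrite -[heps a0 in RHS](heps_sgn a0 1) mul1r -mulrA; congr (_ * _).
    exact: DFZ.
  rewrite -(eps1 a0 (fun q => F (q :: l) a r) (fun q =>
    sgn ((deg q - 1) * (bdeg l + deg a - 1 + bdeg r)) * F l a (rcons r q))); first by apply: cosum_eq => p q _; gring.
  - exact: brform_lin_cons (F1 _ _).
  - by apply: lin1_sgn => //; apply: brform_lin_rcons (F3 _ _).
rewrite -(eps1 a0 (fun q => F [::] q s) (fun q => sgn ((deg q - 1) * bdeg s) * F s q [::])); first by apply: cosum_eq => p q _; gring.
- exact: F2.
- by apply: lin1_sgn.
Qed.

(** Inserting a0 first or last gives the same cyclic word, so its two insertions by b cancel after
    the sum over rotations. *)
Lemma W3_cyc a0 l a r : W3 (a0 :: l) a r =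
  sgn ((deg a0 - 1) * (bdeg l + deg a - 1 + bdeg r)) * W3 l a (rcons r a0).
Proof. by rewrite /W3 cat_rcons mulrA -sgnD !bdegE; congr (_ * _); sgneq. Qed.

Lemma DF_W3 l a r : DF W3 l a r = - (sgn ((deg a - 1 + bdeg r) * bdeg l) * bt c phi [:: (a, r ++ l)]).
Proof.
rewrite bt1E bdE Dl_cat bdeg_cat /DF /W3.
rewrite (Dl_sgn (fun d => sgn ((deg a - 1 + bdeg r) * d))).
rewrite (Dl_sgn (fun d => sgn ((deg a - 1 + d) * bdeg l))).
have -> : cosum a (fun p q => sgn (deg p) * (phi [:: (p, q :: r ++ l)] -
     sgn ((deg q - 1) * (bdeg r + bdeg l)) * phi [:: (p, rcons (r ++ l) q)])) =
   cosum a (fun p q => sgn (deg p) * phi [:: (p, q :: r ++ l)]) -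
   cosum a (fun p q => sgn (deg p + (deg q - 1) * (bdeg r + bdeg l)) * phi [:: (p, rcons (r ++ l) q)]).
  by rewrite -cosumB; apply: cosum_eq => p q _; rewrite sgnD; gring.
(* The letter that the coproduct of a leaves at the end of l is, after rotation, the last of the
   bracket; cocommutativity exchanges it with the other factor. *)
rewrite [cosum a (fun p q => sgn (deg p + _) * phi [:: (p, rcons (r ++ l) q)])]cosumC; last by split=> ?; lin.
have -> : cosum a (fun p q => sgn (bdeg l + deg p - 1) *
   (sgn ((deg q - 1 + bdeg r) * bdeg (rcons l p)) * phi [:: (q, r ++ rcons l p)] +
    sgn ((deg p - 1 + bdeg (q :: r)) * bdeg l) * phi [:: (p, (q :: r) ++ l)])) =
  - (sgn ((deg a - 1 + bdeg r) * bdeg l) * (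
   cosum a (fun p q => sgn (deg p) * phi [:: (p, q :: r ++ l)]) -
   cosum a (fun p q => sgn (deg p * deg q) * (sgn (deg q + (deg p - 1) * (bdeg r + bdeg l)) * phi [:: (q, rcons (r ++ l) p)])))).
  rewrite -cosumB cosumZ' -cosumN; apply: cosum_eq => p q e.
  by rewrite !bdegE -e rcons_cat; sgncases.
move: (cosum _ _) (cosum _ _) (Dl _ _) (Dl _ _) => X1 X2 X3 X4.
by rewrite !degE; sgncases.
Qed.

Lemma Bd_bt B : Bd (bt c phi) B = - bd (Bd phi) B.
Proof.
case: B => a0 s; have -> : bd (Bd phi) (a0, s) =
    bd (fun B : block C => exr B.2 (fun l a r => heps B.1 * W3 l a r)) (a0, s).
  by congr bd; apply/funext => -[b0 t]; rewrite BdE.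
rewrite bd_eps_exr; last exact: triform_W3.
rewrite (exr_eq (F := fun l a r => W3 (a0 :: l) a r - _) (G := fun _ _ _ => 0)); last first.
  by move=> l a r _ _; rewrite W3_cyc subrr.
rewrite [exr s (fun _ _ _ => 0)]ex0 addr0.
have -> : W3 [::] a0 s - sgn ((deg a0 - 1) * bdeg s) * W3 s a0 [::] = 0.
  by rewrite /W3 !bdegE cats0 /=; sgncases.
rewrite addr0 -mulrN /Bd -exrN; congr (_ * _); apply: exr_eq => l a r _ _.
by rewrite DF_W3 opprK.
Qed.
End Connes.

Section CutMore.
Variables (m : int) (C : dgOpenFrobenius m).

Lemma bdZ k (g : block C -> rat) B : bd (fun B => k * g B) B = k * bd g B.
Proof.
case: B => a0 s; rewrite !bdE DlZ !mulrDr; congr (_ + _ + _); first by gring.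
by rewrite cosumZ'; apply: cosum_eq => *; gring.
Qed.

Lemma cut_cons f q (t : seq (helt C)) : cut f (q :: t) =
  exr t (fun w b r => sgn (kap [::] q w b r) * f [::] (hmul (hred q) b, w) r) +
  exr t (fun l a t' => exr t' (fun w b r => sgn (kap (q :: l) a w b r) * f (q :: l) (hmul a b, w) r)).
Proof. by []. Qed.

Lemma cut_rcons f q (t : seq (helt C)) : cut f (rcons t q) =
  exr t (fun l a t' => exr t' (fun w b r => sgn (kap l a w b (rcons r q)) * f l (hmul a b, w) (rcons r q))) +
  exr t (fun l b w => sgn (kap l b w q [::]) * f l (hmul b (hred q), w) [::]).
Proof.
rewrite /cut exr_rcons (_ : cut1 f t (hred q) [::] = 0) // addr0 -[in RHS]exrD.
by apply: exr_eq => l a r _ _; rewrite /cut1 exr_rcons.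
Qed.
Lemma cosum_exr2 a (t : seq (helt C)) (F : helt C -> helt C -> seq (helt C) -> helt C -> seq (helt C) -> helt C -> seq (helt C) -> rat) :
  cosum a (fun p q => exr t (fun l b t' => exr t' (F p q l b))) =
  exr t (fun l b t' => exr t' (fun w b' r => cosum a (fun p q => F p q l b w b' r))).
Proof. by rewrite cosum_exr; apply: exr_eq => l b t' _ _; rewrite cosum_exr. Qed.

Lemma exr2D (t : seq (helt C)) (F G : seq (helt C) -> helt C -> seq (helt C) -> helt C -> seq (helt C) -> rat) :
  exr t (fun l b t' => exr t' (fun w b' r => F l b w b' r + G l b w b' r)) =
  exr t (fun l b t' => exr t' (F l b)) + exr t (fun l b t' => exr t' (G l b)).
Proof. by rewrite -exrD; apply: exr_eq => l b t' _ _; rewrite exrD. Qed.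

Lemma exr2Z k (t : seq (helt C)) (F : seq (helt C) -> helt C -> seq (helt C) -> helt C -> seq (helt C) -> rat) :
  exr t (fun l b t' => exr t' (fun w b' r => k * F l b w b' r)) =
  k * exr t (fun l b t' => exr t' (F l b)).
Proof. by rewrite -exrZ; apply: exr_eq => l b t' _ _; rewrite exrZ. Qed.

Lemma exr2_eq (t : seq (helt C)) (F G : seq (helt C) -> helt C -> seq (helt C) -> helt C -> seq (helt C) -> rat) :
  (forall l b w b' r, bdeg t = bdeg l + (deg b - 1) + (bdeg w + (deg b' - 1) + bdeg r) ->
    F l b w b' r = G l b w b' r) ->
  exr t (fun l b t' => exr t' (F l b)) = exr t (fun l b t' => exr t' (G l b)).
Proof.
by move=> e; apply: exr_eq => l b t' _ e1; apply: exr_eq => w b' r _ e2; apply: e; rewrite e1 e2.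
Qed.
End CutMore.

(** * The homotopy behind the defect of Connes' operator *)

Section BV.
Variables (m : int) (C : dgOpenFrobenius m).
Local Notation c := (1 - m).
Variables (phi : word C -> rat) (nf : nform phi).

(** The bracket is rotated so that a becomes the entry of the first block; k, the part before a,
    comes after what the cut leaves of the rest. *)
Definition fG (a : helt C) k l B r : rat :=
  sgn (bdeg k * (deg a - 1 + bdeg l + bdeg r) + deg a + bdeg k + m + 1) * phi [:: (a, l ++ r ++ k); B].

Definition Z3 k a t : rat := cut (fG a k) t.

Lemma nf_ctx l r B : brform (fun s => phi [:: (B.1, l ++ s ++ r); B.2]).
Proof. by apply: (brform_ctx (f := fun s => phi [:: (B.1, s); B.2])); apply: nf_r1. Qed.

Lemma cutform_fG a k : cutform (fG a k).
Proof.
split=> [B r|l r|l B|l b r]; rewrite /fG.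
- apply: brform_sgn; first by move=> *; rewrite !bdegE.
  exact: (nf_ctx [::] (r ++ k) (a, B)).
- split=> [s|b]; first by lin.
  by apply: brform_Zl; apply: nf_r2.
- apply: brform_sgn; first by move=> *; rewrite !bdegE.
  exact: (nf_ctx l k (a, B)).
- by rewrite nf_02 ?mulr0.
Qed.

Lemma cutI_fG a k l B r : cutI (fG a k) l B r = 0.
Proof.
rewrite /cutI /cosum big1 // => p _; rewrite /fG cat_rcons /= !bdegE.
by sgncases.
Qed.

Lemma nf_cat3 l r B : brform (fun s => phi [:: (B.1, l ++ r ++ s); B.2]).
Proof.
apply: (brform_catl (f := fun s => phi [:: (B.1, l ++ s); B.2])).
by apply: (brform_catl (f := fun s => phi [:: (B.1, s); B.2])); apply: nf_r1.
Qed.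

Lemma triform_Z3 : triform Z3.
Proof.
split=> [a t|k t|k a].
- rewrite /Z3 /cut /cut1 /fG; do 2 (apply: brform_exr' => ? ? ?); apply: brform_Zl.
  apply: brform_sgn; first by move=> *; rewrite !bdegE.
  exact: (nf_cat3 _ _ (_, _)).
- by rewrite /Z3 /cut /cut1 /fG; lin.
- by apply: brform_exr; apply: triform_cut1; apply: cutform_fG.
Qed.

Lemma GdE a0 s : Gd phi (a0, s) = exr s (fun k a t => heps a0 * Z3 k a t).
Proof. by rewrite /Gd exrZ. Qed.

(** By a Frobenius identity, a term of [vee] applied after B: one of the letters a and b has come to
    the front and [vee] cuts at the other. *)
Definition X5 k a w b r : rat := cosum a (fun p q =>
  sgn (kap [::] q w b r + bdeg k * (deg p + bdeg r) + m + bdeg k) *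
  phi [:: (p, r ++ k); (hmul q b, w)]).

(** The letter q inserted in front of t is the left factor of the cut; the left end term of [Dl_cut]
    completes [hred q] to q. *)
Lemma Z3_split k a t :
  cosum a (fun p q => sgn (bdeg k + deg p - 1) * exr t (fun w b r =>
    sgn (kap [::] q w b r) * fG p k [::] (hmul (hred q) b, w) r)) +
  sgn (bdeg k + deg a - 1) * exr t (fun w b r =>
    sgn (kap [::] (hone C) w b r) * fG a k [::] (hmul (hone C) b, w) r) =
  exr t (fun w b r => X5 k a w b r).
Proof.
rewrite -exrZ (cosum_eq (G := fun p q => exr t (fun w b r =>
   sgn (bdeg k + deg p - 1 + kap [::] q w b r) * fG p k [::] (hmul (hred q) b, w) r))); last first.
  by move=> p q _; rewrite -exrZ; apply: exr_eq => *; rewrite mulrA -sgnD.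
rewrite cosum_exr -exrD; apply: exr_eq => w b r _ _.
pose f p := sgn (bdeg k + deg p - 1 + kap [::] (hone C) w b r) * fG p k [::] (hmul (hone C) b, w) r.
have lf : lin1 f by rewrite /f /fG /=; lin.
have -> : sgn (bdeg k + deg a - 1) * (sgn (kap [::] (hone C) w b r) *
   fG a k [::] (hmul (hone C) b, w) r) = f a by rewrite mulrA -sgnD.
rewrite -(cosum_counitr a lf) -cosumD; apply: cosum_eq => p q e; rewrite /f /fG /=.
have lq : lin1 (fun q => phi [:: (p, r ++ k); (hmul q b, w)]).
  by apply: (lin1_mull (f := fun x => phi [:: (p, r ++ k); (x, w)])); lin.
rewrite (hred_lin _ lq) bdeg_nil /kap deg_hone.
have [/eqP q0|/heps_deg->] := boolP (deg q == 0).
  by rewrite q0 [heps q * (_ * _)]mulrC; sgnring.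
by sgnring.
Qed.

(** The coproduct of a inserts at the end of k or at the front of l, that is, at the two ends of the
    rotated bracket, as b does on the first output. What remains is a cut at the inserted letter and
    the right end term of [Dl_cut]. *)
Lemma DF_Z3 k a t : DF Z3 k a t =
  cut (fun l B r => sgn (bdeg k * (deg a - 1 + bdeg l + bdeg r) + deg a + bdeg k + m + 1) *
     bt c phi [:: (a, l ++ r ++ k); B]) t +
  exr t (fun w b r => X5 k a w b r) +
  sgn (bdeg k + deg a - 1) * exr t (fun l b w => fG a k l (hmul b (hone C), w) [::]).
Proof.
rewrite -Z3_split /DF [in sgn (bdeg k + deg a - 1) * Dl _ _]/Z3 (Dl_cut (cutform_fG a k)).
have -> : cosum a (fun p q => sgn (bdeg k + deg p - 1) * (Z3 (rcons k p) q t + Z3 k p (q :: t))) =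
  exr t (fun l b t' => exr t' (fun w b' r => cosum a (fun p q => sgn (bdeg k + deg p - 1) *
    (sgn (kap l b w b' r) * fG q (rcons k p) l (hmul b b', w) r +
     sgn (kap (q :: l) b w b' r) * fG p k (q :: l) (hmul b b', w) r)))) +
  cosum a (fun p q => sgn (bdeg k + deg p - 1) * exr t (fun w b r =>
    sgn (kap [::] q w b r) * fG p k [::] (hmul (hred q) b, w) r)).
  rewrite -cosum_exr2 -cosumD; apply: cosum_eq => p q _.
  rewrite exr2Z exr2D -mulrDr /Z3 cut_cons; congr (_ * _).
  by rewrite -addrA; congr (_ + _); rewrite addrC.
set E1 := cosum a (fun p q => _ * exr t _).
set E2 := exr t (fun w b r => _ * fG a k [::] _ _).
set E3 := exr t (fun l b w => fG a k _ _ _).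
set E4 := exr t (fun l b t' => exr t' _).
set E5 := cut _ t; set E6 := cut _ t.
suff <- : Dl (fun k => Z3 k a t) k - sgn (bdeg k) * Z3 k (hdif a) t +
  sgn (bdeg k + deg a - 1) * E5 + E4 = E6.
  by move: E1 E2 E3 E4 E5 => X1 X2 X3 X4 X5; gring.
rewrite /E4 /E5 /E6 {E1 E2 E3 E4 E5 E6} /Z3 /cut /cut1.
have -> : Dl (fun k => exr t (fun l b t' => exr t' (fun w b' r =>
      sgn (kap l b w b' r) * fG a k l (hmul b b', w) r))) k =
  exr t (fun l b t' => exr t' (fun w b' r => sgn (kap l b w b' r +
      (bdeg k - 1) * (deg a - 1 + bdeg l + bdeg r) + deg a + bdeg k + m) *
      Dl (fun k => phi [:: (a, l ++ r ++ k); (hmul b b', w)]) k)).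
  rewrite /exr Dl_ex; apply: ex_eq => l b t' _; rewrite Dl_ex; apply: ex_eq => w b' r _.
  rewrite DlZ /fG (Dl_sgn (fun d => sgn (d * _ + deg a + d + m + 1))) mulrA -sgnD.
  by congr (_ * _); sgneq.
rewrite -mulNr -!exr2Z -!exr2D; apply: exr2_eq => l b w b' r et.
rewrite cutI_fG sub0r /cutD bt2E [bd _ (a, _)]bdE !Dl_cat !bdeg_cat.
have -> : Dl (fun l => fG a k l (hmul b b', w) r) l =
  sgn (bdeg k * (deg a - 1 + bdeg l - 1 + bdeg r) + deg a + bdeg k + m + 1) *
   Dl (fun l => phi [:: (a, l ++ r ++ k); (hmul b b', w)]) l.
  by rewrite /fG (Dl_sgn (fun d => sgn (_ * (_ + d + _) + _ + _ + m + 1))) !addrA.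
have -> : Dl (fG a k l (hmul b b', w)) r =
  sgn (bdeg k * (deg a - 1 + bdeg l + bdeg r - 1) + deg a + bdeg k + m + 1) *
   Dl (fun r => phi [:: (a, l ++ r ++ k); (hmul b b', w)]) r.
  by rewrite /fG (Dl_sgn (fun d => sgn (_ * (_ + d) + _ + _ + m + 1))) !addrA.
rewrite /fG bdZ.
have -> : cosum a (fun p q => sgn (deg p) * (phi [:: (p, q :: l ++ r ++ k); (hmul b b', w)] -
     sgn ((deg q - 1) * (bdeg l + (bdeg r + bdeg k))) * phi [:: (p, rcons (l ++ r ++ k) q); (hmul b b', w)])) =
   cosum a (fun p q => sgn (deg p) * phi [:: (p, q :: l ++ r ++ k); (hmul b b', w)]) -
   cosum a (fun p q => sgn (deg p + (deg q - 1) * (bdeg l + bdeg r + bdeg k)) * phi [:: (p, rcons (l ++ r ++ k) q); (hmul b b', w)]).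
  by rewrite -cosumB; apply: cosum_eq => p q _; rewrite sgnD addrA; gring.
rewrite [cosum a (fun p q => sgn (deg p + _) * phi [:: (p, rcons (l ++ r ++ k) q); _])]cosumC; last by split=> ?; lin.
have -> : cosum a (fun p q => sgn (bdeg k + deg p - 1) *
   (sgn (kap l b w b' r) * (sgn (bdeg (rcons k p) * (deg q - 1 + bdeg l + bdeg r) + deg q + bdeg (rcons k p) + m + 1) *
       phi [:: (q, l ++ r ++ rcons k p); (hmul b b', w)]) +
    sgn (kap (q :: l) b w b' r) * (sgn (bdeg k * (deg p - 1 + bdeg (q :: l) + bdeg r) + deg p + bdeg k + m + 1) *
       phi [:: (p, (q :: l) ++ r ++ k); (hmul b b', w)]))) =
  sgn (kap l b w b' r + bdeg k * (deg a - 1 + bdeg l + bdeg r) + deg a + bdeg k + m + 1) * (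
   cosum a (fun p q => sgn (deg p) * phi [:: (p, q :: l ++ r ++ k); (hmul b b', w)]) -
   cosum a (fun p q => sgn (deg p * deg q) * (sgn (deg q + (deg p - 1) * (bdeg l + bdeg r + bdeg k)) *
     phi [:: (q, rcons (l ++ r ++ k) p); (hmul b b', w)]))).
  rewrite -cosumB cosumZ'; apply: cosum_eq => p q e.
  rewrite -e !rcons_cat /kap !bdegE.
  by sgnring.
rewrite /block_deg /= !bdeg_cat {et} !degE; move: (kap _ _ _ _ _) (bd _ _) => kp X0.
move: (Dl _ k) (Dl _ l) (Dl _ r) (cosum _ _) (cosum _ _) (phi _) => *.
by sgnring.
Qed.
Definition X3 k a t : rat := exr t (fun w b r => X5 k a w b r).
Definition Y3 a0 k a t : rat := exr t (fun l b w =>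
  - (sgn ((deg a0 - 1) * (bdeg k + deg a - 1 + bdeg t) + kap l b w a0 [::]) *
     fG a k l (hmul b a0, w) [::])).

(** Rotation cancels the two insertions of a0 except when a0, placed last, is itself the right
    factor of the cut. That case is [Y3], and the counit part of [hred a0] cancels the end term of
    [DF_Z3]. *)
Lemma Z3_cyc a0 k a t : 
  Z3 (a0 :: k) a t - sgn ((deg a0 - 1) * (bdeg k + deg a - 1 + bdeg t)) * Z3 k a (rcons t a0) =
  Y3 a0 k a t - heps a0 * (sgn (bdeg k + deg a - 1) * exr t (fun l b w => fG a k l (hmul b (hone C), w) [::])).
Proof.
rewrite /Z3 cut_rcons mulrDr opprD addrA.
have -> : cut (fG a (a0 :: k)) t = sgn ((deg a0 - 1) * (bdeg k + deg a - 1 + bdeg t)) *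
   exr t (fun l b t' => exr t' (fun w b' r => sgn (kap l b w b' (rcons r a0)) *
      fG a k l (hmul b b', w) (rcons r a0))).
  rewrite -exr2Z; apply: exr2_eq => l b w b' r et; rewrite /fG et cat_rcons /kap !bdegE.
  by rewrite !mulrA -!sgnD; congr (_ * _); sgneq.
rewrite subrr add0r -!exrZ /Y3 -[in RHS]exrB -exrN; apply: exr_eq => l b w _ et.
rewrite /fG et.
rewrite (hred_lin a0 (f := fun x => phi [:: (a, l ++ [::] ++ k); (hmul b x, w)])); last first.
  by apply: (lin1_mulr' (f := fun x => phi [:: (a, l ++ [::] ++ k); (x, w)])); lin.
rewrite /kap !bdeg_nil.
have [/eqP q0|/heps_deg->] := boolP (deg a0 == 0).
  by rewrite q0 mulrBr [_ * (heps a0 * _)]mulrCA; sgncases.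
by sgncases.
Qed.

(** The term with [X3] is half of [vee] after B, the one with [Y3] is B on the first factor after
    [vee], and [hd] is the end term in which a0 itself is rotated into place. *)
Lemma bd_Gd a0 s : bd (Gd phi) (a0, s) = Gd (bt c phi) (a0, s) +
  heps a0 * exr s X3 + exr s (Y3 a0) + hd phi (a0, s).
Proof.
have -> : bd (Gd phi) (a0, s) =
    bd (fun B : block C => exr B.2 (fun l a r => heps B.1 * Z3 l a r)) (a0, s).
  by congr bd; apply/funext => -[b0 t]; rewrite GdE.
rewrite bd_eps_exr; last exact: triform_Z3.
have -> : Z3 s a0 [::] = 0 by [].
have -> : Z3 [::] a0 s = hd phi (a0, s).
  rewrite /hd /Z3 /cut -exrZ; apply: exr_eq => l b r _ _; rewrite /cut1 -exrZ.
  apply: exr_eq => w b' r' _ _; rewrite /fG bdeg_nil cats0 [RHS]mulrCA mul0r add0r addr0.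
  by [].
rewrite mulr0 subr0; congr (_ + _).
rewrite (exr_eq (F := fun l a r => Z3 (a0 :: l) a r - _) (G := fun l a r => Y3 a0 l a r -
   heps a0 * (sgn (bdeg l + deg a - 1) * exr r (fun l' b w => fG a l l' (hmul b (hone C), w) [::])))); last first.
  by move=> l a r _ _; apply: Z3_cyc.
rewrite (exr_eq (F := DF Z3) (fun l a r _ _ => DF_Z3 l a r)).
rewrite exrB exrZ 2!exrD.
have -> : Gd (bt c phi) (a0, s) = heps a0 * exr s (fun k a t =>
   cut (fun l B r => sgn (bdeg k * (deg a - 1 + bdeg l + bdeg r) + deg a + bdeg k + m + 1) *
     bt c phi [:: (a, l ++ r ++ k); B]) t) by [].
by rewrite -/X3; gring.
Qed.
End BV.

Section Slots.
Variables (m : int) (C : dgOpenFrobenius m).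

(* The transpose of at_slot, X being a transposed block operation. *)
Definition slotd (c e : int) i (X : (word C -> rat) -> block C -> rat) phi (w : word C) : rat :=
  if drop i w is B :: v then
    sgn (e * word_deg c (take i w)) * X (fun t => phi (take i w ++ t ++ v)) B
  else 0.

Lemma word_deg_nil c : word_deg c ([::] : word C) = 0. Proof. exact: big_nil. Qed.
Lemma word_deg_cons c B (w : word C) : word_deg c (B :: w) = block_deg B - c + word_deg c w.
Proof. exact: big_cons. Qed.
Lemma word_deg_cat c (u v : word C) : word_deg c (u ++ v) = word_deg c u + word_deg c v.
Proof. exact: big_cat. Qed.

Lemma slotd0 c e X phi B (v : word C) :
  slotd c e 0 X phi (B :: v) = X (fun t => phi (t ++ v)) B.
Proof. by rewrite /slotd /= word_deg_nil mulr0 mul1r. Qed.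
Lemma slotd01 c e X phi (B : block C) : slotd c e 0 X phi [:: B] = X phi B.
Proof. by rewrite slotd0; congr (X _ B); apply/funext => t; rewrite cats0. Qed.
Lemma slotd1 c e X phi B B' (v : word C) :
  slotd c e 1 X phi (B :: B' :: v) = sgn (e * (block_deg B - c)) * X (fun t => phi (B :: t ++ v)) B'.
Proof. by rewrite /slotd /= ?drop0 ?take0 word_deg_cons word_deg_nil addr0. Qed.

End Slots.

Section BV2.
Variables (m : int) (C : dgOpenFrobenius m).
Local Notation c := (1 - m).
Implicit Types (phi : word C -> rat).

Lemma bformZ k (g : block C -> rat) : bform g -> bform (fun B => k * g B).
Proof. by move=> [g1 g2]; split=> *; [apply: lin1_Zl | apply: brform_Zl]. Qed.
Lemma bform0 : bform (fun _ : block C => 0).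
Proof. by split=> *; [exact: lin1_const0 | exact: brform0]. Qed.
Lemma bform_sgn (e : int -> int) (g : block C -> rat) : bform g -> bform (fun B => sgn (e (block_deg B)) * g B).
Proof.
move=> [g1 g2]; split=> [s|a].
  by apply: lin1_sgn => // *; rewrite /block_deg.
by apply: brform_sgn => // s t k x y; rewrite /block_deg !bdegE.
Qed.

Lemma nform_swapd phi : nform phi -> nform (swapd phi).
Proof.
move=> nf; split=> [u v|u a v].
  case: u v => [|B1 [|B2 u]] [|B3 [|B4 v]] /=; try exact: bform0.
  - apply: (bform_sgn (fun d => (d - c) * _)); exact: nf_b2.
  - apply: (bform_sgn (fun d => _ * (d - c))); exact: nf_b1.
  - by case: u => /=; [exact: bform0 | move=> *; exact: bform0].
  - by case: u => /=; [exact: bform0 | move=> *; exact: bform0].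
  - by case: u => /=; [exact: bform0 | move=> *; exact: bform0].
case: u v => [|B1 [|B2 u]] [|B3 [|B4 v]] //=; rewrite ?nf_01 ?nf_02 ?mulr0 //.
all: by case: u.
Qed.

(** The counit removes the left factor of the coproduct of a0 b, leaving a0 b as entry of the second
    block; [exr_nest] then lists the letter chosen by B before the one at which [vee] cuts. *)
Lemma vee_B phi (nf : nform phi) a0 s :
  veed c (slotd c 1 0 (@Bd m C) phi) (a0, s) = exr s (Y3 phi a0).
Proof.
rewrite /veed.
pose F l1 a l2 b w := 
  sgn (deg a0 + (1 + deg b + (deg a0 + deg b - m)) * (bdeg l1 + (deg a - 1) + bdeg l2) +
     c * (bdeg l1 + (deg a - 1) + bdeg l2) + (deg a - 1 + bdeg l2) * bdeg l1) *
    phi [:: (a, l2 ++ l1); (hmul a0 b, w)].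
transitivity (exr s (fun x b w => exr x (fun l1 a l2 => F l1 a l2 b w))).
  apply: exr_eq => x b w _ _.
  transitivity (cosum (hmul a0 b) (fun p q => heps p * (sgn (deg a0 + (1 + deg b + deg q) * bdeg x + c * bdeg x) *
     exr x (fun l a r => sgn ((deg a - 1 + bdeg r) * bdeg l) * phi [:: (a, r ++ l); (q, w)])))).
    apply: cosum_eq => p q _; rewrite slotd0 /Bd.
    have [/eqP->|/heps_deg->] := boolP (deg p == 0); last by rewrite !mul0r mulr0.
    by rewrite add0r mulrCA.
  rewrite (@cosum_counitl _ _ (hmul a0 b) (fun q => sgn (deg a0 + (1 + deg b + deg q) * bdeg x + c * bdeg x) *
     exr x (fun l a r => sgn ((deg a - 1 + bdeg r) * bdeg l) * phi [:: (a, r ++ l); (q, w)]))); last by lin.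
  rewrite -exrZ; apply: exr_eq => l1 a l2 _ ->; rewrite /F mulrA -sgnD deg_hmul.
  by [].
rewrite exr_nest; apply: exr_eq => k a t _ _; apply: exr_eq => l b w _ et.
rewrite /F (mulC_lin a0 b (f := fun x => phi [:: (a, l ++ k); (x, w)])); last by lin.
rewrite /fG cat0s et /kap !bdegE -mulrN mulrN !mulrA -!sgnD -mulNr; congr (_ * _).
by apply: sgn_parN; parity.
Qed.

(** After rotation the bracket is t ++ k, and [vee] cuts at a letter of t or of k. The first case
    gives [X3] of the swapped functional, the second [X3] itself. *)
Lemma B_vee phi (nf : nform phi) a0 s :
  Bd (slotd c 0 0 (veed c) phi) (a0, s) =
  - (heps a0 * (exr s (X3 phi) + exr s (X3 (swapd phi)))).
Proof.
rewrite /Bd -mulrN; congr (_ * _); rewrite opprD [RHS]addrC.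
have -> : - exr s (X3 (swapd phi)) = exr s (fun k a t => exr t (fun w b r =>
    sgn ((deg a - 1 + bdeg t) * bdeg k) * vee3 phi a w b (r ++ k))).
  rewrite -exrN; apply: exr_eq => k a t _ _; rewrite /X3 -exrN; apply: exr_eq => w b r _ et.
  rewrite /X5 /vee3 cosumZ' -cosumN.
  rewrite [RHS]cosumC; last by split=> ?; lin.
  rewrite cosum_mulr; last by split=> ?; lin.
  apply: cosum_eq => p q e; rewrite /swapd /block_deg /= !bdegE et -e deg_hmul.
  rewrite !mulrA -!sgnD -mulNr; congr (_ * _); rewrite /kap bdeg_nil.
  by symmetry; apply: sgn_parN; parity.
have -> : - exr s (X3 phi) = exr s (fun k a t => exr k (fun w b r =>
    sgn ((deg a - 1 + bdeg t) * (bdeg w + (deg b - 1) + bdeg r)) * vee3 phi a (t ++ w) b r)).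
  rewrite exr_nest -exrN; apply: exr_eq => w b x _ _; rewrite /X3 -exrN; apply: exr_eq => r a t _ et.
  have lc : lin1 (fun x => cosum x (fun p q =>
    sgn (deg a + (1 + deg b + deg q) * bdeg (t ++ w) + c * (deg p + bdeg (t ++ w))) *
    phi [:: (p, t ++ w); (q, r)])).
    by apply: cosum_lin; split=> ?; lin.
  rewrite /vee3 (mulC_lin a b lc) cosum_mulr; last by split=> ?; lin.
  rewrite /X5 !cosumZ' -cosumN; apply: cosum_eq => p q e.
  rewrite !bdegE -e deg_hmul !mulrA -!sgnD -mulNr; congr (_ * _); rewrite /kap bdeg_nil.
  by symmetry; apply: sgn_parN; parity.
rewrite -exrD; apply: exr_eq => k a t _ ek; rewrite slotd01 /veed exr_cat mulrDr -!exrZ.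
congr (_ + _); apply: exr_eq => w b r _ e //.
by rewrite e.
Qed.

(** [bd_Gd] yields only half of [vee] after B, so it is used for [phi] and for its swap. *)
Theorem vee_BV phi (nf : nform phi) B :
  Bd (slotd c 0 0 (veed c) phi) B =
  (veed c (slotd c 1 0 (@Bd m C) phi) B + hd phi B + (Gd (bt c phi) B - bd (Gd phi) B)) +
  (veed c (slotd c 1 0 (@Bd m C) (swapd phi)) B + hd (swapd phi) B +
    (Gd (bt c (swapd phi)) B - bd (Gd (swapd phi)) B)).
Proof.
case: B => a0 s; have nf' := nform_swapd nf.
rewrite !vee_B // !bd_Gd // B_vee //.
move: (exr _ _) (exr _ _) (exr _ _) (exr _ _) => X1 X2 Y1 Y2.
by ring.
Qed.
End BV2.

(** * Cutting out two blocks: the homotopy for the coderivation property *)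

Section Brace.
Variables (m : int) (C : dgOpenFrobenius m).
Local Notation c := (1 - m).

Lemma bd_exr_sum (F : block C -> seq (helt C) -> helt C -> seq (helt C) -> rat) B t :
  bd (fun X => exr t (F X)) B = exr t (fun l b r => bd (fun X => F X l b r) B).
Proof.
case: B => a0 s; rewrite bdE.
have -> : Dl (fun s => exr t (F (a0, s))) s = exr t (fun l b r => Dl (fun s => F (a0, s) l b r) s).
  exact: Dl_ex.
rewrite (cosum_eq (G := fun p q => exr t (fun l b r => sgn (deg p) * (F (p, q :: s) l b r -
  sgn ((deg q - 1) * bdeg s) * F (p, rcons s q) l b r)))); last by move=> p q _; rewrite exrZ exrB exrZ.
by rewrite cosum_exr -exrZ -!exrD.
Qed.

Lemma bd_sgn (e : int -> rat) (g : block C -> rat) B :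
  bd (fun X => e (block_deg X) * g X) B = e (block_deg B - 1) * bd g B.
Proof.
case: B => a0 s; rewrite !bdE /block_deg /=.
rewrite (Dl_sgn (fun d => e (deg a0 + d))) !mulrDr deg_hdif cosumZ'.
have -> : deg a0 - 1 + bdeg s = deg a0 + bdeg s - 1 by ring.
have -> : deg a0 + (bdeg s - 1) = deg a0 + bdeg s - 1 by ring.
congr (_ + _ + _); first by gring.
apply: cosum_eq => p q ed; rewrite !bdegE -ed.
have -> : deg p + (deg q - 1 + bdeg s) = deg p + deg q + bdeg s - 1 by ring.
have -> : deg p + (bdeg s + (deg q - 1)) = deg p + deg q + bdeg s - 1 by ring.
by gring.
Qed.

Variables (phi : word C -> rat) (nf : nform phi).

(** X is cut out first and Y from what follows it. The product of the shifted degrees is the sign of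
    exchanging the two blocks. *)
Definition gk a0 l X r Y t : rat :=
  sgn (bdeg l + (block_deg X - c) * (block_deg Y - c)) * phi [:: (a0, l ++ r ++ t); X; Y].
Definition fk a0 l X r : rat := cut (gk a0 l X) r.

Lemma nf_mid l r (B B' : block C) a : brform (fun s => phi [:: (a, l ++ s ++ r); B; B']).
Proof. by apply: (brform_ctx (f := fun s => phi [:: (a, s); B; B'])); apply: nf_r1. Qed.

Lemma cutform_gk a0 l X : cutform (gk a0 l X).
Proof.
split=> [B r|r t|r B|r b t]; rewrite /gk.
- by apply: brform_Zl; apply: nf_mid.
- apply: (bform_sgn (fun d => bdeg l + (block_deg X - c) * (d - c))); exact: nf_b3.
- apply: brform_Zl.
  apply: (brform_catl (f := fun s => phi [:: (a0, l ++ s); X; B])).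
  by apply: (brform_catl (f := fun s => phi [:: (a0, s); X; B])); apply: nf_r1.
- by rewrite nf_03 ?mulr0.
Qed.

Lemma cutI_gk a0 l X r B t : cutI (gk a0 l X) r B t = 0.
Proof.
by rewrite /cutI /cosum big1 // => p _; rewrite /gk cat_rcons subrr mulr0.
Qed.

Lemma fk_0 a0 l X : fk a0 l X [::] = 0. Proof. by []. Qed.

Lemma cutform_fk a0 : cutform (fk a0).
Proof.
split=> [B r|l r|l B|l b r]; rewrite /fk.
- rewrite /cut /cut1 /gk; do 2 (apply: brform_exr' => ? ? ?); apply: brform_Zl.
  apply: brform_sgn; first by move=> *; rewrite !bdegE.
  by apply: (brform_catr (f := fun s => phi [:: (a0, s); B; _])); apply: nf_r1.
- split=> [s|b]; first by rewrite /cut /cut1 /gk /block_deg /=; lin.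
  rewrite /cut /cut1 /gk /block_deg /=; do 2 (apply: brform_exr' => ? ? ?); apply: brform_Zl.
  by apply: brform_sgn; [move=> *; rewrite !bdegE | apply: nf_r2].
- by apply: brform_exr; apply: triform_cut1; apply: cutform_gk.
- rewrite /cut /cut1 /gk; rewrite /exr.
  by rewrite [LHS](ex_eq (G := fun _ _ _ => 0)) ?ex0 // => ? ? ? _;
    rewrite [LHS](ex_eq (G := fun _ _ _ => 0)) ?ex0 // => ? ? ? _; rewrite nf_02 ?mulr0.
Qed.

Lemma lin1_fk l X r : lin1 (fun a0 => fk a0 l X r).
Proof. by rewrite /fk /cut /cut1 /gk; lin. Qed.

(** Unlike in [cutI_hf], the two terms do not cancel: a letter moved to the front of r can become
    the left factor of the second cut, so that the blocks touch. The counit part of [hred p] adds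
    the unit term. *)
Lemma cutI_fk a0 l X r : cutI (fk a0) l X r =
  - cosum X.1 (fun p y => sgn ((m + bdeg r + 1) * deg p + bdeg l) *
     exr r (fun n e t => sgn (kap [::] p n e t) * gk a0 l (y, X.2) [::] (hmul p e, n) t))
  + sgn (bdeg l) * exr r (fun n e t => sgn (kap [::] (hone C) n e t) * gk a0 l X [::] (hmul (hone C) e, n) t).
Proof.
pose f y := sgn (bdeg l) * exr r (fun n e t =>
  sgn (kap [::] (hone C) n e t) * gk a0 l (y, X.2) [::] (hmul (hone C) e, n) t).
have lf : lin1 f by rewrite /f /gk /block_deg /=; lin.
have -> : sgn (bdeg l) * exr r (fun n e t =>
   sgn (kap [::] (hone C) n e t) * gk a0 l X [::] (hmul (hone C) e, n) t) = f X.1.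
  by rewrite /f -surjective_pairing.
rewrite -(cosum_counitl _ lf) -cosumN -cosumD /cutI; apply: cosum_eq => p y _.
have -> : fk a0 l (y, X.2) (p :: r) = exr r (fun n e t => sgn (kap [::] p n e t) *
    gk a0 l (y, X.2) [::] (hmul (hred p) e, n) t) + fk a0 (rcons l p) (y, X.2) r.
  rewrite /fk cut_cons; congr (_ + _); apply: exr2_eq => k b w b' t _.
  rewrite /gk cat_rcons /kap !bdegE !mulrA -!sgnD; congr (_ * _).
  by sgneq.
rewrite opprD addrCA subrr addr0 mulrN -mulrN.
have -> : exr r (fun n e t => sgn (kap [::] p n e t) *
    gk a0 l (y, X.2) [::] (hmul (hred p) e, n) t) = 
   exr r (fun n e t => sgn (kap [::] p n e t) * gk a0 l (y, X.2) [::] (hmul p e, n) t) -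
   heps p * exr r (fun n e t => sgn (kap [::] (hone C) n e t) * gk a0 l (y, X.2) [::] (hmul (hone C) e, n) t).
  rewrite -exrZ -exrB; apply: exr_eq => n e t _ _; rewrite /gk.
  rewrite (hred_lin p (f := fun x => phi [:: (a0, l ++ [::] ++ t); (y, X.2); (hmul x e, n)])); last first.
    by apply: (lin1_mull (f := fun x => phi [:: (a0, l ++ [::] ++ t); (y, X.2); (x, n)])); lin.
  have [/eqP q0|/heps_deg->] := boolP (deg p == 0).
    by rewrite /kap /block_deg /= !degE q0; sgncases.
  by rewrite /kap /block_deg /= !degE; gring.
rewrite /f.
have [/eqP q0|/heps_deg->] := boolP (deg p == 0); last by gring.
by rewrite q0 mulr0 add0r; gring.
Qed.

(** Touching blocks: one factor of the coproduct of the entry of X is multiplied into the entry of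
    Y. In [brP2], the letter that the coproduct of a0 inserts at the right end is the right factor
    of Y. *)
Definition brP1 a0 l X r : rat := - (sgn (deg a0) *
  cosum X.1 (fun p y => sgn ((m + bdeg r + 1) * deg p + bdeg l) *
     exr r (fun n e t => sgn (kap [::] p n e t) * gk a0 l (y, X.2) [::] (hmul p e, n) t))).
Definition brP2 a0 l X r : rat := cosum a0 (fun p q => - (sgn (deg p + (deg q - 1) * (bdeg l + bdeg r + 1)) *
  exr r (fun k b n => sgn (kap k b n q [::]) * gk p l X k (hmul b q, n) [::]))).

(** Of the two end terms of [Dl_cut] for the inner cut, [end1] cancels the unit term of [cutI_fk]
    and [end2] the counit part of the letter inserted last by the coproduct of a0. *)
Lemma kd_boundary_pt a0 l X r :
  fk (hdif a0) l X r + sgn (deg a0) * (cutI (fk a0) l X r - cutD (fk a0) l X r) +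
  cosum a0 (fun p q => sgn (deg p) * (sgn (deg q - 1) * fk p (q :: l) X r -
    sgn ((deg q - 1) * (bdeg l + bdeg r + 1)) * fk p l X (rcons r q))) =
  cut (fun r Y t => sgn (bdeg l + (block_deg X - c) * (block_deg Y - c)) *
     bt c phi [:: (a0, l ++ r ++ t); X; Y]) r + brP1 a0 l X r + brP2 a0 l X r.
Proof.
rewrite cutI_fk /cutD [Dl (fk a0 l X) r](Dl_cut (cutform_gk a0 l X)).
set end1 := exr r (fun n e t => _ * gk a0 l X [::] (hmul (hone C) e, n) t).
set end2 := exr r (fun l' a w => gk a0 l X l' (hmul a (hone C), w) [::]).
pose CD := cut (cutD (gk a0 l X)) r.
have -> : cut (fun l' B r => cutI (gk a0 l X) l' B r - cutD (gk a0 l X) l' B r) r = - CD.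
  rewrite /CD /cut -exrN; apply: exr_eq => ? ? ? _ _; rewrite /cut1 -exrN; apply: exr_eq => *.
  by rewrite cutI_gk sub0r mulrN.
have -> : cosum a0 (fun p q => sgn (deg p) * (sgn (deg q - 1) * fk p (q :: l) X r -
    sgn ((deg q - 1) * (bdeg l + bdeg r + 1)) * fk p l X (rcons r q))) =
  exr r (fun k a t' => exr t' (fun w b t => cosum a0 (fun p q => sgn (deg p) * (
    sgn (deg q - 1 + kap k a w b t) * gk p (q :: l) X k (hmul a b, w) t -
    sgn ((deg q - 1) * (bdeg l + bdeg r + 1) + kap k a w b (rcons t q)) * gk p l X k (hmul a b, w) (rcons t q)))))
  + brP2 a0 l X r + sgn (deg a0 + bdeg l) * end2.
  have -> : sgn (deg a0 + bdeg l) * end2 = cosum a0 (fun p q => heps q * (sgn (deg p + bdeg l) *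
      exr r (fun l' a w => gk p l X l' (hmul a (hone C), w) [::]))).
    rewrite (@cosum_counitr _ _ a0 (fun p => sgn (deg p + bdeg l) *
      exr r (fun l' a w => gk p l X l' (hmul a (hone C), w) [::]))) //.
    by rewrite /gk; lin.
  rewrite -cosum_exr2 /brP2 -!cosumD; apply: cosum_eq => p q _.
  have -> : exr r (fun k a t' => exr t' (fun w b t => sgn (deg p) * (
      sgn (deg q - 1 + kap k a w b t) * gk p (q :: l) X k (hmul a b, w) t -
      sgn ((deg q - 1) * (bdeg l + bdeg r + 1) + kap k a w b (rcons t q)) *
        gk p l X k (hmul a b, w) (rcons t q)))) =
    sgn (deg p) * (sgn (deg q - 1) * fk p (q :: l) X r -
      sgn ((deg q - 1) * (bdeg l + bdeg r + 1)) * exr r (fun k a t' => exr t' (fun w b t =>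
        sgn (kap k a w b (rcons t q)) * gk p l X k (hmul a b, w) (rcons t q)))).
    rewrite exr2Z; congr (_ * _); rewrite /fk /cut /cut1 -mulNr -!exr2Z -exr2D.
    by apply: exr2_eq => *; rewrite mulNr !mulrA -!sgnD.
  rewrite [fk p l X (rcons r q)]/fk cut_rcons.
  have -> : exr r (fun k b n => sgn (kap k b n q [::]) * gk p l X k (hmul b (hred q), n) [::]) =
    exr r (fun k b n => sgn (kap k b n q [::]) * gk p l X k (hmul b q, n) [::]) -
    heps q * (sgn (bdeg r + 1) * exr r (fun l' a w => gk p l X l' (hmul a (hone C), w) [::])).
    rewrite -!exrZ -exrB; apply: exr_eq => k b n _ er; rewrite /gk.
    rewrite (hred_lin q (f := fun x => phi [:: (p, l ++ k ++ [::]); X; (hmul b x, n)])); last first.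
      by apply: (lin1_mulr' (f := fun x => phi [:: (p, l ++ k ++ [::]); X; (x, n)])); lin.
    have [/eqP q0|/heps_deg->] := boolP (deg q == 0); last by gring.
    rewrite er /kap /block_deg /= !degE q0 bdeg_nil.
    rewrite [heps q * (sgn _ * _)]mulrCA [heps q * (sgn _ * _)]mulrCA.
    by sgnring.
  set X4 := exr r (fun l' a w => gk p l X l' (hmul a (hone C), w) [::]).
  have [/eqP q0|/heps_deg->] := boolP (deg q == 0); last by sgnring.
  rewrite q0; rewrite [heps q * (_ * X4)]mulrCA [heps q * (_ * X4)]mulrCA.
  move: (fk _ _ _ _) (exr _ _) (exr _ _) X4 => X1 X2 X3 X4.
  by sgncases.
rewrite /brP1.
set Z := cosum X.1 _; set E4 := exr r (fun k a t' => exr t' _).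
set E5 := cut _ r.
suff <- : fk (hdif a0) l X r + sgn (deg a0) * (sgn (bdeg l) * CD - Dl (fun l => fk a0 l X r) l -
   sgn (bdeg l + bdeg r + m + 1) * bd (fun X => fk a0 l X r) X) + E4 = E5.
  move: (bd _ _) (Dl _ _) (CD) (brP2 _ _ _ _) E4 E5 end1 end2 Z => *.
  by rewrite [sgn (deg a0 + bdeg l)]sgnD; gring.
rewrite /fk /E4 /E5 /CD {Z E4 E5 end1 end2 CD} /cut /cut1.
have -> : Dl (fun l => exr r (fun k b t' => exr t' (fun w b' t =>
      sgn (kap k b w b' t) * gk a0 l X k (hmul b b', w) t))) l =
  exr r (fun k b t' => exr t' (fun w b' t => sgn (kap k b w b' t + bdeg l - 1 + (block_deg X - c) * (block_deg (hmul b b', w) - c)) *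
      Dl (fun l => phi [:: (a0, l ++ k ++ t); X; (hmul b b', w)]) l)).
  rewrite /exr Dl_ex; apply: ex_eq => k b t' _; rewrite Dl_ex; apply: ex_eq => w b' t _.
  rewrite DlZ /gk (Dl_sgn (fun d => sgn (d + _))) mulrA -sgnD.
  by congr (sgn _ * _); ring.
rewrite bd_exr_sum (exr_eq (F := fun l b r => bd _ _) (G := fun k b t' => exr t' (fun w b' t =>
  sgn (kap k b w b' t + bdeg l + (block_deg X - 1 - c) * (block_deg (hmul b b', w) - c)) *
   bd (fun X => phi [:: (a0, l ++ k ++ t); X; (hmul b b', w)]) X))); last first.
  move=> k b t' _ _; rewrite bd_exr_sum; apply: exr_eq => w b' t _ _.
  rewrite bdZ /gk (bd_sgn (fun d => sgn (_ + (d - c) * _))) mulrA -sgnD.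
  by congr (sgn _ * _); ring.
rewrite !mulrDr !mulrN -!mulNr -!exr2Z -!exr2D; apply: exr2_eq => k b w b' t er.
rewrite er /cutD bt3E [bd _ (a0, _)]bdE !Dl_cat !bdeg_cat.
rewrite /gk !DlZ (bd_sgn (fun d => sgn (_ + _ * (d - c)))).
have -> : cosum a0 (fun p q => sgn (deg p) * (
    sgn (deg q - 1 + kap k b w b' t) * (sgn (bdeg (q :: l) + (block_deg X - c) * (block_deg (hmul b b', w) - c)) *
      phi [:: (p, (q :: l) ++ k ++ t); X; (hmul b b', w)]) -
    sgn ((deg q - 1) * (bdeg l + (bdeg k + (deg b - 1) + (bdeg w + (deg b' - 1) + bdeg t)) + 1) + kap k b w b' (rcons t q)) *
     (sgn (bdeg l + (block_deg X - c) * (block_deg (hmul b b', w) - c)) *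
      phi [:: (p, l ++ k ++ rcons t q); X; (hmul b b', w)]))) =
  sgn (kap k b w b' t + bdeg l + (block_deg X - c) * (block_deg (hmul b b', w) - c)) *
  cosum a0 (fun p q => sgn (deg p) * (phi [:: (p, q :: l ++ k ++ t); X; (hmul b b', w)] -
     sgn ((deg q - 1) * (bdeg l + (bdeg k + bdeg t))) *
       phi [:: (p, rcons (l ++ k ++ t) q); X; (hmul b b', w)])).
  rewrite cosumZ'; apply: cosum_eq => p q _; rewrite !rcons_cat /kap !bdegE.
  by rewrite !mulrBr !mulrA -!sgnD; congr (_ * _ - _ * _); sgneq.
move: (bd _ X) (bd _ _) => B1 B2.
(* The letters b, w, b' together have the degree of the cut block up to the constant m - 2. *)
rewrite (_ : _ + (bdeg w + _ + _) = bdeg k + (block_deg (hmul b b', w) + m - 1 - 1) + bdeg t); last by rewrite /block_deg /= degE; ring.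
rewrite [block_deg (a0, _)]/block_deg /= bdeg_cat bdeg_cat; move: (kap _ _ _ _ _) (block_deg _) (block_deg _) => kp dX dY.
move: (Dl _ k) (Dl _ l) (Dl _ t) (cosum _ _) (phi _) => *.
by sgnring.
Qed.
End Brace.

Section Brace2.
Variables (m : int) (C : dgOpenFrobenius m).
Local Notation c := (1 - m).

Definition sw01d (phi : word C -> rat) (w : word C) : rat :=
  if w is [:: x; y; z] then sgn ((block_deg x - c) * (block_deg y - c)) * phi [:: y; x; z] else 0.

Lemma mulAC_lin (f : helt C -> rat) x y z : lin1 f ->
  f (hmul (hmul x y) z) = sgn (deg y * deg z + m) * f (hmul (hmul x z) y).
Proof.
move=> lf; rewrite !mulA_lin // (mulC_lin y z (lin1_mulr' x lf)).
by rewrite !mulrA -!sgnD; congr (sgn _ * _); ring.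
Qed.

Variables (phi : word C -> rat) (nf : nform phi).
Local Notation fk := (fk phi).

Lemma kdE a0 s : kd c phi (a0, s) = exr s (cut1 (fk a0)).
Proof. by []. Qed.

Lemma cut1_fk_pt a0 l a t :
  cut1 (fk (hdif a0)) l a t + sgn (deg a0) * DF (cut1 (fk a0)) l a t +
  cosum a0 (fun p q => sgn (deg p) * (cut1 (fk p) (q :: l) a t -
    sgn ((deg q - 1) * (bdeg l + deg a - 1 + bdeg t)) * cut1 (fk p) l a (rcons t q))) =
  exr t (fun w b r => sgn (kap l a w b r) * (
    cut (fun k Y t => sgn (bdeg l + (block_deg (hmul a b, w) - c) * (block_deg Y - c)) *
     bt c phi [:: (a0, l ++ k ++ t); (hmul a b, w); Y]) r + brP1 phi a0 l (hmul a b, w) r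
     + brP2 phi a0 l (hmul a b, w) r)).
Proof.
rewrite (DF_cut1 (cutform_fk nf a0)) fk_0 addr0.
have -> : cosum a0 (fun p q => sgn (deg p) * (cut1 (fk p) (q :: l) a t -
    sgn ((deg q - 1) * (bdeg l + deg a - 1 + bdeg t)) * cut1 (fk p) l a (rcons t q))) =
  exr t (fun w b r => sgn (kap l a w b r) * cosum a0 (fun p q => sgn (deg p) *
   (sgn (deg q - 1) * fk p (q :: l) (hmul a b, w) r -
    sgn ((deg q - 1) * (bdeg l + bdeg r + 1)) * fk p l (hmul a b, w) (rcons r q)))).
  transitivity (cosum a0 (fun p q => exr t (fun w b r => sgn (kap l a w b r) * (sgn (deg p) *
   (sgn (deg q - 1) * fk p (q :: l) (hmul a b, w) r -
    sgn ((deg q - 1) * (bdeg l + bdeg r + 1)) * fk p l (hmul a b, w) (rcons r q))))));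
    last by rewrite cosum_exr; apply: exr_eq => *; rewrite cosumZ'.
  apply: cosum_eq => p q _; rewrite /cut1 exr_rcons fk_0 mulr0 addr0 -exrZ -exrB -exrZ.
  apply: exr_eq => w b r _ et; rewrite !mulrBr !mulrA -!sgnD et /kap !bdegE.
  by congr (_ * _ - _ * _); sgneq.
rewrite -exrZ -!exrD; apply: exr_eq => w b r _ _.
by rewrite -kd_boundary_pt //; gring.
Qed.

(** Besides the touching blocks, each end contributes: the letter inserted by the coproduct of a0 is
    the right factor of Y or the left factor of X. *)
Lemma bd_kd a0 s : bd (kd c phi) (a0, s) = kd c (bt c phi) (a0, s) +
  exr s (fun l a t => exr t (fun w b r => sgn (kap l a w b r) * brP1 phi a0 l (hmul a b, w) r)) +
  exr s (fun l a t => exr t (fun w b r => sgn (kap l a w b r) * brP2 phi a0 l (hmul a b, w) r)) +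
  cosum a0 (fun p q => sgn (deg p) * cut1 (fk p) [::] q s).
Proof.
have -> : bd (kd c phi) (a0, s) = bd (fun B : block C => exr B.2 (cut1 (fk B.1))) (a0, s).
  by congr bd; apply/funext => -[b0 t].
rewrite (bd_exr (F := fun a0 => cut1 (fk a0))); first last.
- by move=> l a r; apply: lin1_exr => *; apply: lin1_Zl; apply: lin1_fk.
- by move=> b0; apply: triform_cut1; apply: cutform_fk.
rewrite (exr_eq (fun l a t _ _ => cut1_fk_pt a0 l a t)); congr (_ + _).
  have -> : kd c (bt c phi) (a0, s) = exr s (fun l a t => exr t (fun w b r => sgn (kap l a w b r) *
    cut (fun k Y t => sgn (bdeg l + (block_deg (hmul a b, w) - c) * (block_deg Y - c)) *
     bt c phi [:: (a0, l ++ k ++ t); (hmul a b, w); Y]) r)) by [].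
  by rewrite -!exr2D; apply: exr2_eq => l a w b r _; rewrite !mulrDr.
apply: cosum_eq => p q _; have -> : cut1 (fk p) s q [::] = 0 by [].
by rewrite mulr0 subr0.
Qed.

(** Two blocks touching at b are what [vee], cutting at b, makes of the single block (a e)[w, b, n];
    [mulAC_lin] reorders the triple product. *)
Lemma brace_match1 a0 s :
  exr s (fun l a t => exr t (fun w b r => sgn (kap l a w b r) * brP1 phi a0 l (hmul a b, w) r)) =
  - hd (slotd c 0 1 (veed c) phi) (a0, s).
Proof.
rewrite /hd /cut -exrZ -exrN; apply: exr_eq => l a x _ _.
rewrite /cut1 -exrZ -exrN.
pose G w b n e t := - (sgn (deg a0 + m + 1 + kap l a (w ++ b :: n) e t) * vee3 (fun u => phi ((a0, l ++ t) :: u)) (hmul a e) w b n).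
transitivity (exr x (fun v e t => exr v (fun w b n => G w b n e t))); last first.
  apply: exr_eq => v e t _ _; rewrite slotd1 /veed mul0r mul1r -!exrZ -exrN.
  rewrite [RHS](_ : _ = exr v (fun w b n => - (sgn (deg a0 + m + 1 + kap l a v e t) * vee3 (fun u => phi ((a0, l ++ t) :: u)) (hmul a e) w b n))); last first.
    by apply: exr_eq => w b n _ _; rewrite mulrA -sgnD /vee3.
  by apply: exr_eq => w b n _ ev; rewrite /G /kap !bdegE ev; congr (- (sgn _ * _)); ring.
rewrite exr_nest; apply: exr_eq => w b r _ _.
rewrite /brP1 mulrN.
rewrite [RHS](_ : _ = exr r (fun n e t => - - G w b n e t)); last by apply: exr_eq => *; rewrite opprK.
rewrite [RHS]exrN; congr (- _).
rewrite mulrA -sgnD cosumZ' /=.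
rewrite (cosum_eq (G := fun p y => exr r (fun n e t => sgn (kap l a w b r + deg a0 + ((m + bdeg r + 1) * deg p + bdeg l)
    + kap [::] p n e t) * gk phi a0 l (y, w) [::] (hmul p e, n) t))); last first.
  by move=> p y _; rewrite mulrA -sgnD -exrZ; apply: exr_eq => *; rewrite mulrA -sgnD.
rewrite cosum_exr; apply: exr_eq => n e t _ er.
rewrite /G opprK /vee3.
have bG : bilin (fun p q => sgn (deg (hmul a e) + (1 + deg b + deg q) * bdeg w + c * (deg p + bdeg w)) *
      phi [:: (a0, l ++ t); (p, w); (q, n)]) by split=> ?; lin.
have lG := cosum_lin bG.
rewrite (mulAC_lin a e b lG).
rewrite [cosum (hmul (hmul a b) e) _]cosumC // [cosum (hmul (hmul a b) e) _]cosum_mulL; last first.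
  by split=> ?; lin.
rewrite !cosumZ'; apply: cosum_eq => p y ey.
have ea : deg a = deg p + deg y - deg b + m by rewrite ey deg_hmul; ring.
rewrite /gk /= !mulrA -!sgnD; congr (_ * _).
by rewrite /block_deg /= !degE /kap er ?bdegE ea; sgneq.
Qed.
(** The right factor of Y becomes the letter at which [vee] cuts: Y is the right output, and X is
    cut out of the left one. *)
Lemma brace_match2 a0 s :
  exr s (fun l a t => exr t (fun w b r => sgn (kap l a w b r) * brP2 phi a0 l (hmul a b, w) r)) =
  veed c (slotd c 1 0 (@hd m C) phi) (a0, s).
Proof.
pose G l a w b k b' n := cosum (hmul a0 b') (fun p q =>
  sgn (deg a0 + (1 + deg b' + deg q) * bdeg (l ++ a :: w ++ b :: k) +
     c * (deg p + bdeg (l ++ a :: w ++ b :: k)) + deg p + m + 1 + kap l a w b k) *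
   phi [:: (p, l ++ k); (hmul a b, w); (q, n)]).
transitivity (exr s (fun x b' n => exr x (fun l a y => exr y (fun w b k => G l a w b k b' n)))); last first.
  apply: exr_eq => x b' n _ _.
  rewrite /G -cosum_exr2; apply: cosum_eq => p q _.
  rewrite slotd0 /hd /cut /cut1 -!exr2Z; apply: exr2_eq => l a w b k ex.
  rewrite !mulrA -!sgnD !bdegE ex.
  by congr (sgn _ * _); ring.
rewrite exr_nest; apply: exr_eq => l a t _ _.
rewrite (exr_nest _ (fun w b k b' n => G l a w b k b' n)); apply: exr_eq => w b r _ _.
rewrite /brP2 cosumZ' (cosum_eq (G := fun p q => exr r (fun k b' n => - (sgn (kap l a w b r + deg p +
    (deg q - 1) * (bdeg l + bdeg r + 1) + kap k b' n q [::]) * gk phi p l (hmul a b, w) k (hmul b' q, n) [::])))); last first.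
  move=> p q _; rewrite mulrN mulrA -sgnD -exrZ -exrN; apply: exr_eq => k b' n _ _.
  by rewrite mulrA -sgnD; congr (- (sgn _ * _)); ring.
rewrite cosum_exr; apply: exr_eq => k b' n _ er.
rewrite /G cosum_mulr; last by split=> ?; lin.
apply: cosum_eq => p q e.
rewrite (mulC_lin q b' (f := fun x => phi [:: (p, l ++ k); (hmul a b, w); (x, n)])); last by lin.
rewrite /gk cats0 !mulrA -!sgnD -mulNr; congr (_ * _).
symmetry; apply: sgn_parN.
by rewrite /block_deg /= !degE /kap er ?bdegE -e; parity.
Qed.

(** X is the left output of [vee], cutting at b, and Y is cut out of the right output. The block
    with entry a0 then comes from the right output, hence the swap. *)
Lemma brace_match3 a0 s :
  cosum a0 (fun p q => sgn (deg p) * cut1 (fk p) [::] q s) =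
  veed c (slotd c 1 1 (@hd m C) (sw01d phi)) (a0, s).
Proof.
rewrite (cosum_eq (G := fun p q => exr s (fun w b r => sgn (deg p + kap [::] q w b r) * fk p [::] (hmul q b, w) r))); last first.
  by move=> p q _; rewrite /cut1 -exrZ; apply: exr_eq => *; rewrite mulrA -sgnD.
rewrite cosum_exr; apply: exr_eq => w b r _ _.
pose G P Q := exr r (fun k x t' => exr t' (fun n e t =>
  sgn (deg a0 + (1 + deg b + deg Q) * bdeg w + c * (deg P + bdeg w) + (deg P + bdeg w - c) + deg Q + m + 1
     + kap k x n e t + (deg P + bdeg w - c) * (deg Q + bdeg k + bdeg t - c)) *
   phi [:: (Q, k ++ t); (P, w); (hmul x e, n)])).
have -> : cosum (hmul a0 b) (fun P Q => sgn (deg a0 + (1 + deg b + deg Q) * bdeg w + c * (deg P + bdeg w)) *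
   slotd c 1 1 (@hd m C) (sw01d phi) [:: (P, w); (Q, r)]) = cosum (hmul a0 b) G.
  apply: cosum_eq => P Q _; rewrite slotd1 /hd /cut /cut1 -!exr2Z; apply: exr2_eq => k x n e t _.
  rewrite /sw01d /= /block_deg /= !bdegE !mulrA -!sgnD; congr (sgn _ * _).
  by ring.
rewrite [RHS]cosumC; last by rewrite /G; split=> ?; lin.
rewrite [RHS]cosum_mulr; last by rewrite /G; split=> ?; lin.
apply: cosum_eq => p q ea; rewrite /G /fk /cut /cut1 mulrA -sgnD -!exr2Z; apply: exr2_eq => k x n e t er.
rewrite /gk /= !mulrA -!sgnD; congr (_ * _).
by rewrite /block_deg /= !degE /kap er ?bdegE -ea; sgneq.
Qed.

Theorem hd_vee B :
  hd (slotd c 0 1 (veed c) phi) B =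
  veed c (slotd c 1 0 (@hd m C) phi) B + veed c (slotd c 1 1 (@hd m C) (sw01d phi)) B
  + (kd c (bt c phi) B - bd (kd c phi) B).
Proof.
case: B => a0 s; rewrite bd_kd brace_match1 brace_match2 brace_match3.
by move: (hd _ _) (veed _ _ _) (veed _ _ _) (kd _ _ _) => *; ring.
Qed.
End Brace2.

Lemma exr_exchange (m : int) (C : dgOpenFrobenius m) (s t : seq (helt C))
    (F : seq (helt C) -> helt C -> seq (helt C) -> seq (helt C) -> helt C -> seq (helt C) -> rat) :
  exr s (fun l a r => exr t (fun l' a' r' => F l a r l' a' r')) =
  exr t (fun l' a' r' => exr s (fun l a r => F l a r l' a' r')).
Proof.
rewrite /exr; elim: s F => [|x s IH] F /=; first by rewrite ex0.
by rewrite exD (IH (fun l => F (x :: l))).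
Qed.

(** * Identities that hold without homotopy *)

Section Coassoc.
Variables (m : int) (C : dgOpenFrobenius m).
Local Notation c := (1 - m).

Lemma tri_mulr a x (T : helt C -> helt C -> helt C -> rat) : trilin T ->
  cosum x (fun p q => sgn (m * deg p) * cosum (hmul q a) (fun y z => T p y z)) = tri (hmul x a) T.
Proof.
move=> tT; have [T1 T2 T3] := tT; rewrite triA // [RHS]cosum_mulr //.
by split=> y; [apply: lin1_cosum | apply: cosum_lin].
Qed.

Definition sw12d (phi : word C -> rat) (w : word C) : rat :=
  if w is [:: x; y; z] then sgn ((block_deg y - c) * (block_deg z - c)) * phi [:: x; z; y] else 0.

Variables (phi : word C -> rat) (nf : nform phi).

(** Both sides run over two cut letters a and b and are iterated coproducts, of (a0 b) a and of (a0
    a) b; [mulAC_lin] exchanges the two products. *)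
Lemma veed_coassoc B :
  veed c (slotd c 0 0 (veed c) phi) B = veed c (slotd c 0 1 (veed c) phi) B.
Proof.
case: B => a0 s; rewrite /veed.
pose G l a w b r := cosum (hmul a0 b) (fun P Q => cosum (hmul P a) (fun P' Q' =>
   sgn (deg a0 + (1 + deg b + deg Q) * (bdeg l + (deg a - 1 + bdeg w)) + c * (deg P + (bdeg l + (deg a - 1 + bdeg w))) +
     deg P + (1 + deg a + deg Q') * bdeg l + c * (deg P' + bdeg l)) * phi [:: (P', l); (Q', w); (Q, r)])).
transitivity (exr s (fun x b r => exr x (fun l a w => G l a w b r))).
  apply: exr_eq => x b r _ _; rewrite /G -cosum_exr; apply: cosum_eq => P Q _.
  rewrite slotd0 -exrZ; apply: exr_eq => l a w _ ex; rewrite cosumZ'; apply: cosum_eq => P' Q' _.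
  by rewrite mulrA -sgnD ex !addrA.
rewrite exr_nest; apply: exr_eq => l a t _ _.
transitivity (exr t (fun w b r => cosum (hmul a0 a) (fun P Q => cosum (hmul Q b) (fun P' Q' => 
  sgn (deg a0 + (1 + deg a + deg Q) * bdeg l + c * (deg P + bdeg l) +
    deg Q + (1 + deg b + deg Q') * bdeg w + c * (deg P' + bdeg w)) * phi [:: (P, l); (P', w); (Q', r)])))); last first.
  rewrite -cosum_exr; apply: cosum_eq => P Q _.
  rewrite slotd1 mul0r mul1r -exrZ; apply: exr_eq => w b r _ et; rewrite cosumZ'; apply: cosum_eq => P' Q' _.
  by rewrite mulrA -sgnD !addrA.
apply: exr_eq => w b r _ _; rewrite /G.
pose T P P' Q' := sgn (deg a0 + (1 + deg a + (deg P' + deg Q' - deg b + m)) * bdeg l + c * (deg P + bdeg l) +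
    (deg P' + deg Q' - deg b + m) + (1 + deg b + deg Q') * bdeg w + c * (deg P' + bdeg w) + m * deg P) *
    phi [:: (P, l); (P', w); (Q', r)].
have tT : trilin T by rewrite /T; split=> ? ?; lin.
transitivity (tri (hmul (hmul a0 a) b) T); last first.
  rewrite -tri_mulr //; apply: cosum_eq => P Q _; rewrite cosumZ'; apply: cosum_eq => P' Q'.
  rewrite deg_hmul => e; rewrite /T mulrA -sgnD; congr (_ * _).
  by rewrite e; sgneq.
rewrite (mulAC_lin a0 a b (lin1_tri tT)) -tri_mulL // cosumZ'.
apply: cosum_eq => P Q; rewrite deg_hmul => e; rewrite mulrA -sgnD cosumZ'; apply: cosum_eq => P' Q'.
rewrite deg_hmul => e'; rewrite /T mulrA -sgnD; congr (_ * _).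
have -> : deg a0 = deg P' + deg Q' - deg a + m + deg Q - deg b + m by rewrite e' -[deg a0](addrK (deg b)) -(addrK (- m) (_ + deg b)) opprK -e; ring.
have -> : deg P = deg P' + deg Q' - deg a + m by rewrite e'; ring.
by sgneq.
Qed.

(** The letter at which [vee] cuts l ++ r lies in r or in l; accordingly the block is cut out of the
    left or of the right output, and both sides have the same terms. *)
Lemma vee_hd B :
  hd (slotd c 0 0 (veed c) phi) B =
  veed c (slotd c 1 0 (@hd m C) (sw12d phi)) B + veed c (slotd c 1 1 (@hd m C) phi) B.
Proof.
case: B => a0 s.
pose G1 l1 e l2 a w b r := cosum (hmul a0 e) (fun P Q =>
  sgn (deg a0 + m + 1 + kap (l1 ++ e :: l2) a w b r + deg a0 + (1 + deg e + deg Q) * bdeg l1 + c * (deg P + bdeg l1)) *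
  phi [:: (P, l1); (Q, l2 ++ r); (hmul a b, w)]).
pose G2 l a w b r1 e r2 := cosum (hmul a0 e) (fun P Q =>
  sgn (deg a0 + m + 1 + kap l a w b (r1 ++ e :: r2) + deg a0 + (1 + deg e + deg Q) * (bdeg l + bdeg r1) + c * (deg P + (bdeg l + bdeg r1))) *
  phi [:: (P, l ++ r1); (Q, r2); (hmul a b, w)]).
transitivity (exr s (fun l a t => exr t (fun w b r => exr r (fun r1 e r2 => G2 l a w b r1 e r2))) +
  exr s (fun l a t => exr l (fun l1 e l2 => exr t (fun w b r => G1 l1 e l2 a w b r)))).
  rewrite /hd /cut -exrZ -exrD; apply: exr_eq => l a t _ _.
  rewrite /cut1 -exrZ.
  transitivity (exr t (fun w b r => exr r (fun r1 e r2 => G2 l a w b r1 e r2) + exr l (fun l1 e l2 => G1 l1 e l2 a w b r))); last first.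
    rewrite exrD; congr (_ + _).
    exact: exr_exchange.
  apply: exr_eq => w b r _ _.
  rewrite slotd0 /veed exr_cat [RHS]addrC !mulrDr -!exrZ; congr (_ + _); apply: exr_eq => l1 e l2 _ el.
    by rewrite /G1 !cosumZ'; apply: cosum_eq => P Q _; rewrite !mulrA -!sgnD /kap !bdegE el;
      congr (sgn _ * _); ring.
  by rewrite /G2 !cosumZ'; apply: cosum_eq => P Q _; rewrite !mulrA -!sgnD /kap !bdegE el;
      congr (sgn _ * _); ring.
congr (_ + _).
  transitivity (exr s (fun x e r2 => exr x (fun l a y => exr y (fun w b r1 => G2 l a w b r1 e r2)))).
    rewrite exr_nest; apply: exr_eq => l a t _ _.
    by rewrite -(exr_nest t (fun w b r1 e r2 => G2 l a w b r1 e r2)).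
  apply: exr_eq => x e r2 _ _.
  rewrite /G2 -cosum_exr2; apply: cosum_eq => P Q ed.
  rewrite slotd0 /hd /cut /cut1 -!exr2Z; apply: exr2_eq => l a w b r1 ex.
  rewrite /sw12d /= !mulrA -!sgnD; congr (_ * _).
  rewrite /block_deg /= !degE /kap !bdegE ex.
  have -> : deg a0 = deg P + deg Q - deg e + m by rewrite ed deg_hmul; ring.
  by sgneq.
rewrite (exr_nest s (fun l1 e l2 a t => exr t (fun w b r => G1 l1 e l2 a w b r))).
apply: exr_eq => l1 e y _ _; rewrite /G1 -cosum_exr2; apply: cosum_eq => P Q ed.
rewrite slotd1 /hd /cut /cut1 -!exr2Z; apply: exr2_eq => l2 a w b r ey.
rewrite /= !mulrA -!sgnD; congr (_ * _).
rewrite /block_deg /= /kap ?bdegE.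
have -> : deg a0 = deg P + deg Q - deg e + m by rewrite ed deg_hmul; ring.
by sgneq.
Qed.

(** B takes its new entry in ker eps, where the counit of the next B vanishes. *)
Lemma Bd_Bd B : Bd (slotd c 1 0 (@Bd m C) phi) B = 0.
Proof.
case: B => a0 s; rewrite /Bd (_ : exr _ _ = exr s (fun _ _ _ => 0)) ?[exr s _]ex0 ?mulr0 //.
by apply: exr_eq => l a r ea _; rewrite slotd01 /Bd ea mul0r mulr0.
Qed.
End Coassoc.

(** * Families of chains and bounded functionals *)

Section Supp.
Variable K : choiceType.
Implicit Types (P : K -> Prop) (u v : {freeg K / rat}).

Definition supp P u := forall w, w \in dom u -> P w.

Lemma supp0 P : supp P 0. Proof. by move=> w; rewrite dom0. Qed.
Lemma suppU P w : P w -> supp P << w >>.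
Proof. by move=> Pw x; rewrite domU1 inE => /eqP->. Qed.
Lemma suppD P u v : supp P u -> supp P v -> supp P (u + v).
Proof. by move=> Pu Pv w /domD_subset; rewrite mem_cat => /orP[/Pu|/Pv]. Qed.
Lemma suppZ P a u : supp P u -> supp P (a *: u).
Proof. by move=> Pu w /domZ_subset /Pu. Qed.
Lemma suppN P u : supp P u -> supp P (- u).
Proof. by rewrite -scaleN1r; apply: suppZ. Qed.
Lemma suppB P u v : supp P u -> supp P v -> supp P (u - v).
Proof. by move=> ? ?; apply: suppD => //; apply: suppN. Qed.
Lemma supp_sum (I : Type) P (r : seq I) (Q : pred I) (F : I -> {freeg K / rat}) :
  (forall i, Q i -> supp P (F i)) -> supp P (\sum_(i <- r | Q i) F i).
Proof. by move=> PF; elim/big_rec: _ => [|i u Qi Pu]; [exact: supp0 | apply: suppD => //; apply: PF]. Qed.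
Lemma supp_sum_seq (I : eqType) P (r : seq I) (F : I -> {freeg K / rat}) :
  (forall i, i \in r -> supp P (F i)) -> supp P (\sum_(i <- r) F i).
Proof. by move=> PF; rewrite big_seq; apply: supp_sum. Qed.

Lemma fglift_eq (f g : K -> rat) u : supp (fun w => f w = g w) u ->
  fglift (f : _ -> rat^o) u = fglift (g : _ -> rat^o) u.
Proof. by move=> e; rewrite !fgliftE; apply: eq_big_seq => w /e->. Qed.

Lemma fglift_eq0 (f : K -> rat) u : supp (fun w => f w = 0) u -> fglift (f : _ -> rat^o) u = 0.
Proof. by move=> e; rewrite fgliftE big_seq big1 // => w /e->; rewrite mulr0. Qed.

Lemma sub_supp P Q u : (forall w, P w -> Q w) -> supp P u -> supp Q u.
Proof. by move=> PQ Pu w /Pu /PQ. Qed.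
Lemma fglift_sumf (I : Type) (r : seq I) (F : I -> K -> rat) u :
  \sum_(i <- r) fglift (F i : _ -> rat^o) u = fglift ((fun w => \sum_(i <- r) F i w) : _ -> rat^o) u.
Proof.
rewrite fgliftE (eq_bigr _ (fun i _ => fgliftE (F i) u)) exchange_big /=.
by apply: eq_bigr => w _; rewrite mulr_sumr.
Qed.
End Supp.

Lemma supp_fglift (K L : choiceType) (Q : L -> Prop) (G : K -> {freeg L / rat}) (u : {freeg K / rat}) :
  supp (fun w => supp Q (G w)) u -> supp Q (fglift G u).
Proof.
move=> h; rewrite -[u]freeg_sumE raddf_sum; apply: supp_sum_seq => w wu.
by rewrite /= liftU; apply: suppZ; apply: h.
Qed.

Section Lists.
Definition Lr (r N : nat) : seq (seq nat) := [seq [seq val i | i <- tval t] | t : r.-tuple 'I_N].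

Lemma Lr_uniq r N : uniq (Lr r N).
Proof.
rewrite map_inj_uniq ?enum_uniq // => t1 t2 /(inj_map val_inj) e.
exact: val_inj.
Qed.

Lemma mem_Lr r N ns : (ns \in Lr r N) = (size ns == r) && all (fun n => (n < N)%N) ns.
Proof.
apply/imageP/andP => [[t _ ->]|[/eqP sr al]].
  by rewrite size_map size_tuple eqxx; split=> //; rewrite all_map; apply/allP => i _ /=.
case: N al => [|N] al.
  case: ns sr al => // sr _; subst r; exists [tuple] => //=.
have st : size [seq inord n : 'I_N.+1 | n <- ns] == r by rewrite size_map sr.
exists (Tuple st) => //=; rewrite -map_comp -[LHS]map_id; apply/eq_in_map => n /(allP al) nN /=.
by rewrite inordK.
Qed.

Lemma big_Lr (V : nmodType) r N (F : seq nat -> V) :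
  \sum_(t : r.-tuple 'I_N) F [seq val i | i <- t] = \sum_(ns <- Lr r N) F ns.
Proof. by rewrite /Lr big_image. Qed.

Lemma sum_Lr_ge (V : nmodType) r M N (F : seq nat -> V) : (M <= N)%N ->
  (forall ns, size ns = r -> ~~ all (fun n => (n < M)%N) ns -> F ns = 0) ->
  \sum_(ns <- Lr r N) F ns = \sum_(ns <- Lr r M) F ns.
Proof.
move=> MN F0; rewrite (bigID (fun ns => all (fun n => (n < M)%N) ns)) /= [X in _ + X]big1_seq ?addr0.
  rewrite -big_filter; apply: perm_big; apply: uniq_perm; rewrite ?filter_uniq ?Lr_uniq // => ns.
  rewrite mem_filter !mem_Lr; case: (boolP (all _ ns)) => //= al; rewrite ?andbF ?andbT //.
  case: eqP => //= _; apply/allP => n /(allP al) nM; exact: leq_trans nM MN.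
by move=> ns /andP[h]; rewrite mem_Lr => /andP[/eqP sr _]; apply: F0.
Qed.

Lemma sumn_mem ns n : n \in ns -> (n <= sumn ns)%N.
Proof. by elim: ns => //= k ns IH; rewrite inE => /orP[/eqP->|/IH]; lia. Qed.
End Lists.

(** * The pairing of families with functionals of bounded shape *)

Section Pairing.
Variables (m : int) (C : dgOpenFrobenius m).
Local Notation c := (1 - m).
Implicit Types (phi psi : word C -> rat) (f g : family C) (w u : word C).

Definition bounded phi N := forall w, (N < sumn (shape w))%N -> phi w = 0.

(* Functionals supported on finitely many shapes: these separate families up to
   null ones, and their pairing with a family is a finite sum. *)
Definition good r phi :=
  [/\ nform phi, forall w, size w <> r -> phi w = 0 & exists N, bounded phi N].

Definition supported r f := forall ns w, w \in dom (f ns) ->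
  [/\ size ns = r, 0%N \notin ns & shape w = ns].

Lemma chain_supported k r d f : is_chain k r d f -> supported r f.
Proof. by move=> cf ns w /cf []. Qed.

Definition pairN r N phi f : rat := \sum_(ns <- Lr r N.+1) fglift (phi : _ -> rat^o) (f ns).

Lemma pairN_ge r M N phi f : supported r f -> (M <= N)%N -> bounded phi M ->
  pairN r N phi f = pairN r M phi f.
Proof.
move=> sf MN bM; apply: sum_Lr_ge => // ns _ /allPn[n nns nM].
apply: fglift_eq0 => w /sf [_ _ ew]; apply: bM; rewrite ew.
by apply: leq_trans (sumn_mem nns); rewrite -leqNgt in nM.
Qed.

(** A bound chosen classically, 0 if there is none; by [pairE] the choice is immaterial. *)
Definition bnd phi : nat :=
  if pselect (exists N, bounded phi N) is left e then projT1 (cid e) else 0%N.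

Lemma bndP phi : (exists N, bounded phi N) -> bounded phi (bnd phi).
Proof. by rewrite /bnd; case: pselect => // e _; case: cid. Qed.

Definition pair r phi f : rat := pairN r (bnd phi) phi f.

Lemma pairE r N phi f : supported r f -> bounded phi N -> pair r phi f = pairN r N phi f.
Proof.
move=> sf bN; have b : bounded phi (bnd phi) by apply: bndP; exists N.
by rewrite /pair -(pairN_ge sf (leq_maxl (bnd phi) N) b) (pairN_ge sf (leq_maxr (bnd phi) N) bN).
Qed.

(* extend is the case K = 2; the homotopies shorten brackets by up to 4 letters. *)
Definition extK (K r : nat) (G : word C -> {freeg (word C) / rat}) f : family C :=
  fun ns => \sum_(t : r.-tuple 'I_(K + sumn ns)%N) fglift (@keep m C ns) (fglift G (f [seq val i | i <- t])).

(** Cut off at words of length r, because [good r] asks functionals to vanish elsewhere. *)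
Definition pull (r : nat) (G : word C -> {freeg (word C) / rat}) phi : word C -> rat :=
  fun w => if size w == r then fglift (phi : _ -> rat^o) (G w) else 0.

(** The bound by K on the entries of the source shape makes the extension to families a finite sum
    and keeps transposes bounded. *)
Record isop (r r' : nat) (e : int) (K : nat) (G : word C -> {freeg (word C) / rat}) : Prop := IsOp {
  op_typed : forall w, size w = r -> supp (fun u => [/\ size u = r', word_deg c u = word_deg c w + e &
     forall n, n \in shape w -> (n < K + sumn (shape u))%N]) (G w);
  op_good : forall phi, good r' phi -> good r (pull r G phi) }.

Lemma size_shape w : size (shape w) = size w. Proof. exact: size_map. Qed.

Lemma extK_supported K r r' e G f : isop r r' e K G -> supported r f -> supported r' (extK K r G f).
Proof.
move=> oG sf ns; apply: supp_sum => t _; apply: supp_fglift; apply: supp_fglift => w wf u uG.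
rewrite /keep; case: ifP => [/andP[/eqP sh n0]|_]; last exact: supp0.
have [sr _ ew] := sf _ _ wf.
apply: suppU; split=> //; have sw : size w = r by rewrite -size_shape ew.
by have [<- _ _] := op_typed oG sw uG; rewrite -sh size_shape.
Qed.

Lemma extK_chain K r r' e G f k k' : isop r r' e K G -> k' = k + e -> is_chain c r k f ->
  is_chain c r' k' (extK K r G f).
Proof.
move=> oG -> cf ns; apply: supp_sum => t _; apply: supp_fglift; apply: supp_fglift => w wf u uG.
rewrite /keep; case: ifP => [/andP[/eqP sh n0]|_]; last exact: supp0.
have [sr _ ew dw] := cf _ _ wf.
apply: suppU; have sw : size w = r by rewrite -size_shape ew.
have [su du _] := op_typed oG sw uG; split=> //; last by rewrite du dw.
by rewrite -sh size_shape.
Qed.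

Lemma extK_linear K r G : linear (extK K r G).
Proof.
move=> a f g; apply/funext => ns.
rewrite -[RHS]/(a *: extK K r G f ns + extK K r G g ns).
rewrite /extK scaler_sumr -big_split /=; apply: eq_bigr => t _.
by rewrite -[(a *: f + g) _]/(a *: f _ + g _) !linearP.
Qed.

(** [extK] and [pull] are adjoint: both pairings are one finite sum over source and target shapes,
    taken in the two orders. *)
Lemma pair_ext K r r' e G f phi : isop r r' e K G -> supported r f -> good r' phi ->
  pair r' phi (extK K r G f) = pair r (pull r G phi) f.
Proof.
move=> oG sf gphi; have [nf sz [N bN]] := gphi.
have [_ _ [N' bN']] := op_good oG gphi.
(* Target shapes have r' entries at most N, hence sum at most r' * N, so the words reaching them
   have bracket lengths below K + r' * N. *)
pose M := maxn N' (K + r' * N)%N.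
rewrite (pairE (extK_supported oG sf) bN).
have bM : bounded (pull r G phi) M.
  by move=> w h; apply: bN'; apply: leq_ltn_trans h; apply: leq_maxl.
rewrite (pairE sf bM) /pairN.
pose phin ns (w : word C) := if (shape w == ns) && (0%N \notin ns) then phi w else 0.
have phinE ns v : fglift (phi : _ -> rat^o) (fglift (@keep m C ns) v) = fglift (phin ns : _ -> rat^o) v.
  rewrite fglift_comp; apply: fglift_eq => w _; rewrite /keep /phin.
  by case: ifP => _; rewrite ?fglift1 ?raddf0.
transitivity (\sum_(ns <- Lr r' N.+1) \sum_(t <- Lr r M.+1)
   fglift ((fun w => fglift (phin ns : _ -> rat^o) (G w)) : _ -> rat^o) (f t)).
  apply: eq_big_seq => ns; rewrite mem_Lr => /andP[/eqP sns al].
  rewrite raddf_sum /=.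
  rewrite (big_Lr _ _ (fun t => fglift (phi : _ -> rat^o) (fglift (@keep m C ns) (fglift G (f t)) : {freeg (word C) / rat}))) .
  have sl : (sumn ns <= r' * N)%N.
    rewrite -sns; elim: ns al {sns} => //= n ns IH /andP[nN /IH]; rewrite mulSn ltnS in nN *.
    by apply: leq_add.
  rewrite -(@sum_Lr_ge _ _ _ M.+1).
  - by apply: eq_bigr => t _; rewrite phinE fglift_comp.
  - by apply: leqW; apply: leq_trans (leq_maxr _ _); rewrite leq_add2l.
  - move=> t st /allPn[n nt nK]; rewrite phinE fglift_comp; apply: fglift_eq0 => w wf.
    apply: fglift_eq0 => u uG; rewrite /phin; case: eqP => //= sh; case: ifP => // n0.
    have [_ _ ew] := sf _ _ wf; have sw : size w = r by rewrite -size_shape ew.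
    have [_ _ /(_ n)] := op_typed oG sw uG.
    by rewrite ew nt => /(_ isT); rewrite sh (negPf nK).
rewrite exchange_big /=; apply: eq_big_seq => t _.
rewrite fglift_sumf; apply: fglift_eq => w wf.
have [_ _ ew] := sf _ _ wf.
rewrite fglift_sumf /pull -(size_shape w) ew.
case: (eqVneq (size t) r) => [st|/eqP ne]; last first.
  by case: ne; case: (sf _ _ wf).
apply: fglift_eq => u uG.
have [su _ _] := op_typed oG (etrans (esym (size_shape w)) (etrans (congr1 size ew) st)) uG.
(* [keep] drops the words with an empty bracket, and there [phi] vanishes. *)
case: (boolP (0%N \in shape u)) => [u0|u0].
  have -> : phi u = 0.
    case/mapP: u0 => -[a [|//]] /path.splitP h _ //=.
    by case: h => p q; rewrite cat_rcons; case: nf.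
  by rewrite big1 // => ns _; rewrite /phin; case: eqP => //= <-; rewrite u0.
case: (boolP (shape u \in Lr r' N.+1)) => uL.
  rewrite (bigD1_seq (shape u)) ?Lr_uniq //= /phin eqxx u0 /= big1 ?addr0 // => ns.
  by rewrite eq_sym => /negPf->.
rewrite bN ?big1_seq // => [ns /andP[_ nsL]|].
  by rewrite /phin; case: eqP => //= esh; rewrite esh nsL in uL.
move: uL; rewrite mem_Lr size_shape su eqxx /= => /allPn[n nu]; rewrite -leqNgt => nN.
exact: leq_trans nN (sumn_mem nu).
Qed.

(** A reduced form cut off at one shape without zero entries is bounded and vanishes on empty
    brackets, so it is good; this isolates each component of the family. *)
Lemma nullP1 r f : supported r f -> (forall phi, good r phi -> pair r phi f = 0) -> null_family f.
Proof.
move=> sf h ns phi rphi.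
pose phi1 (w : word C) := if (shape w == ns) && (size ns == r) && (0%N \notin ns) then phi w else 0.
have bn : bounded phi1 (sumn ns) by move=> w; rewrite /phi1; case: eqP => //= ->; rewrite ltnn.
have gphi : good r phi1.
  split; last by exists (sumn ns).
    split=> [u v|u a v].
      have /reduced_formP/(_ u v) [b1 b2] := rphi.
      split=> [s|a].
        move=> k x y z; rewrite /phi1 /shape !map_cat /=.
        by case: ifP => _; [exact: b1 | rewrite mulr0 addr0].
      have [b3 b4] := b2 a; split=> s t.
        move=> k x y z; rewrite /phi1 /shape !map_cat /= !size_cat /=.
        by case: ifP => _; [exact: b3 | rewrite mulr0 addr0].
      by rewrite /phi1 b4 if_same.
    rewrite /phi1; case: eqP => //= e; case: eqP => //= _; case: ifP => //.
    by rewrite -e /shape map_cat mem_cat /= inE eqxx orbT.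
  move=> w sw; rewrite /phi1; case: eqP => //= e; case: eqP => //= sr.
  by case: sw; rewrite -size_shape e.
transitivity (fglift (phi1 : _ -> rat^o) (f ns)).
  apply: fglift_eq => w wf; have [sr n0 ew] := sf _ _ wf.
  by rewrite /phi1 ew eqxx sr eqxx n0.
rewrite -(h _ gphi) (pairE sf bn) /pairN.
have z t : t != ns -> fglift (phi1 : _ -> rat^o) (f t) = 0.
  move=> tn; apply: fglift_eq0 => w wf; have [_ _ ew] := sf _ _ wf.
  by rewrite /phi1 ew (negPf tn).
case: (boolP (ns \in Lr r (sumn ns).+1)) => nL.
  by rewrite (bigD1_seq ns) ?Lr_uniq //= big1 ?addr0 //; exact: z.
have -> : \sum_(t <- Lr r (sumn ns).+1) fglift (phi1 : _ -> rat^o) (f t) = 0.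
  by apply: big1_seq => t /andP[_ tL]; apply: z; apply: contraNneq nL => etn; rewrite -{1}etn.
apply: fglift_eq0 => w wf; have [sr n0 ew] := sf _ _ wf.
by move: nL; rewrite mem_Lr sr eqxx /= => /allPn[n /sumn_mem nn]; rewrite ltnS nn.
Qed.

Lemma nullP2 r f phi : supported r f -> good r phi -> null_family f -> pair r phi f = 0.
Proof.
move=> sf [nf _ _] nl; rewrite /pair /pairN big1 // => ns _.
by apply: nl; apply/reduced_formP; case: nf.
Qed.

Lemma pairDr r phi f g : pair r phi (f + g) = pair r phi f + pair r phi g.
Proof. by rewrite /pair /pairN -big_split; apply: eq_bigr => ns _; rewrite /= raddfD. Qed.
Lemma pairZr r phi a f : pair r phi (a *: f) = a * pair r phi f.
Proof. by rewrite /pair /pairN mulr_sumr; apply: eq_bigr => ns _; rewrite /= linearZ. Qed.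
Lemma pairNr r phi f : pair r phi (- f) = - pair r phi f.
Proof. by rewrite -scaleN1r pairZr mulN1r. Qed.
Lemma pairBr r phi f g : pair r phi (f - g) = pair r phi f - pair r phi g.
Proof. by rewrite pairDr pairNr. Qed.

Lemma pairDl r phi psi f : supported r f -> good r phi -> good r psi ->
  pair r (fun w => phi w + psi w) f = pair r phi f + pair r psi f.
Proof.
move=> sf [_ _ [N bN]] [_ _ [M bM]].
have b1 : bounded phi (maxn N M) by move=> w h; apply: bN; apply: leq_ltn_trans h; apply: leq_maxl.
have b2 : bounded psi (maxn N M) by move=> w h; apply: bM; apply: leq_ltn_trans h; apply: leq_maxr.
rewrite (pairE sf b1) (pairE sf b2) (pairE (N := maxn N M) sf) => [|w h]; last by rewrite b1 ?b2 ?addr0.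
rewrite /pairN -big_split; apply: eq_bigr => ns _ /=; rewrite !fgliftE -big_split.
by apply: eq_bigr => w _; rewrite mulrDr.
Qed.
Lemma pairZl r a phi f : supported r f -> good r phi ->
  pair r (fun w => a * phi w) f = a * pair r phi f.
Proof.
move=> sf [_ _ [N b1]].
rewrite (pairE sf b1) (pairE (N := N) sf) => [|w h]; last by rewrite b1 ?mulr0.
rewrite /pairN mulr_sumr; apply: eq_bigr => ns _ /=; rewrite !fgliftE mulr_sumr.
by apply: eq_bigr => w _; rewrite mulrCA.
Qed.

Lemma goodD r phi psi : good r phi -> good r psi -> good r (fun w => phi w + psi w).
Proof.
move=> [[n1 n2] s1 [N1 b1]] [[n3 n4] s2 [N2 b2]]; split.
- split=> [u v|u a v]; last by rewrite n2 n4 addr0.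
  have [p1 p2] := n1 u v; have [p3 p4] := n3 u v.
  by split=> *; [apply: lin1D | apply: brformD].
- by move=> w sw; rewrite s1 ?s2 ?addr0.
- exists (maxn N1 N2) => w h; rewrite b1 ?b2 ?addr0 //; apply: leq_ltn_trans h; rewrite ?leq_maxl ?leq_maxr //.
Qed.
Lemma goodZ r a phi : good r phi -> good r (fun w => a * phi w).
Proof.
move=> [[n1 n2] s1 [N1 b1]]; split.
- by split=> [u v|u x v]; [apply: bformZ | rewrite n2 mulr0].
- by move=> w sw; rewrite s1 ?mulr0.
- by exists N1 => w h; rewrite b1 ?mulr0.
Qed.
End Pairing.

(** * Operations on words and their transposes *)

Section BlockForms.
Variables (m : int) (C : dgOpenFrobenius m).
Local Notation c := (1 - m).
Implicit Types (g : block C -> rat) (psi : word C -> rat) (B : block C).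

Lemma bform_bd g : bform g -> bform (bd g).
Proof.
move=> bg; have [g1 g2] := bg; split=> [s|a]; rewrite /bd.
  apply: lin1D; first apply: lin1D.
  - exact: (lin1_dif (g1 s)).
  - by apply: lin1_sgn => //; apply: lin1_Dl.
  - apply: cosum_lin; split=> x.
      by apply: lin1_sgn => //; apply: lin1B => //; apply: lin1_Zl.
    apply: lin1_Zl; apply: lin1B; first exact: (brform_lin_cons s (g2 x)).
    by apply: lin1_sgn => //; exact: (brform_lin_rcons s (g2 x)).
apply: brformD; first apply: brformD.
- exact: g2.
- by apply: brform_Zl; apply: brform_Dl.
- apply: brform_cosum => p q; apply: brform_Zl; apply: brformB; first exact: (brform_cons q (g2 p)).
  by apply: brform_sgn; [move=> *; rewrite !bdegE | exact: (brform_rcons q (g2 p))].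
Qed.

Definition null0 (g : block C -> rat) := forall a, g (a, [::]) = 0.
(** What makes an operation descend to the reduced complex, expressed on its transpose. *)
Definition nfd (Xd : (word C -> rat) -> block C -> rat) :=
  forall psi, nform psi -> bform (Xd psi) /\ null0 (Xd psi).

(** On an empty bracket, inserting a letter on the left or on the right gives the same block, and
    the two terms cancel. *)
Lemma nfd_bd : nfd (fun psi => bd (fun B => psi [:: B])).
Proof.
move=> psi nf; split=> [|a]; first by apply: bform_bd; apply: nf_b1.
rewrite bdE Dl_nil mulr0 addr0 /= nf_01 // add0r /cosum big1 // => p _.
by rewrite bdeg_nil mulr0 mul1r subrr mulr0.
Qed.

Lemma nfd_hd : nfd (@hd m C).
Proof.
move=> psi nf; split=> [|a]; last by rewrite hdE.
split=> [s|a0]; last first.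
  rewrite (_ : (fun s => _) = (fun s => exr s (h3 psi a0))); last by apply/funext => s; rewrite hdE.
  by apply: brform_exr; apply: triform_h3.
rewrite (_ : (fun a => _) = (fun a => exr s (h3 psi a))); last by apply/funext => a; rewrite hdE.
by apply: lin1_exr => l a r; apply: lin1_h3.
Qed.

Lemma nfd_Bd : nfd (@Bd m C).
Proof.
move=> psi nf; split=> [|a]; last by rewrite /Bd mulr0.
split=> [s|a0]; first by apply: lin1_mulr; apply: lin1_eps.
by apply: brform_Zl; apply: brform_exr; apply: triform_W3.
Qed.

Lemma nfd_Gd : nfd (@Gd m C).
Proof.
move=> psi nf; split=> [|a]; last by rewrite /Gd mulr0.
split=> [s|a0]; first by apply: lin1_mulr; apply: lin1_eps.
by apply: brform_Zl; apply: brform_exr; apply: triform_Z3.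
Qed.

Lemma nfd_kd : nfd (@kd m C c).
Proof.
move=> psi nf; split=> [|a]; last by rewrite kdE.
split=> [s|a0]; last first.
  rewrite (_ : (fun s => _) = (fun s => exr s (cut1 (fk psi a0)))); last by apply/funext => s; rewrite kdE.
  by apply: brform_exr; apply: triform_cut1; apply: cutform_fk.
rewrite (_ : (fun a => _) = (fun a => exr s (cut1 (fk psi a)))); last by apply/funext => a; rewrite kdE.
apply: lin1_exr => l a r; apply: lin1_exr => w b t; apply: lin1_Zl; exact: lin1_fk.
Qed.

Lemma nfd_veed : nfd (@veed m C c).
Proof.
move=> psi nf; split=> [|a]; last by rewrite /veed.
split=> [s|a0]; last by apply: brform_exr; apply: triform_vee3.
apply: lin1_exr => l a r.
apply: (lin1_deg (f := fun d a0 => cosum (hmul a0 a) (fun p q =>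
    sgn (d + (1 + deg a + deg q) * bdeg l + c * (deg p + bdeg l)) * psi [:: (p, l); (q, r)]))) => d.
apply: (lin1_mull (f := fun x => cosum x _)); apply: cosum_lin.
by split=> ?; lin.
Qed.
End BlockForms.

Ltac wdeg := rewrite /block_deg ?word_deg_cons ?word_deg_nil /block_deg /= ?bdegE ?degE.

(** * Operations on a single block *)

Section BlockOps.
Variables (m : int) (C : dgOpenFrobenius m).
Local Notation c := (1 - m).
Local Notation fg := {freeg (word C) / rat}.
Implicit Types (psi : word C -> rat) (B : block C) (s l r : seq (helt C)) (X : block C -> fg).

(** K exceeds the number of letters lost from the bracket by at least one; K = 2 is the range used
    by [extend]. *)
Definition typed q e K X := forall B, supp (fun u =>
  [/\ size u = q, word_deg c u = block_deg B - c + e & (size B.2 < K + sumn (shape u))%N]) (X B).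

Record blkop q e K X (Xd : (word C -> rat) -> block C -> rat) : Prop := BlkOp {
  bk_typed : typed q e K X;
  bk_dual : forall psi B, nform psi -> fglift (psi : _ -> rat^o) (X B) = Xd psi B;
  bk_nf : nfd Xd }.

Definition exg s (F : seq (helt C) -> helt C -> seq (helt C) -> fg) : fg :=
  \sum_(i < size s) F (take i s) (hred (nth (hone C) s i)) (drop i.+1 s).

Lemma fglift_exg psi s F : fglift (psi : _ -> rat^o) (exg s F) =
  exr s (fun l a r => fglift (psi : _ -> rat^o) (F l a r)).
Proof. by rewrite /exg raddf_sum /= (ex_ord (hone C) s (fun l a r => fglift (psi : _ -> rat^o) (F l (hred a) r))). Qed.

Lemma fglift_ord psi s F :
  fglift (psi : _ -> rat^o) (\sum_(i < size s) F (take i s) (nth (hone C) s i) (drop i.+1 s)) =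
  ex s (fun l a r => fglift (psi : _ -> rat^o) (F l a r)).
Proof. by rewrite raddf_sum /= (ex_ord (hone C) s (fun l a r => fglift (psi : _ -> rat^o) (F l a r))). Qed.

Lemma fglift_cop psi x (F : helt C -> helt C -> fg) :
  fglift (psi : _ -> rat^o) (\sum_(p <- hcop x) F p.1 p.2) =
  cosum x (fun p q => fglift (psi : _ -> rat^o) (F p q)).
Proof. by rewrite raddf_sum. Qed.

Lemma fgliftZ1 psi a (w : word C) : fglift (psi : _ -> rat^o) (a *: << w >>) = a * psi w.
Proof. by rewrite linearZ /= fglift1. Qed.

Lemma split_ord s (i : 'I_(size s)) (x0 : helt C) :
  s = take i s ++ nth x0 s i :: drop i.+1 s.
Proof. by rewrite -drop_nth // cat_take_drop. Qed.

Lemma supp_ord P s (F : seq (helt C) -> helt C -> seq (helt C) -> fg) :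
  (forall l a r, bdeg s = bdeg l + (deg a - 1) + bdeg r -> size s = (size l + size r).+1 ->
     supp P (F l a r)) -> supp P (\sum_(i < size s) F (take i s) (nth (hone C) s i) (drop i.+1 s)).
Proof.
move=> h; apply: supp_sum => i _; apply: h.
  by rewrite {1}(split_ord i (hone C)) !bdegE addrA.
by rewrite {1}(split_ord i (hone C)) size_cat /= addnS.
Qed.

Lemma supp_exg P s F : (forall l a r, bdeg s = bdeg l + (deg a - 1) + bdeg r ->
   size s = (size l + size r).+1 -> supp P (F l a r)) -> supp P (exg s F).
Proof.
by move=> h; apply: (supp_ord (F := fun l a r => F l (hred a) r)) => l a r d z; apply: h.
Qed.

Lemma supp_heps P (x : helt C) (u : fg) : (deg x = 0 -> supp P u) -> supp P (heps x *: u).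
Proof.
move=> h; have [/eqP/h Pu|/heps_deg->] := boolP (deg x == 0); first exact: suppZ.
by rewrite scale0r; apply: supp0.
Qed.

Lemma supp_cop P (x : helt C) (F : helt C -> helt C -> fg) :
  (forall p q, deg p + deg q = deg x -> supp P (F p q)) -> supp P (\sum_(p <- hcop x) F p.1 p.2).
Proof. by move=> h; apply: supp_sum_seq => p /cop_deg; apply: h. Qed.


Lemma blkop_b : blkop 1 (-1) 2 (@b_block m C) (fun psi => bd (fun B => psi [:: B])).
Proof.
split; last exact: nfd_bd.
- case=> a0 s; rewrite /b_block; apply: suppD; first apply: suppD; first apply: suppB.
  + by apply: suppU; split=> //=; [wdeg; ring | lia].
  + apply: (supp_ord (F := fun l a r => sgn (deg a0 + bdeg l) *: blk a0 (l ++ hdif a :: r))) => l a r d z.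
    apply: suppZ; apply: suppU; split=> //=; first by wdeg; rewrite d; ring.
    by rewrite size_cat /= z; lia.
  + apply: (supp_ord (F := fun l a r => \sum_(p <- hcop a) sgn (deg a0 + bdeg (rcons l p.1)) *:
      blk a0 (l ++ p.1 :: p.2 :: r))) => l a r d z.
    apply: (supp_cop (F := fun p q => sgn (deg a0 + bdeg (rcons l p)) *: blk a0 (l ++ p :: q :: r))) => p q pq.
    apply: suppZ; apply: suppU; split=> //=; first by wdeg; rewrite d -pq; ring.
    by rewrite size_cat /= z; lia.
  apply: (supp_cop (F := fun p q => sgn (deg p) *: (blk p (q :: s) - sgn ((deg q - 1) * bdeg s) *: blk p (rcons s q)))) => p q pq.
  apply: suppZ; apply: suppB; last apply: suppZ.
    by apply: suppU; split=> //=; [wdeg; rewrite -pq; ring | lia].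
  by apply: suppU; split=> //=; [wdeg; rewrite -pq; ring | rewrite size_rcons; lia].
move=> psi [a0 s] _; rewrite /b_block bdE !raddfD /= raddfN /= fglift1.
rewrite (fglift_ord psi s (fun l a r => sgn (deg a0 + bdeg l) *: blk a0 (l ++ hdif a :: r))).
rewrite (fglift_ord psi s (fun l a r => \sum_(p <- hcop a) sgn (deg a0 + bdeg (rcons l p.1)) *:
      blk a0 (l ++ p.1 :: p.2 :: r))).
rewrite (fglift_cop psi a0 (fun p q => sgn (deg p) *: (blk p (q :: s) - sgn ((deg q - 1) * bdeg s) *: blk p (rcons s q)))).
congr (_ + _); last first.
  by apply: cosum_eq => p q _; rewrite linearZ /= raddfB /= fglift1 fgliftZ1.
rewrite -addrA; congr (_ + _); rewrite /Dl -exZ addrC -exB; apply: ex_eq => l a r _.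
rewrite fgliftZ1 (fglift_cop psi a (fun p q => sgn (deg a0 + bdeg (rcons l p)) *: blk a0 (l ++ p :: q :: r))).
rewrite mulrDr mulrN mulrA -sgnD addrC cosumZ'; congr (_ + _).
by apply: cosum_eq => p q _; rewrite fgliftZ1 mulrA -sgnD bdeg_rcons; congr (sgn _ * _); ring.
Qed.
End BlockOps.

Section BlockOps2.
Variables (m : int) (C : dgOpenFrobenius m).
Local Notation c := (1 - m).
Local Notation fg := {freeg (word C) / rat}.
Implicit Types (psi : word C -> rat) (B : block C) (s l r : seq (helt C)).


Lemma B_blockE a0 s : B_block (a0, s) = heps a0 *: exg s (fun l a r =>
  sgn ((deg a - 1 + bdeg r) * bdeg l) *: blk a (r ++ l)).
Proof.
rewrite /exg scaler_sumr; apply: eq_bigr => i _; rewrite scalerA mulrC.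
by rewrite (drop_nth (hone C)) // bdeg_cons.
Qed.

Lemma blkop_B : blkop 1 1 2 (@B_block m C) (@Bd m C).
Proof.
split; last exact: nfd_Bd.
  case=> a0 s; rewrite B_blockE; apply: supp_heps => d0.
  apply: supp_exg => l a r d z; apply: suppZ; apply: suppU; split=> //=.
    by wdeg; rewrite d d0; ring.
  by rewrite z size_cat; lia.
move=> psi [a0 s] _; rewrite B_blockE linearZ /= fglift_exg; congr (_ * _).
by apply: exr_eq => l a r _ _; rewrite fgliftZ1.
Qed.

(** [vee_block] leaves out the first and the last letter while [veed] runs over all of them; the two
    extra terms have an empty bracket. *)
Lemma veeS_fglift psi B : nform psi -> fglift (psi : _ -> rat^o) (veeS_block c B) = veed c psi B.
Proof.
move=> nf; case: B => a0 s; rewrite /veeS_block fglift_comp.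
pose psi' (w : word C) := fglift (psi : _ -> rat^o) (shift2 c w).
pose F l a r : fg := \sum_(p <- hcop (hmul a0 (hred a)))
    sgn (deg a0 + (1 + deg a + deg p.2) * bdeg l) *: << [:: (p.1, l); (p.2, r)] >>.
have eF l a r : fglift (psi' : _ -> rat^o) (F l a r) = vee3 psi a0 l (hred a) r.
  rewrite (fglift_cop psi' _ (fun p q => sgn (deg a0 + (1 + deg a + deg q) * bdeg l) *: << [:: (p, l); (q, r)] >>)).
  apply: cosum_eq => p q _; rewrite fgliftZ1 /psi' /= fgliftZ1 mulrA -sgnD.
  by congr (sgn _ * _); rewrite /block_deg /= degE; ring.
have -> : veed c psi (a0, s) = \sum_(i < size s) fglift (psi' : _ -> rat^o) (F (take i s) (nth (hone C) s i) (drop i.+1 s)).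
  by rewrite (ex_ord (hone C) s (fun l a r => fglift (psi' : _ -> rat^o) (F l a r))); apply: ex_eq => l a r _; rewrite eF.
rewrite /vee_block raddf_sum /=.
rewrite -(big_mkord xpredT (fun i => fglift (psi' : _ -> rat^o) (F (take i s) (nth (hone C) s i) (drop i.+1 s)))).
have F0 : fglift (psi' : _ -> rat^o) (F (take 0 s) (nth (hone C) s 0) (drop 1 s)) = 0.
  by rewrite eF take0 vee3_0l.
case es: (size s) => [|[|n]]; first by rewrite !big_geq.
  by rewrite big_geq // big_nat1 F0.
rewrite [RHS]big_nat_recr // [X in _ = _ + X](_ : _ = 0); last first.
  by rewrite eF (_ : drop n.+2 s = [::]) ?(vee3_0r nf) //; apply: drop_oversize; rewrite es.
by rewrite addr0 [RHS]big_ltn // F0; apply/esym/add0r.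
Qed.

Lemma blkop_V : blkop 2 0 2 (@veeS_block m C c) (@veed m C c).
Proof.
split; [|by move=> psi B; apply: veeS_fglift | exact: nfd_veed].
case=> a0 s; rewrite /veeS_block; apply: supp_fglift; rewrite /vee_block big_nat_cond.
apply: supp_sum => i /andP[/andP[i0 i1] _].
have si : (i < size s)%N by lia.
apply: (supp_cop (F := fun p q => sgn (deg a0 + (1 + deg (nth (hone C) s i) + deg q) * bdeg (take i s)) *:
   << [:: (p, take i s); (q, drop i.+1 s)] >>)) => p q pq.
apply: suppZ; apply: suppU => /=; apply: suppZ; apply: suppU; split=> //=.
  have es : bdeg s = bdeg (take i s) + (deg (nth (hone C) s i) - 1 + bdeg (drop i.+1 s)).
    by rewrite -[in LHS](cat_take_drop i s) (drop_nth (hone C) si) !bdegE.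
  by wdeg; rewrite es; move: pq; rewrite !degE; lia.
by rewrite size_take size_drop si; lia.
Qed.

Definition cutg s (F : seq (helt C) -> block C -> seq (helt C) -> fg) : fg :=
  exg s (fun l a t => exg t (fun w b r => sgn (kap l a w b r) *: F l (hmul a b, w) r)).

Lemma fglift_cutg psi s F :
  fglift (psi : _ -> rat^o) (cutg s F) = cut (fun l B r => fglift (psi : _ -> rat^o) (F l B r)) s.
Proof.
rewrite fglift_exg; apply: exr_eq => l a t _ _; rewrite fglift_exg.
by apply: exr_eq => w b r _ _; rewrite linearZ.
Qed.

Lemma supp_cutg P s F : (forall l B r, bdeg s = bdeg l + block_deg B + m - 2 + bdeg r ->
   size s = (size l + size B.2 + size r).+2 -> supp P (F l B r)) -> supp P (cutg s F).
Proof.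
move=> h; apply: supp_exg => l a t d z; apply: supp_exg => w b r d' z'.
apply: suppZ; apply: h; rewrite ?d ?d' ?z ?z' /block_deg /= ?degE; [ring | lia].
Qed.

(** The homotopies are needed as operations on chains and not only as transposes, because a boundary
    must be witnessed by a family. *)
Definition h_block B : fg :=
  sgn (deg B.1 + m + 1) *: cutg B.2 (fun l X r => << [:: (B.1, l ++ r); X] >>).
Definition G_block B : fg :=
  heps B.1 *: exg B.2 (fun k a t => cutg t (fun l X r =>
    sgn (bdeg k * (deg a - 1 + bdeg l + bdeg r) + deg a + bdeg k + m + 1) *:
    << [:: (a, l ++ r ++ k); X] >>)).
Definition k_block B : fg :=
  cutg B.2 (fun l X r' => cutg r' (fun r Y t =>
    sgn (bdeg l + (block_deg X - c) * (block_deg Y - c)) *: << [:: (B.1, l ++ r ++ t); X; Y] >>)).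

Lemma blkop_h : blkop 2 1 3 h_block (@hd m C).
Proof.
split; last exact: nfd_hd.
  move=> B; apply: suppZ; apply: supp_cutg => l X r d z; apply: suppU; split=> //=.
    by rewrite ?word_deg_cons ?word_deg_nil /block_deg /= d bdeg_cat; rewrite -/(block_deg X); ring.
  by rewrite z size_cat; lia.
move=> psi [a0 s] _; rewrite /h_block linearZ /= fglift_cutg; congr (_ * _).
by congr (cut _ _); do 3!apply/funext => ?; rewrite fglift1.
Qed.

Lemma blkop_G : blkop 2 2 4 G_block (@Gd m C).
Proof.
split; last exact: nfd_Gd.
  move=> B; apply: supp_heps => d0; apply: supp_exg => k a t dt zt.
  apply: supp_cutg => l X r d z; apply: suppZ; apply: suppU; split=> //=.
    by rewrite ?word_deg_cons ?word_deg_nil {1 3}/block_deg /= dt d d0 !bdeg_cat; ring.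
  by rewrite zt z !size_cat; lia.
move=> psi [a0 s] _; rewrite /G_block linearZ /= fglift_exg; congr (_ * _).
apply: exr_eq => k a t _ _; rewrite fglift_cutg.
by congr (cut _ _); do 3!apply/funext => ?; rewrite fgliftZ1.
Qed.

Lemma blkop_k : blkop 3 2 5 k_block (@kd m C c).
Proof.
split; last exact: nfd_kd.
  move=> B; apply: supp_cutg => l X r' d z; apply: supp_cutg => r Y t d' z'.
  apply: suppZ; apply: suppU; split=> //=.
    by rewrite ?word_deg_cons ?word_deg_nil {1 4}/block_deg /= d d' !bdeg_cat; ring.
  by rewrite z z' !size_cat; lia.
move=> psi [a0 s] _; rewrite /k_block fglift_cutg.
congr (cut _ _); do 3!apply/funext => ?; rewrite fglift_cutg.
by congr (cut _ _); do 3!apply/funext => ?; rewrite fgliftZ1.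
Qed.
End BlockOps2.

(** * Operations on one tensor factor *)

Section SlotOps.
Variables (m : int) (C : dgOpenFrobenius m).
Local Notation c := (1 - m).
Local Notation fg := {freeg (word C) / rat}.
Implicit Types (phi psi : word C -> rat) (B : block C) (X : block C -> fg) (w u v : word C).

Definition pullb X psi B : rat := fglift (psi : _ -> rat^o) (X B).

Lemma slotdE e i X phi w :
  fglift (phi : _ -> rat^o) (at_slot c e i X w) = slotd c e i (pullb X) phi w.
Proof.
rewrite /at_slot /slotd; case: (drop i w) => [|B v]; first by rewrite raddf0.
rewrite linearZ /= fglift_comp; congr (_ * fglift _ _).
by apply/funext => t; rewrite fglift1.
Qed.

Lemma slotdS e i Xd phi B w : slotd c e i.+1 Xd phi (B :: w) =
  sgn (e * (block_deg B - c)) * slotd c e i Xd (fun w' => phi (B :: w')) w.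
Proof.
rewrite /slotd /=; case: (drop i w) => [|B' v]; first by rewrite mulr0.
by rewrite word_deg_cons mulrDr sgnD mulrA.
Qed.

Lemma bform_fglift (F : block C -> word C -> rat) (u : fg) :
  (forall t, bform (F^~ t)) -> bform (fun B => fglift (F B : _ -> rat^o) u).
Proof.
move=> bF; rewrite (_ : (fun B => _) = (fun B => \sum_(t <- dom u) coeff t u * F B t)); last first.
  by apply/funext => B; rewrite fgliftE.
split=> [s|a].
  by apply: lin1_sum => t; apply: lin1_Zl; case: (bF t) => /(_ s).
by apply: brform_sum => t; apply: brform_Zl; case: (bF t) => _ /(_ a).
Qed.

Lemma nform_cons phi B : nform phi -> nform (fun w => phi (B :: w)).
Proof. by move=> [n1 n2]; split=> [u v|u a v]; [apply: (n1 (B :: u)) | apply: (n2 (B :: u))]. Qed.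
Lemma nform_catr phi v : nform phi -> nform (fun w => phi (w ++ v)).
Proof.
move=> [n1 n2]; split=> [u v'|u a v']; last by rewrite -catA /= n2.
rewrite (_ : (fun B => _) = (fun B => phi (u ++ B :: (v' ++ v)))) //.
by apply/funext => B; rewrite -catA.
Qed.

(** The varied factor is either the input of X, where [nfd] applies, or a factor that X leaves alone
    and [phi] sees directly. *)
Lemma nform_slot e i X phi : nfd (pullb X) -> nform phi -> nform (slotd c e i (pullb X) phi).
Proof.
move=> nX; elim: i phi => [|i IH] phi nf.
  split=> [[|B0 u] v|[|B0 u] a v].
  - rewrite (_ : (fun B => _) = (pullb X (fun t => phi (t ++ v)))); last by apply/funext => B; rewrite slotd0.
    by case: (nX (fun t => phi (t ++ v))) => //; apply: nform_catr.
  - rewrite (_ : (fun B => _) = (fun B => fglift ((fun t => phi (t ++ u ++ B :: v)) : _ -> rat^o) (X B0))); last first.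
      by apply/funext => B; rewrite slotd0.
    apply: bform_fglift => t; rewrite (_ : (fun B => _) = (fun B => phi ((t ++ u) ++ B :: v))); first by case: nf.
    by apply/funext => B; rewrite catA.
  - by rewrite /= slotd0; case: (nX (fun t => phi (t ++ v))) => //; apply: nform_catr.
  - rewrite /= slotd0; apply: fglift_eq0 => t _; rewrite catA; exact: nf.2.
split=> [[|B0 u] v|[|B0 u] a v].
- rewrite (_ : (fun B => _) = (fun B => sgn (e * (block_deg B - c)) *
     fglift ((fun w' => phi (B :: w')) : _ -> rat^o) (at_slot c e i X v))); last first.
    by apply/funext => B; rewrite slotdS slotdE.
  by apply: (bform_sgn (fun d => e * (d - c))); apply: bform_fglift => t; apply: nf_b1.
- rewrite (_ : (fun B => _) = (fun B => sgn (e * (block_deg B0 - c)) *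
     slotd c e i (pullb X) (fun w' => phi (B0 :: w')) (u ++ B :: v))); last first.
    by apply/funext => B; rewrite slotdS.
  by apply: bformZ; case: (IH _ (nform_cons B0 nf)).
- by rewrite /= slotdS -slotdE fglift_eq0 ?mulr0 // => t _; apply: nf_01.
- by rewrite /= slotdS; case: (IH _ (nform_cons B0 nf)) => _ ->; rewrite mulr0.
Qed.

Lemma nform_size r phi : nform phi -> nform (fun w => if size w == r then phi w else 0).
Proof.
move=> [n1 n2]; split=> [u v|u a v]; last by rewrite n2 if_same.
rewrite (_ : (fun B => _) = (fun B => if (size u + (size v).+1 == r)%N then phi (u ++ B :: v) else 0)); last first.
  by apply/funext => B; rewrite size_cat.
by case: eqP => _; [exact: n1 | exact: bform0].
Qed.

(** Boundedness is automatic: if an output has total bracket length at most N, the r input brackets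
    have lengths at most K + N each. *)
Lemma mkop r r' e K (G : word C -> fg) :
  (forall w, size w = r -> supp (fun u => [/\ size u = r', word_deg c u = word_deg c w + e &
     forall n, n \in shape w -> (n < K + sumn (shape u))%N]) (G w)) ->
  (forall phi, good r' phi -> nform (pull r G phi)) -> isop r r' e K G.
Proof.
move=> tG nG; split=> // phi gphi; split; first exact: nG.
  by move=> w /eqP/negPf sw; rewrite /pull sw.
have [_ _ [N bN]] := gphi; exists (r * (K + N))%N => w hw; rewrite /pull.
case: eqP => // sw; apply: fglift_eq0 => u /(tG _ sw) [su _ hn].
apply: bN; rewrite ltnNge; apply/negP => hu; move: hw; rewrite ltnNge => /negP; apply.
rewrite -sw -size_shape; move: hn; move: (shape w) => ns hn.
have {}hn n : n \in ns -> (n <= K + N)%N by move=> /hn; lia.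
elim: ns hn {tG nG sw} => //= n ns IH hn; rewrite mulSn; apply: leq_add; first by apply: hn; rewrite inE eqxx.
by apply: IH => k kn; apply: hn; rewrite inE kn orbT.
Qed.

Lemma nfd_pullb q e K X Xd : blkop q e K X Xd -> nfd (pullb X).
Proof.
move=> [_ dX nX] psi nf; have -> : pullb X psi = Xd psi by apply/funext => B; apply: dX.
exact: nX.
Qed.

Lemma sumn_cat3 u t v : sumn (shape (u ++ t ++ v)) = (sumn (shape u) + (sumn (shape t) + sumn (shape v)))%N.
Proof. by rewrite /shape !map_cat !sumn_cat. Qed.

Lemma isop_slot q e K X Xd p r i : blkop q e K X Xd -> (i < r)%N -> (0 < K)%N ->
  isop r (r + q).-1 e K (at_slot c p i X).
Proof.
move=> bX ir K0; have [tX _ _] := bX; apply: mkop => [w sw|phi [nf _ _]]; last first.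
  apply: nform_size; rewrite (_ : (fun w => _) = slotd c p i (pullb X) phi); last first.
    by apply/funext => w; rewrite slotdE.
  by apply: nform_slot => //; apply: nfd_pullb bX.
rewrite /at_slot; have : (i < size w)%N by rewrite sw.
move: (cat_take_drop i w) (size_drop i w); case: (drop i w) => [|B v] ew; first by rewrite /= ; lia.
move=> /= sv iw; apply: suppZ; apply: supp_fglift => t /tX [st dt zt].
apply: suppU; split.
- by rewrite !size_cat size_take st iw; lia.
- by rewrite -{2}ew !word_deg_cat word_deg_cons dt; ring.
move=> n; rewrite sumn_cat3 -{1}ew /shape map_cat mem_cat inE.
case/or3P => [/sumn_mem|/eqP->|/(@sumn_mem (shape v))]; move: zt; rewrite /shape; lia.
Qed.
End SlotOps.

Section SlotComm.
Variables (m : int) (C : dgOpenFrobenius m).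
Local Notation c := (1 - m).
Local Notation fg := {freeg (word C) / rat}.
Implicit Types (phi psi : word C -> rat) (B : block C) (X : block C -> fg) (w u v : word C).

Lemma bdD (g h : block C -> rat) B : bd (fun B => g B + h B) B = bd g B + bd h B.
Proof.
case: B => a0 s; rewrite !bdE DlD.
rewrite (_ : cosum a0 _ = cosum a0 (fun p q => sgn (deg p) *
    (g (p, q :: s) - sgn ((deg q - 1) * bdeg s) * g (p, rcons s q))) +
  cosum a0 (fun p q => sgn (deg p) *
    (h (p, q :: s) - sgn ((deg q - 1) * bdeg s) * h (p, rcons s q)))); first by gring.
by rewrite -cosumD; apply: cosum_eq => p q _; gring.
Qed.

Lemma bd_fglift (F : block C -> word C -> rat) (u : fg) B :
  bd (fun B => fglift (F B : _ -> rat^o) u) B = fglift ((fun t => bd (F^~ t) B) : _ -> rat^o) u.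
Proof.
rewrite fgliftE (_ : (fun B => fglift (F B : _ -> rat^o) u) = (fun B => \sum_(t <- dom u) coeff t u * F B t : rat)); last first.
  by apply/funext => B'; rewrite fgliftE.
elim: (dom u) => [|t s IH].
  rewrite big_nil -[RHS](mul0r (bd (fun _ => 0) B)) -bdZ; congr bd; apply/funext => B'.
  by rewrite big_nil mul0r.
rewrite big_cons -IH -bdZ -bdD; congr bd; apply/funext => B'; by rewrite big_cons.
Qed.

Lemma bt_fglift (F : word C -> word C -> rat) (u : fg) w :
  bt c (fun w => fglift (F w : _ -> rat^o) u) w = fglift ((fun t => bt c (F^~ t) w) : _ -> rat^o) u.
Proof.
elim: w F => [|B w IH] F /=; first by rewrite fglift_eq0.
rewrite bd_fglift IH !fgliftE mulr_sumr -big_split; apply: eq_bigr => t _ /=.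
by rewrite mulrDr mulrCA.
Qed.

Lemma btD phi psi w : bt c (fun w => phi w + psi w) w = bt c phi w + bt c psi w.
Proof.
elim: w phi psi => [|B w IH] phi psi /=; first by rewrite addr0.
by rewrite bdD IH mulrDr addrACA.
Qed.
Lemma btZ k phi w : bt c (fun w => k * phi w) w = k * bt c phi w.
Proof.
elim: w phi => [|B w IH] phi /=; first by rewrite mulr0.
by rewrite bdZ IH mulrDr mulrCA.
Qed.

Lemma bt_cat phi t v : bt c phi (t ++ v) =
  bt c (fun t => phi (t ++ v)) t + sgn (word_deg c t) * bt c (fun v' => phi (t ++ v')) v.
Proof.
elim: t phi => [|B t IH] phi /=; first by rewrite word_deg_nil mul1r add0r.
by rewrite IH word_deg_cons (sgnD _ (word_deg c t)) mulrDr mulrA addrA.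
Qed.

Variables (X : block C -> fg) (e : int).
Hypothesis degX : forall B, supp (fun u => sgn (word_deg c u) = sgn (block_deg B - c + e)) (X B).

(* The transpose of the graded commutator of X with b. *)
Definition comm_b psi B : rat := bd (pullb X psi) B - sgn e * pullb X (bt c psi) B.

(** Away from the slot, X and b commute up to the Koszul sign, so only their commutator inside the
    slot remains. Degrees enter through signs alone, hence the form of the hypothesis on X. *)
Lemma slot_comm i phi w : bt c (slotd c e i (pullb X) phi) w =
  sgn e * slotd c e i (pullb X) (bt c phi) w + slotd c (e + 1) i comm_b phi w.
Proof.
elim: i phi w => [|i IH] phi [|B w]; first by rewrite /slotd /= mulr0 addr0.
  rewrite !slotd0 /= /comm_b.
  rewrite (_ : pullb X (fun t => bt c phi (t ++ w)) B = pullb X (bt c (fun t => phi (t ++ w))) B +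
     sgn (block_deg B - c + e) * bt c (slotd c e 0 (pullb X) phi \o cons B) w); last first.
    rewrite {1}/pullb (fglift_eq (g := fun t => bt c (fun t => phi (t ++ w)) t +
       sgn (block_deg B - c + e) * bt c (fun v => phi (t ++ v)) w)); last first.
      by move=> t /degX dt; rewrite bt_cat dt.
    rewrite (_ : slotd c e 0 (pullb X) phi \o cons B =
       fun v => fglift ((fun t => phi (t ++ v)) : _ -> rat^o) (X B)); last first.
      by apply/funext => v /=; rewrite slotd0.
    rewrite /pullb bt_fglift !fgliftE mulr_sumr -big_split; apply: eq_bigr => t _ /=.
    by rewrite mulrDr mulrCA.
  rewrite (_ : (fun B' => slotd c e 0 (pullb X) phi (B' :: w)) = pullb X (fun t => phi (t ++ w))); last first.
    by apply/funext => B'; rewrite slotd0.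
  rewrite /comp (sgnD _ e); move: (bt c _ w) (bd _ B) (pullb _ _ _) (sgn (_ - c)) (sgn e) (sgnMsgn e) => a b p x y yy.
  rewrite (_ : y * (p + x * y * a) = y * p + y * y * (x * a)); last by ring.
  by rewrite yy; ring.
  by rewrite /slotd /= mulr0 addr0.
have e1 : bd (fun B' => slotd c e i.+1 (pullb X) phi (B' :: w)) B =
  sgn (e * (block_deg B - 1 - c)) * slotd c e i (pullb X) (fun w' => bd (fun B' => phi (B' :: w')) B) w.
  rewrite -slotdE -bd_fglift -(bd_sgn (fun d => sgn (e * (d - c)))); congr bd.
  by apply/funext => B'; rewrite slotdS slotdE.
have e2 : bt c (fun v => slotd c e i.+1 (pullb X) phi (B :: v)) w =
   sgn (e * (block_deg B - c)) * bt c (slotd c e i (pullb X) (fun w' => phi (B :: w'))) w.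
  by rewrite -btZ; congr bt; apply/funext => v; rewrite slotdS.
have e3 : slotd c e i (pullb X) (fun w' => bt c phi (B :: w')) w =
  slotd c e i (pullb X) (fun w' => bd (fun B' => phi (B' :: w')) B) w +
  sgn (block_deg B - c) * slotd c e i (pullb X) (bt c (fun w' => phi (B :: w'))) w.
  rewrite -!slotdE !fgliftE mulr_sumr -big_split; apply: eq_bigr => t _ /=.
  by rewrite mulrDr mulrCA.
rewrite [LHS]/= e1 e2 !slotdS e3 IH.
move: (slotd _ _ _ _ _ w) (slotd _ _ _ _ _ w) (slotd _ _ _ _ _ w) => p q r.
by move: (block_deg B) => d; sgnring.
Qed.
End SlotComm.

(** * Chain operations and their action on homology *)

Section ChainOps.
Variables (m : int) (C : dgOpenFrobenius m).
Local Notation c := (1 - m).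
Local Notation fg := {freeg (word C) / rat}.
Implicit Types (phi psi : word C -> rat) (B : block C) (w u v : word C) (f g z : family C).

Lemma bt_size0 phi w : (forall v, size v = size w -> phi v = 0) -> bt c phi w = 0.
Proof.
elim: w phi => [|B w IH] phi h //=; rewrite IH => [|v sv]; last by apply: h; rewrite /= sv.
rewrite (_ : (fun B' => phi (B' :: w)) = (fun B' => 0 * phi (B' :: w))); last first.
  by apply/funext => B'; rewrite h ?mul0r.
by rewrite bdZ mul0r mulr0 addr0.
Qed.

Lemma bt_eq phi psi w : (forall v, size v = size w -> phi v = psi v) -> bt c phi w = bt c psi w.
Proof.
move=> h; have : bt c (fun v => phi v + (-1) * psi v) w = 0.
  by apply: bt_size0 => v /h->; ring.
by rewrite btD btZ mulN1r => /eqP; rewrite subr_eq0 => /eqP.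
Qed.

Definition btot r w : fg := \sum_(i < r) at_slot c 1 i (@b_block m C) w.

(** The first factor is split off on both sides; its degree supplies the sign that all later slots
    share. *)
Lemma sum_slotd_bt phi w : nform phi ->
  \sum_(i < size w) slotd c 1 i (pullb (@b_block m C)) phi w = bt c phi w.
Proof.
elim: w phi => [|B w IH] phi nf; first by rewrite big_ord0.
rewrite /= big_ord_recl slotd0 /pullb (bk_dual (blkop_b C)); last exact: nform_catr.
congr (_ + _); rewrite -IH; last exact: nform_cons.
by rewrite mulr_sumr; apply: eq_bigr => i _; rewrite slotdS mul1r.
Qed.

Lemma pull_btot r phi : good r phi -> pull r (btot r) phi = bt c phi.
Proof.
move=> [nf sz _]; apply/funext => w; rewrite /pull; case: eqP => [sw|nw].
  rewrite -sum_slotd_bt // raddf_sum /= sw; apply: eq_bigr => i _; exact: slotdE.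
by rewrite bt_size0 // => v sv; apply: sz; rewrite sv.
Qed.

Lemma good0 r : good r (fun _ : word C => 0).
Proof. by split=> //; [split=> // *; exact: bform0 | exists 0%N]. Qed.

Lemma good_eq r phi psi : phi =1 psi -> good r phi -> good r psi.
Proof. by move=> /funext->. Qed.

Lemma isop_sum r r' e K n (G : nat -> word C -> fg) :
  (forall i, (i < n)%N -> isop r r' e K (G i)) -> isop r r' e K (fun w => \sum_(i < n) G i w).
Proof.
move=> oG; split=> [w sw|phi gphi]; first by apply: supp_sum => i _; exact: (op_typed (oG i (ltn_ord i)) sw).
have : good r (fun w => \sum_(i < n) pull r (G i) phi w).
  elim: n oG => [|n IH] oG; first by apply: good_eq (good0 r) => w; rewrite big_ord0.
  apply: good_eq (goodD (IH (fun i h => oG i (ltnW h))) (op_good (oG n (ltnSn n)) gphi)) => w.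
  by rewrite big_ord_recr.
by apply: good_eq => w; rewrite /pull; case: eqP => _; rewrite ?raddf_sum // big1.
Qed.

Lemma isop_btot r : isop r r (-1) 2 (btot r).
Proof.
apply: (isop_sum (G := fun i => at_slot c 1 i (@b_block m C))) => i ir; rewrite -{2}[r]/(r.+1.-1) -addn1.
exact: (isop_slot _ (blkop_b C) ir).
Qed.

Lemma good_bt r phi : good r phi -> good r (bt c phi).
Proof. by move=> gphi; rewrite -(pull_btot gphi); exact: (op_good (isop_btot r) gphi). Qed.

Lemma b_totalE r f : b_total c r f = extK 2 r (btot r) f.
Proof. by []. Qed.

Lemma pair_btotal r phi f : supported r f -> good r phi ->
  pair r phi (b_total c r f) = pair r (bt c phi) f.
Proof. by move=> sf gphi; rewrite b_totalE (pair_ext (isop_btot r)) // pull_btot. Qed.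

Lemma btotal_supported r f : supported r f -> supported r (b_total c r f).
Proof. exact: (extK_supported (isop_btot r)). Qed.

Lemma supportedP r a f g : supported r f -> supported r g -> supported r (a *: f + g).
Proof.
move=> sf sg ns; rewrite -[(a *: f + g) ns]/(a *: f ns + g ns).
by apply: suppD; [apply: suppZ => w; apply: sf | move=> w; apply: sg].
Qed.
Lemma supportedB r f g : supported r f -> supported r g -> supported r (f - g).
Proof. by move=> sf sg; rewrite addrC -scaleN1r; apply: supportedP. Qed.

Lemma cycle_chain r k f : is_cycle c r k f -> is_chain c r k f. Proof. by case. Qed.
Lemma cycle_supp r k f : is_cycle c r k f -> supported r f.
Proof. by case=> cf _; apply: chain_supported cf. Qed.

Lemma cycle_pair r k f phi : is_cycle c r k f -> good r phi -> pair r (bt c phi) f = 0.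
Proof.
move=> zf gphi; have sf := cycle_supp zf; have [_ nf] := zf.
by rewrite -pair_btotal //; apply: nullP2 nf => //; apply: btotal_supported.
Qed.

(** Good functionals separate families up to null ones, so cycles, and below boundaries, are
    recognised by pairings in which [bt] replaces the differential. *)
Lemma cycleI r k f : is_chain c r k f -> (forall phi, good r phi -> pair r (bt c phi) f = 0) ->
  is_cycle c r k f.
Proof.
move=> cf h; have sf := chain_supported cf; split=> //; apply: (@nullP1 _ _ r).
  exact: btotal_supported.
by move=> phi gphi; rewrite pair_btotal // h.
Qed.

Lemma boundaryI r k f g : is_chain c r k f -> is_chain c r (k + 1) g ->
  (forall phi, good r phi -> pair r phi f = pair r (bt c phi) g) -> is_boundary c r k f.
Proof.
move=> cf cg h; have sf := chain_supported cf; have sg := chain_supported cg.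
split=> //; exists g => //; apply: (@nullP1 _ _ r).
  by apply: supportedB => //; apply: btotal_supported.
by move=> phi gphi; rewrite pairBr pair_btotal // h // subrr.
Qed.

Lemma boundary_pair r k f : is_boundary c r k f -> exists2 g, is_chain c r (k + 1) g &
  forall phi, good r phi -> pair r phi f = pair r (bt c phi) g.
Proof.
move=> [cf [g cg nfg]]; exists g => // phi gphi; have sf := chain_supported cf; have sg := chain_supported cg.
have := nullP2 (supportedB sf (btotal_supported sg)) gphi nfg.
by rewrite pairBr pair_btotal // => /eqP; rewrite subr_eq0 => /eqP.
Qed.

Record chop r r' e K (G : word C -> fg) : Prop := ChOp {
  ch_isop :> isop r r' e K G;
  ch_comm : forall phi, good r' phi -> forall w, size w = r ->
    bt c (pull r G phi) w = sgn e * pull r G (bt c phi) w }.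

Lemma ch_commE r r' e K G phi : chop r r' e K G -> good r' phi ->
  bt c (pull r G phi) = (fun w => sgn e * pull r G (bt c phi) w).
Proof.
move=> [oG cG] gphi; apply/funext => w; have [sw|nw] := eqVneq (size w) r; first exact: cG.
rewrite /pull (negPf nw) mulr0 bt_size0 // => v sv.
by rewrite sv (negPf nw).
Qed.

Section Act.
Variables (r r' K : nat) (e k k' : int) (G : word C -> fg) (cG : chop r r' e K G) (ek : k' = k + e).

Lemma chop_cycle f : is_cycle c r k f -> is_cycle c r' k' (extK K r G f).
Proof.
move=> zf; have sf := cycle_supp zf; apply: cycleI; first exact: (extK_chain cG ek (cycle_chain zf)).
move=> phi gphi; rewrite (pair_ext cG) //; last exact: good_bt.
have := cycle_pair zf (op_good cG gphi); rewrite (ch_commE cG gphi) pairZl //; last first.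
  by apply: (op_good cG); apply: good_bt.
by move=> /eqP; rewrite mulf_eq0 sgnE signr_eq0 => /eqP.
Qed.

Lemma chop_boundary f : is_boundary c r k f -> is_boundary c r' k' (extK K r G f).
Proof.
move=> bf; have [cf _] := bf; have [g cg h] := boundary_pair bf.
have cGg : is_chain c r' (k' + 1) (extK K r G g).
  by apply: (extK_chain cG _ cg); rewrite ek; ring.
(* An operation of degree e commutes with the differential up to [sgn e], whence the sign of the
   witness. *)
apply: (@boundaryI _ _ _ (sgn e *: extK K r G g)).
- exact: (extK_chain cG ek cf).
- by rewrite -[_ *: _]addr0; apply: is_chainP => //; apply: is_chain0.
move=> phi gphi; have sf := chain_supported cf; have sg := chain_supported cg.
rewrite pairZr !(pair_ext cG) //; last exact: good_bt.
have gP := op_good cG gphi; rewrite h // (ch_commE cG gphi) pairZl //.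
by apply: (op_good cG); apply: good_bt.
Qed.

Lemma cls_eq (x y : subsp (cycles C c r k)) : is_boundary c r k (val x - val y) ->
  subq_class (boundaries C c r k) x = subq_class (boundaries C c r k) y.
Proof.
move=> h; apply/eqP; rewrite /subq_class -Quotient.idealrBE inE raddfB.
exact/asboolP.
Qed.
End Act.

Lemma clsP r k (x y : subsp (cycles C c r k)) :
  subq_class (boundaries C c r k) x = subq_class (boundaries C c r k) y ->
  is_boundary c r k (val x - val y).
Proof.
by move/eqP; rewrite /subq_class -Quotient.idealrBE inE raddfB => /asboolP.
Qed.

Lemma subspP r k (x : subsp (cycles C c r k)) : is_cycle c r k (val x).
Proof. by have := valP x; rewrite inE => /asboolP. Qed.

Section HM.
Variables (r r' K : nat) (e k k' : int) (G : word C -> fg) (cG : chop r r' e K G) (ek : k' = k + e).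

Definition cact (x : subsp (cycles C c r k)) : subsp (cycles C c r' k') :=
  exist _ (extK K r G (val x)) (introT (asboolP _) (chop_cycle cG ek (subspP x))).

Lemma cact_linear : linear cact.
Proof. by move=> a x y; apply: val_inj; rewrite /= extK_linear. Qed.

Lemma extKB f g : extK K r G (f - g) = extK K r G f - extK K r G g.
Proof.
by rewrite -(scaleN1r g) addrC extK_linear scaleN1r addrC.
Qed.

(** Defined on the chosen representative of the class; [hmapE] allows any cycle in it. *)
Definition hmap (x : HHt C c r k) : HHt C c r' k' := subq_class _ (cact (repr x)).

Lemma hmapE x : hmap (subq_class _ x) = subq_class _ (cact x).
Proof.
have xB := clsP (esym (subq_classE (subq_class _ x))).
by apply: cls_eq; rewrite /= -extKB; apply: (chop_boundary cG ek).
Qed.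

Lemma hmap_linear : linear hmap.
Proof.
have cZ c' s k0 (u : subsp (cycles C c' s k0)) b :
  b *: subq_class (boundaries C c' s k0) u = subq_class _ (b *: u) by apply: subq_classZ.
move=> a x y; rewrite (subq_classE x) (subq_classE y).
by rewrite cZ -subq_classD !hmapE cact_linear subq_classD -cZ.
Qed.

Lemma hmap_ex : exists F : {linear HHt C c r k -> HHt C c r' k'}, induced (extK K r G) F.
Proof.
exists (HB.pack_for {linear HHt C c r k -> HHt C c r' k'} hmap
  (GRing.isLinear.Build rat (HHt C c r k) (HHt C c r' k') *:%R hmap hmap_linear)).
by move=> z; exists (cact z) => //=; apply: hmapE.
Qed.
End HM.
End ChainOps.

(** * Permutations of tensor factors and nested slots *)

Section Swaps.
Variables (m : int) (C : dgOpenFrobenius m).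
Local Notation c := (1 - m).
Local Notation fg := {freeg (word C) / rat}.
Implicit Types (phi psi : word C -> rat) (B x y : block C) (w u v t : word C) (X : block C -> fg).

(** All permutations are written with adjacent transpositions, whose compatibility with the
    differential involves two factors only. *)
Definition sw_word i w : fg :=
  if drop i w is x :: y :: v then
    sgn ((block_deg x - c) * (block_deg y - c)) *: << take i w ++ y :: x :: v >>
  else 0.

Definition swd i phi w : rat :=
  if drop i w is x :: y :: v then
    sgn ((block_deg x - c) * (block_deg y - c)) * phi (take i w ++ y :: x :: v)
  else 0.

Lemma swdE i phi w : fglift (phi : _ -> rat^o) (sw_word i w) = swd i phi w.
Proof.
rewrite /sw_word /swd; case: (drop i w) => [|x [|y v]]; rewrite ?raddf0 //.
exact: fgliftZ1.
Qed.

Lemma swd0 phi x y v : swd 0 phi [:: x, y & v] =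
  sgn ((block_deg x - c) * (block_deg y - c)) * phi [:: y, x & v].
Proof. by []. Qed.
Lemma swdS i phi B w : swd i.+1 phi (B :: w) = swd i (fun w => phi (B :: w)) w.
Proof. by []. Qed.

Lemma swap_wordE w : size w = 2%N -> swap_word c w = sw_word 0 w.
Proof.
case: w => [|x [|y [|]]] // _; rewrite /swap_word /sw_word /=.
by rewrite !word_deg_cons word_deg_nil !addr0.
Qed.

Lemma nform_swd i phi : nform phi -> nform (swd i phi).
Proof.
elim: i phi => [|i IH] phi nf.
  split=> [u v|u a v].
    case: u => [|x [|y u]] /=.
    - case: v => [|y v]; first exact: bform0.
      by apply: (bform_sgn (fun d => (d - c) * (block_deg y - c))); apply: nf_b2.
    - by apply: (bform_sgn (fun d => (block_deg x - c) * (d - c))); apply: nf_b1.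
    - by apply: bformZ; case: nf => /(_ [:: y, x & u] v).
  case: u => [|x [|y u]] /=; first by case: v => [|y v] //; rewrite /swd /= nf_02 ?mulr0.
    by rewrite /swd /= nf_01 ?mulr0.
  by rewrite /swd /=; have := nf.2 [:: y, x & u] a v; rewrite /= => ->; rewrite mulr0.
split=> [[|B0 u] v|[|B0 u] a v].
- rewrite (_ : (fun B => _) = (fun B => fglift ((fun w => phi (B :: w)) : _ -> rat^o) (sw_word i v))); last first.
    by apply/funext => B; rewrite swdE.
  by apply: bform_fglift => t; apply: nf_b1.
- by case: (IH _ (nform_cons B0 nf)) => /(_ u v).
- by rewrite /= swdS -swdE fglift_eq0 // => t _; apply: nf_01.
- by rewrite /= swdS; case: (IH _ (nform_cons B0 nf)) => _ ->.
Qed.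

Lemma isop_sw r i : (i.+1 < r)%N -> isop r r 0 2 (sw_word i).
Proof.
move=> ir; apply: mkop => [w sw|phi [nf _ _]]; last first.
  apply: nform_size; rewrite (_ : (fun w => _) = swd i phi); first exact: nform_swd.
  by apply/funext => w; rewrite swdE.
rewrite /sw_word; have : (i.+1 < size w)%N by rewrite sw.
move: (cat_take_drop i w) (size_drop i w); case: (drop i w) => [|x [|y v]] ew; try by rewrite /=; lia.
move=> /= sv iw; apply: suppZ; apply: suppU; split.
- by rewrite -sw -[in RHS]ew !size_cat.
- by rewrite -[in RHS]ew !word_deg_cat !word_deg_cons; ring.
move=> n; rewrite -{1}ew /shape !map_cat !mem_cat /= !sumn_cat /= !inE.
by case/or4P => [/sumn_mem|/eqP->|/eqP->|/sumn_mem]; rewrite -/(shape _); lia.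
Qed.

Lemma bt_swd i phi w : (i.+1 < size w)%N -> bt c (swd i phi) w = swd i (bt c phi) w.
Proof.
elim: i phi w => [|i IH] phi [|x w] //.
  case: w => [|y v] // _; rewrite swd0 /=.
  have e1 : bd (fun B' => swd 0 phi [:: B', y & v]) x =
     sgn ((block_deg x - 1 - c) * (block_deg y - c)) * bd (fun B' => phi [:: y, B' & v]) x.
    exact: (bd_sgn (fun d => sgn ((d - c) * (block_deg y - c)))).
  have e2 : bd (fun B' => swd 0 phi [:: x, B' & v]) y =
     sgn ((block_deg x - c) * (block_deg y - 1 - c)) * bd (fun B' => phi [:: B', x & v]) y.
    exact: (bd_sgn (fun d => sgn ((block_deg x - c) * (d - c)))).
  have e3 : bt c (fun v' => swd 0 phi [:: x, y & v']) v =
     sgn ((block_deg x - c) * (block_deg y - c)) * bt c (fun v' => phi [:: y, x & v']) v.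
    exact: btZ.
  rewrite e1 e2 e3; move: (bd _ x) (bd _ y) (bt _ _ v) (block_deg x) (block_deg y) => p q r d d'.
  by sgnring.
move=> iw; rewrite swdS /=.
have -> : bd (fun B' => swd i.+1 phi (B' :: w)) x = swd i (fun w' => bd (fun B' => phi (B' :: w')) x) w.
  by rewrite -swdE -bd_fglift; congr bd; apply/funext => B'; rewrite swdS swdE.
rewrite (IH (fun v => phi (x :: v))) // -!swdE !fgliftE mulr_sumr -big_split; apply: eq_bigr => t _ /=.
by rewrite mulrDr mulrCA.
Qed.

Lemma pull_op r (G : word C -> fg) phi w : size w = r -> pull r G phi w = fglift (phi : _ -> rat^o) (G w).
Proof. by rewrite /pull => /eqP->. Qed.

Lemma chop_sw r i : (i.+1 < r)%N -> chop r r 0 2 (sw_word i).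
Proof.
move=> ir; split; first exact: isop_sw.
move=> phi gphi w sw; rewrite expr0z mul1r pull_op // swdE -bt_swd ?sw //.
by apply: bt_eq => v sv; rewrite pull_op ?sv // swdE.
Qed.

Lemma chop_eq r r' e K G H : (forall w, size w = r -> G w = H w) -> chop r r' e K G -> chop r r' e K H.
Proof.
move=> GH; have pE phi : pull r H phi = pull r G phi.
  by apply/funext => w; rewrite /pull; case: eqP => // /GH ->.
case=> [[tG gG] cG]; split=> [|phi gphi w sw]; last by rewrite !pE cG.
by split=> [w sw|phi /gG]; [rewrite -GH //; exact: tG | rewrite pE].
Qed.

Lemma chop_swap : chop 2 2 0 2 (swap_word c : word C -> fg).
Proof. by apply: chop_eq (chop_sw (r := 2) (i := 0) _) => // w sw; rewrite swap_wordE. Qed.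

Section SlotNest.
Variables (X : block C -> fg) (q : nat) (e : int).
Hypothesis tX : forall B, supp (fun u => size u = q /\ word_deg c u = block_deg B - c + e) (X B).

Lemma pullb_eq phi psi B : (forall t, size t = q -> word_deg c t = block_deg B - c + e -> phi t = psi t) ->
  pullb X phi B = pullb X psi B.
Proof. by move=> h; apply: fglift_eq => t /tX [st dt]; apply: h. Qed.

Lemma pullbZ k phi B : pullb X (fun t => k * phi t) B = k * pullb X phi B.
Proof. by rewrite /pullb !fgliftE mulr_sumr; apply: eq_bigr => t _; rewrite mulrCA. Qed.
End SlotNest.

Lemma slotdZ p i X k phi w : slotd c p i (pullb X) (fun w => k * phi w) w = k * slotd c p i (pullb X) phi w.
Proof. by rewrite -!slotdE !fgliftE mulr_sumr; apply: eq_bigr => t _; rewrite mulrCA. Qed.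

Lemma slotd_catr p j Xd phi t v : (j < size t)%N ->
  slotd c p j Xd phi (t ++ v) = slotd c p j Xd (fun t => phi (t ++ v)) t.
Proof.
elim: j t phi => [|j IH] [|B t] phi //; last by move=> jt; rewrite /= !slotdS IH.
by rewrite /= !slotd0; move=> _; congr (Xd _ _); apply/funext => s; rewrite catA.
Qed.

(** For j < q the second operation acts on an output of the first, so a relation between composites
    reduces to a relation on one block. *)
Lemma slot_nest X q e (tX : forall B, supp (fun u => size u = q /\ word_deg c u = block_deg B - c + e) (X B))
   Y p p' i j phi w : (j < q)%N -> 
  slotd c p i (pullb X) (slotd c p' (i + j) (pullb Y) phi) w =
  slotd c (p + p') i (fun psi => pullb X (slotd c p' j (pullb Y) psi)) phi w.
Proof.
move=> jq; elim: i phi w => [|i IH] phi [|B w]; rewrite ?slotd0 //.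
  by apply: (pullb_eq tX) => t st _; apply: slotd_catr; rewrite st.
rewrite !slotdS -IH addSn.
rewrite (_ : (fun w' => slotd c p' (i + j).+1 (pullb Y) phi (B :: w')) = (fun w' =>
  sgn (p' * (block_deg B - c)) * slotd c p' (i + j) (pullb Y) (fun w => phi (B :: w)) w')); last first.
  by apply/funext => w'; rewrite slotdS.
by rewrite slotdZ mulrA -sgnD mulrDl.
Qed.

Lemma slot_nest_sw X e (tX : forall B, supp (fun u => size u = 2%N /\ word_deg c u = block_deg B - c + e) (X B))
   p i phi w :
  slotd c p i (pullb X) (swd i phi) w = slotd c p i (fun psi => pullb X (swd 0 psi)) phi w.
Proof.
elim: i phi w => [|i IH] phi [|B w]; rewrite ?slotd0 //.
  by apply: (pullb_eq tX) => -[|x [|y []]].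
by rewrite !slotdS -IH.
Qed.

Lemma slotd_par p p' i Xd phi w : par p = par p' -> slotd c p i Xd phi w = slotd c p' i Xd phi w.
Proof.
move=> pp; rewrite /slotd; case: (drop i w) => // B v; congr (_ * _).
by apply: sgn_par; rewrite !parM pp.
Qed.

Lemma slotd_eq p i Xd Yd phi w : nform phi -> (forall psi B, nform psi -> Xd psi B = Yd psi B) ->
  slotd c p i Xd phi w = slotd c p i Yd phi w.
Proof.
move=> nf h; elim: i phi nf w => [|i IH] phi nf [|B w] //.
  by rewrite !slotd0; apply: h; apply: nform_catr.
by rewrite !slotdS IH //; apply: nform_cons.
Qed.

End Swaps.

Section SlotChains.
Variables (m : int) (C : dgOpenFrobenius m).
Local Notation c := (1 - m).
Local Notation fg := {freeg (word C) / rat}.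
Implicit Types (phi psi : word C -> rat) (B x y : block C) (w u v t : word C) (X : block C -> fg) (f g z : family C).

Lemma nform_sum n (F : nat -> word C -> rat) :
  (forall i, nform (F i)) -> nform (fun w => \sum_(i < n) F i w).
Proof.
move=> nF; split=> [u v|u a v]; last by rewrite big1 // => i _; apply: (nF i).2.
split=> [s|a].
  by apply: lin1_sum => i; case: (nF i) => /(_ u v) [/(_ s)].
by apply: brform_sum => i; case: (nF i) => /(_ u v) [_ /(_ a)].
Qed.

Lemma nform_bt phi : nform phi -> nform (bt c phi).
Proof.
move=> nf; have nS i : nform (slotd c 1 i (pullb (@b_block m C)) phi).
  by apply: nform_slot => //; apply: nfd_pullb (blkop_b C).
split=> [u v|u a v]; last by rewrite -sum_slotd_bt // big1 // => i _; apply: (nS i).2.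
have [/(_ u v) h _] := nform_sum (size u + (size v).+1) nS.
rewrite (_ : (fun B => _) = (fun B => \sum_(i < size u + (size v).+1) slotd c 1 i (pullb (@b_block m C)) phi (u ++ B :: v))) //.
by apply/funext => B; rewrite -sum_slotd_bt // size_cat.
Qed.

Section OneOp.
Variables (q : nat) (e : int) (K : nat) (X : block C -> fg) (Xd : (word C -> rat) -> block C -> rat).
Hypotheses (bX : blkop q e K X Xd) (K0 : (0 < K)%N).

Lemma bk_tX B : supp (fun u => size u = q /\ word_deg c u = block_deg B - c + e) (X B).
Proof. by apply: sub_supp (bk_typed bX (B := B)) => u []. Qed.

Lemma bk_degX B : supp (fun u => sgn (word_deg c u) = sgn (block_deg B - c + e)) (X B).
Proof. by apply: sub_supp (bk_typed bX (B := B)) => u [_ -> _]. Qed.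

Lemma pullb_dual psi : nform psi -> pullb X psi = Xd psi.
Proof. by move=> nf; apply/funext => B; apply: bk_dual bX _ _ _. Qed.

Lemma comm_bE psi B : nform psi -> comm_b X e psi B = bd (Xd psi) B - sgn e * Xd (bt c psi) B.
Proof. by move=> nf; rewrite /comm_b !pullb_dual //; apply: nform_bt. Qed.

Variables (r i : nat) (ir : (i < r)%N).

Lemma isop_op : isop r (r + q).-1 e K (at_slot c e i X).
Proof. exact: isop_slot bX ir K0. Qed.

Lemma pull_slot phi w : size w = r ->
  pull r (at_slot c e i X) phi w = slotd c e i (pullb X) phi w.
Proof. by move=> sw; rewrite pull_op // slotdE. Qed.

Lemma bt_pull_slot phi w : size w = r -> bt c (pull r (at_slot c e i X) phi) w =
  sgn e * pull r (at_slot c e i X) (bt c phi) w + slotd c (e + 1) i (comm_b X e) phi w.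
Proof.
move=> sw; rewrite (@bt_eq _ _ _ (slotd c e i (pullb X) phi)) ?slot_comm ?pull_slot //.
  exact: bk_degX.
by move=> v sv; rewrite pull_slot // sv.
Qed.

Lemma chop_slot : (forall psi B, nform psi -> bd (Xd psi) B = sgn e * Xd (bt c psi) B) ->
  chop r (r + q).-1 e K (at_slot c e i X).
Proof.
move=> cX; split=> [|phi [nf _ _] w sw]; first exact: isop_op.
rewrite bt_pull_slot // (@slotd_eq _ _ _ _ _ (fun _ _ => 0)) ?addr0 //.
  by rewrite /slotd; case: (drop i w) => *; rewrite ?mulr0 addr0.
by move=> psi B npsi; rewrite comm_bE // cX // subrr.
Qed.

(** The commutator of X with b, placed in a slot, sends a cycle z to a boundary: the part where b
    acts first vanishes on z, and the rest is the differential of X applied to z, with sign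
    [- sgn e]. *)
Lemma hom_slot z k k' f D : is_cycle c r k z -> is_chain c (r + q).-1 k' f -> k' + 1 = k + e ->
  (forall psi B, nform psi -> D psi B = bd (Xd psi) B - sgn e * Xd (bt c psi) B) ->
  (forall phi, good (r + q).-1 phi ->
     pair (r + q).-1 phi f = pair r (fun w => if size w == r then slotd c (e + 1) i D phi w else 0) z) ->
  is_boundary c (r + q).-1 k' f.
Proof.
move=> zz cf ek hD h; have sz := cycle_supp zz.
apply: (@boundaryI _ _ _ _ _ (- sgn e *: extK K r (at_slot c e i X) z)) => //.
  rewrite -[_ *: _]addr0; apply: is_chainP; last exact: is_chain0.
  exact: (extK_chain isop_op ek (cycle_chain zz)).
move=> phi gphi; have gb := good_bt gphi; have [nf _ _] := gphi.
rewrite h // pairZr (pair_ext isop_op) //.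
have g1 := op_good isop_op gphi; have g2 := op_good isop_op gb.
transitivity (pair r (fun w => bt c (pull r (at_slot c e i X) phi) w +
   (- sgn e) * pull r (at_slot c e i X) (bt c phi) w) z).
  congr (pair r _ z); apply/funext => w; case: eqP => [sw|nw]; last first.
    rewrite bt_size0 => [|v sv]; last by rewrite /pull sv; case: eqP.
    by rewrite /pull; case: eqP => // _; rewrite mulr0 addr0.
  rewrite bt_pull_slot // (@slotd_eq _ _ _ _ D (comm_b X e)) //; first by ring.
  by move=> psi B npsi; rewrite hD // comm_bE.
rewrite pairDl //; [| exact: good_bt | exact: goodZ].
by rewrite pairZl // (cycle_pair zz g1) add0r.
Qed.
End OneOp.
End SlotChains.

Section Symm.
Variables (m : int) (C : dgOpenFrobenius m).
Local Notation c := (1 - m).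
Local Notation fg := {freeg (word C) / rat}.

Definition symm (X : block C -> fg) B : fg := X B + fglift (@sw_word m C 0) (X B).

Lemma pullb_symm (X : block C -> fg) phi B : pullb (symm X) phi B = pullb X phi B + pullb X (swd 0 phi) B.
Proof.
rewrite /pullb raddfD /= fglift_comp; congr (_ + _).
by apply: fglift_eq => w _; apply: swdE.
Qed.

Lemma blkop_symm e K X Xd : blkop 2 e K X Xd ->
  blkop 2 e K (symm X) (fun psi B => Xd psi B + Xd (swd 0 psi) B).
Proof.
move=> bX; have [tX dX nX] := bX; split=> [B|psi B nf|psi nf].
- apply: suppD; first exact: tX.
  apply: supp_fglift => w Connes_slot; have := tX B w Connes_slot; case: w {Connes_slot} => [|x [|y [|? ?]]] [] //= _ dw zw.
  apply: suppZ; apply: suppU; split=> //; last by move: zw; rewrite /=; lia.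
  by rewrite -dw !word_deg_cons; ring.
- rewrite -[LHS]/(pullb (symm X) psi B) pullb_symm /pullb !dX //.
  exact: nform_swd.
have [[b1 b2] n1] := nX _ nf; have [[b3 b4] n2] := nX _ (nform_swd 0 nf).
split=> [|a]; last by rewrite n1 n2 addr0.
by split=> *; [apply: lin1D | apply: brformD].
Qed.
End Symm.

Section Pairing2.
Variables (m : int) (C : dgOpenFrobenius m).
Local Notation c := (1 - m).
Local Notation fg := {freeg (word C) / rat}.
Implicit Types (phi psi P Q : word C -> rat) (B x y : block C) (w u v t : word C) (X : block C -> fg) (f g z : family C) (G H : word C -> fg).

(** Transposes in slots are written without a length test; [res] restores the cut-off that good
    functionals need. *)
Definition res r P w : rat := if size w == r then P w else 0.
Definition dualw G P w : rat := fglift (P : _ -> rat^o) (G w).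

Lemma res_good r phi : good r phi -> res r phi = phi.
Proof.
move=> [_ sz _]; apply/funext => w; rewrite /res; case: eqP => // nw.
by rewrite sz.
Qed.

Lemma res_eq r P Q : (forall w, size w = r -> P w = Q w) -> res r P = res r Q.
Proof. by move=> h; apply/funext => w; rewrite /res; case: eqP => // /h. Qed.

Lemma dualw_res r r' e K G P : isop r r' e K G -> res r (dualw G (res r' P)) = res r (dualw G P).
Proof.
move=> oG; apply: res_eq => w sw; apply: fglift_eq => u uG.
by have [su _ _] := op_typed oG sw uG; rewrite /res su eqxx.
Qed.

Lemma good_step r r' e K G P : isop r r' e K G -> good r' (res r' P) -> good r (res r (dualw G P)).
Proof. by move=> oG gP; rewrite -(dualw_res P oG); apply: (op_good oG gP). Qed.

Lemma pair_extK_res r r' e K G P f : isop r r' e K G -> supported r f -> good r' (res r' P) ->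
  pair r' (res r' P) (extK K r G f) = pair r (res r (dualw G P)) f.
Proof. by move=> oG sf gP; rewrite (pair_ext oG) // -(dualw_res P oG). Qed.

Lemma pair_resB r P Q f : supported r f -> good r (res r P) -> good r (res r Q) ->
  pair r (res r P) f - pair r (res r Q) f = pair r (res r (fun w => P w - Q w)) f.
Proof.
move=> sf gP gQ; rewrite -mulN1r -pairZl // -pairDl //; last exact: goodZ.
by congr (pair r _ f); apply/funext => w; rewrite /res; case: eqP => _; ring.
Qed.

Lemma dualw_slot p i X P : dualw (at_slot c p i X) P = slotd c p i (pullb X) P.
Proof. by apply/funext => w; apply: slotdE. Qed.
Lemma dualw_sw i P : dualw (@sw_word m C i) P = swd i P.
Proof. by apply/funext => w; apply: swdE. Qed.

(** Equal pairings make the difference null, and a null family is a boundary with 0 as bounding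
    chain. *)
Lemma boundary_of_pair_eq r k f g : is_chain c r k f -> is_chain c r k g ->
  (forall phi, good r phi -> pair r phi f = pair r phi g) -> is_boundary c r k (f - g).
Proof.
move=> cf cg h; have sf := chain_supported cf; have sg := chain_supported cg.
apply: (@boundaryI _ _ _ _ _ 0); [|exact: is_chain0|].
  by rewrite -(scaleN1r g) (addrC f); apply: is_chainP.
move=> phi gphi; rewrite pairBr h // subrr /pair /pairN big1 // => ns _.
by rewrite raddf0.
Qed.
End Pairing2.

Section Ops.
Variables (m : int) (C : dgOpenFrobenius m).
Local Notation c := (1 - m).
Local Notation fg := {freeg (word C) / rat}.
Implicit Types (phi psi P Q : word C -> rat) (B x y : block C) (w u v t : word C) (X : block C -> fg) (f g z : family C) (G H : word C -> fg).

(* h is a homotopy between vee and its opposite, so its symmetrization is a chain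
   operation; it measures the failure of B to be a coderivation. *)
Definition bracket_block := symm (@h_block m C).
Definition M_block := symm (@G_block m C).
Definition bracketd psi B := hd psi B + hd (@swd m C 0 psi) B.
Definition Md psi B := Gd psi B + Gd (@swd m C 0 psi) B.

Lemma blkop_bracket : blkop 2 1 3 bracket_block bracketd. Proof. exact: blkop_symm (blkop_h C). Qed.
Lemma blkop_M : blkop 2 2 4 M_block Md. Proof. exact: blkop_symm (blkop_G C). Qed.

Definition vee_slot i : word C -> fg := at_slot c 0 i (@veeS_block m C c).
Definition Connes_slot i : word C -> fg := at_slot c 1 i (@B_block m C).
Definition bracket_slot i : word C -> fg := at_slot c 1 i bracket_block.

(** The transpose only evaluates its functional on outputs of X, which have q factors. *)
Lemma dual_eq q e K X Xd phi psi B : blkop q e K X Xd -> nform phi -> nform psi ->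
  (forall t, size t = q -> phi t = psi t) -> Xd phi B = Xd psi B.
Proof.
move=> bX n1 n2 h; rewrite -!(bk_dual bX) //; apply: fglift_eq => t tX.
by have [st _ _] := bk_typed bX tX; apply: h.
Qed.

Lemma swdK psi t : size t = 2%N -> swd 0 (swd 0 psi) t = psi t.
Proof.
case: t => [|x [|y [|]]] // _; rewrite !swd0 mulrA -sgnD.
by rewrite (mulrC (block_deg y - c)) sgnD sgnMsgn mul1r.
Qed.

Lemma bt_swd0 q e K X Xd psi B : blkop q e K X Xd -> (1 < q)%N -> nform psi ->
  Xd (bt c (swd 0 psi)) B = Xd (swd 0 (bt c psi)) B.
Proof.
move=> bX q1 npsi; apply: (dual_eq _ bX).
- by apply: nform_bt; apply: nform_swd.
- by apply: nform_swd; apply: nform_bt.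
by move=> t st; rewrite bt_swd // st.
Qed.

Lemma Ld_comm psi B : nform psi -> bd (bracketd psi) B = sgn 1 * bracketd (bt c psi) B.
Proof.
move=> npsi; have nsw := nform_swd 0 npsi.
have h1 := hd_homotopy npsi B; have := hd_homotopy nsw B.
rewrite (_ : veed c (swapd psi) B = veed c (swd 0 psi) B) // in h1.
rewrite (_ : veed c (swapd (swd 0 psi)) B = veed c (swd 0 (swd 0 psi)) B) //.
rewrite (dual_eq (phi := swd 0 (swd 0 psi)) (psi := psi) B (blkop_V C)) //; [| exact: nform_swd | exact: swdK].
rewrite (bt_swd0 _ (blkop_h C)) // => h2.
rewrite [LHS]bdD /bracketd expr1z mulN1r; apply/eqP; rewrite -subr_eq0 opprK addrACA -h1 -h2.
by rewrite addrC subrKA subrr.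
Qed.

Lemma chop_vee r i : (i < r)%N -> chop r r.+1 0 2 (vee_slot i).
Proof.
move=> ir; rewrite -[r.+1]/(r.+2.-1) -addn2; apply: (chop_slot (blkop_V C)) => // psi B npsi.
by rewrite expr0z mul1r veed_bt.
Qed.
Lemma chop_Connes r i : (i < r)%N -> chop r r 1 2 (Connes_slot i).
Proof.
move=> ir; rewrite -[X in chop _ X]/(r.+1.-1) -addn1; apply: (chop_slot (blkop_B C)) => // psi B npsi.
by rewrite expr1z mulN1r Bd_bt // opprK.
Qed.
Lemma chop_bracket r i : (i < r)%N -> chop r r.+1 1 3 (bracket_slot i).
Proof.
move=> ir; rewrite -[r.+1]/(r.+2.-1) -addn2; apply: (chop_slot blkop_bracket) => // psi B npsi.
exact: Ld_comm.
Qed.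

Lemma rot_wordE w : size w = 3%N -> rot_word c w = fglift (@sw_word m C 0) (sw_word 1 w).
Proof.
case: w => [|x [|y [|z [|]]]] // _; rewrite /sw_word /= linearZ /= liftU scale1r /= scalerA -sgnD.
rewrite !word_deg_cons word_deg_nil; congr (sgn _ *: _); ring.
Qed.

(** The cyclic permutation inherits everything from the two adjacent transpositions that compose
    it. *)
Lemma chop_rot : chop 3 3 0 2 (@rot_word m C c).
Proof.
have c0 := chop_sw C (isT : (1 < 3)%N); have c1 := chop_sw C (isT : (2 < 3)%N).
have pE phi : pull 3 (@rot_word m C c) phi = pull 3 (sw_word 1) (pull 3 (sw_word 0) phi).
  rewrite -[RHS]/(res 3 (dualw (sw_word 1) (res 3 (dualw (sw_word 0) phi)))) (dualw_res _ c1).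
  by apply: res_eq => w sw; rewrite rot_wordE // fglift_comp.
split; first split.
- case=> [|x [|y [|z [|]]]] // _; apply: suppZ; apply: suppU; split=> //.
    by rewrite !word_deg_cons word_deg_nil; ring.
  by move=> n; rewrite /= !inE => /or3P[] /eqP->; lia.
- by move=> phi gphi; rewrite pE; apply: (op_good c1); apply: (op_good c0).
move=> phi gphi w sw; rewrite !pE (ch_comm c1) //; last exact: (op_good c0).
by rewrite (ch_commE c0) // !expr0z !mul1r; congr pull; apply/funext => u; rewrite mul1r.
Qed.
End Ops.

(** * Relations up to boundary *)

Section Rel.
Variables (m : int) (C : dgOpenFrobenius m).
Local Notation c := (1 - m).
Local Notation fg := {freeg (word C) / rat}.
Local Notation V := (@veeS_block m C c).
Local Notation Bb := (@B_block m C).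
Local Notation L := (@bracket_block m C).
Local Notation sw := (@sw_word m C).
Local Notation vee_slot := (@vee_slot m C).
Local Notation Connes_slot := (@Connes_slot m C).
Local Notation bracket_slot := (@bracket_slot m C).
Implicit Types (phi psi P Q : word C -> rat) (B x y : block C) (w u v t : word C) (X : block C -> fg) (f g z : family C) (G H : word C -> fg).

Section Pairs.
Variables (r r1 r2 r3 : nat) (e1 e2 e3 : int) (K1 K2 K3 : nat) (G1 G2 G3 : word C -> fg).
Hypotheses (o1 : isop r r1 e1 K1 G1) (o2 : isop r1 r2 e2 K2 G2) (o3 : isop r2 r3 e3 K3 G3).
Variables (z : family C) (sz : supported r z).

Lemma pair_op1 phi : good r1 phi -> pair r1 phi (extK K1 r G1 z) = pair r (res r (dualw G1 phi)) z.
Proof. by move=> gphi; have := pair_extK_res o1 sz (P := phi); rewrite res_good //; apply. Qed.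
Lemma good_op1 phi : good r1 phi -> good r (res r (dualw G1 phi)).
Proof. by move=> gphi; have := good_step o1 (P := phi); rewrite res_good //; apply. Qed.

Lemma good_op2' phi : good r2 phi -> good r1 (res r1 (dualw G2 phi)).
Proof. by move=> gphi; have := good_step o2 (P := phi); rewrite res_good //; apply. Qed.
Lemma pair_op2 phi : good r2 phi ->
  pair r2 phi (extK K2 r1 G2 (extK K1 r G1 z)) = pair r (res r (dualw G1 (dualw G2 phi))) z.
Proof.
move=> gphi; have := pair_extK_res o2 (extK_supported o1 sz) (P := phi); rewrite res_good // => -> //.
by rewrite (pair_extK_res o1 sz) //; apply: good_op2'.
Qed.
Lemma good_op2 phi : good r2 phi -> good r (res r (dualw G1 (dualw G2 phi))).
Proof. by move=> gphi; apply: (good_step o1); apply: good_op2'. Qed.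

Lemma good_op3' phi : good r3 phi -> good r2 (res r2 (dualw G3 phi)).
Proof. by move=> gphi; have := good_step o3 (P := phi); rewrite res_good //; apply. Qed.
Lemma pair_op3 phi : good r3 phi ->
  pair r3 phi (extK K3 r2 G3 (extK K2 r1 G2 (extK K1 r G1 z))) =
  pair r (res r (dualw G1 (dualw G2 (dualw G3 phi)))) z.
Proof.
move=> gphi; have g3 := good_op3' gphi; have g2 := good_step o2 g3.
have := pair_extK_res o3 (extK_supported o2 (extK_supported o1 sz)) (P := phi); rewrite res_good // => -> //.
by rewrite (pair_extK_res o2 (extK_supported o1 sz)) // (pair_extK_res o1 sz).
Qed.
Lemma good_op3 phi : good r3 phi -> good r (res r (dualw G1 (dualw G2 (dualw G3 phi)))).
Proof. by move=> gphi; apply: (good_step o1); apply: (good_step o2); apply: good_op3'. Qed.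
End Pairs.

Lemma hom_slot_eq q e K X Xd r r' i z k k' f D : blkop q e K X Xd -> (0 < K)%N -> (i < r)%N ->
  (r + q).-1 = r' -> is_cycle c r k z -> is_chain c r' k' f -> k' + 1 = k + e ->
  (forall psi B, nform psi -> D psi B = bd (Xd psi) B - sgn e * Xd (bt c psi) B) ->
  (forall phi, good r' phi -> pair r' phi f = pair r (res r (slotd c (e + 1) i D phi)) z) ->
  is_boundary c r' k' f.
Proof. by move=> bX K0 ir <- zz cf ek hD h; apply: hom_slot bX K0 _ _ ir _ _ _ _ _ zz cf ek hD h. Qed.

Lemma chainB r k f g : is_chain c r k f -> is_chain c r k g -> is_chain c r k (f - g).
Proof. by move=> cf cg; rewrite -(scaleN1r g) (addrC f); apply: is_chainP. Qed.
Lemma chainD r k f g : is_chain c r k f -> is_chain c r k g -> is_chain c r k (f + g).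
Proof. by move=> cf cg; rewrite -(scale1r f); apply: is_chainP. Qed.

Lemma slotd_dual q e K X Xd p i phi : blkop q e K X Xd -> nform phi ->
  slotd c p i (pullb X) phi = slotd c p i Xd phi.
Proof.
move=> bX nf; apply/funext => w; apply: slotd_eq => // psi B npsi.
by rewrite (pullb_dual bX).
Qed.

Lemma swap_vee r i z k : (i < r)%N -> is_cycle c r k z ->
  is_boundary c r.+1 k (extK 2 r.+1 (sw i) (extK 2 r (vee_slot i) z) - extK 2 r (vee_slot i) z).
Proof.
move=> ir zz; have sz := cycle_supp zz; have oV := chop_vee C ir.
have oS : isop r.+1 r.+1 0 2 (sw i) by apply: isop_sw; rewrite ltnS.
apply: (hom_slot_eq (blkop_h C) _ ir _ zz (D := fun psi B => pullb V (swd 0 psi) B - pullb V psi B)).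
- by [].
- by rewrite addn2.
- have cV : is_chain c r.+1 k (extK 2 r (vee_slot i) z) by apply: (extK_chain oV _ (cycle_chain zz)); rewrite addr0.
  by apply: chainB => //; apply: (extK_chain oS _ cV); rewrite addr0.
- by [].
- move=> psi B nf; rewrite !(pullb_dual (blkop_V C)) //; last exact: nform_swd.
  by rewrite mulN1r opprK; exact: hd_homotopy.
move=> phi gphi; rewrite pairBr (pair_op2 oV oS) // (pair_op1 oV) //.
rewrite pair_resB //; [|exact: (good_op2 oV oS)|exact: good_op1 oV _ gphi].
congr (pair r _ z); apply: res_eq => w _.
rewrite !dualw_slot dualw_sw (slot_nest_sw (bk_tX (blkop_V C))).
(* The commutator with a homotopy of degree 1 carries the even degree [1 + 1], so its slot sign is
   that of [vee]. *)
rewrite (@slotd_par _ _ (1 + 1) 0) // /slotd; case: (drop i w) => [|B v]; first by rewrite subr0.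
by rewrite mulrBr.
Qed.
End Rel.

Section Rel2.
Variables (m : int) (C : dgOpenFrobenius m).
Local Notation c := (1 - m).
Local Notation fg := {freeg (word C) / rat}.
Local Notation V := (@veeS_block m C c).
Local Notation Bb := (@B_block m C).
Local Notation L := (@bracket_block m C).
Local Notation sw := (@sw_word m C).
Local Notation vee_slot := (@vee_slot m C).
Local Notation Connes_slot := (@Connes_slot m C).
Local Notation bracket_slot := (@bracket_slot m C).
Implicit Types (phi psi P Q : word C -> rat) (B x y : block C) (w u v t : word C) (X : block C -> fg) (f g z : family C) (G H : word C -> fg).

Let tV := bk_tX (blkop_V C).
Let tB := bk_tX (blkop_B C).
Let tL := bk_tX (blkop_bracket C).

Lemma slotd_swd2 Y i p phi w :
  (forall phi psi B, (forall t, size t = 2%N -> phi t = psi t) -> Y phi B = Y psi B) ->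
  slotd c p i Y (swd i phi) w = slotd c p i (fun psi => Y (swd 0 psi)) phi w.
Proof.
move=> dY; elim: i phi w => [|i IH] phi [|B w]; rewrite ?slotd0 //.
  by apply: dY => -[|x [|y [|]]].
by rewrite !slotdS -IH.
Qed.

Definition vee_Connes_defect psi B : rat := pullb V (slotd c 1 0 (pullb Bb) psi) B +
  pullb V (slotd c 1 0 (pullb Bb) (swd 0 psi)) B + pullb L psi B - pullb Bb (slotd c 0 0 (pullb V) psi) B.

Lemma vee_Connes_defectE psi B : nform psi -> vee_Connes_defect psi B = bd (Md psi) B - sgn 2 * Md (bt c psi) B.
Proof.
move=> nf; have nsw := nform_swd 0 nf.
rewrite /vee_Connes_defect !(slotd_dual _ _ (blkop_B C)) // !(slotd_dual _ _ (blkop_V C)) // !(pullb_dual (blkop_bracket C)) //.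
rewrite !(pullb_dual (blkop_V C)); first last.
- by rewrite -(slotd_dual _ _ (blkop_B C)) //; apply: nform_slot => //; apply: nfd_pullb (blkop_B C).
- by rewrite -(slotd_dual _ _ (blkop_B C)) //; apply: nform_slot => //; apply: nfd_pullb (blkop_B C).
rewrite (pullb_dual (blkop_B C)); last first.
  by rewrite -(slotd_dual _ _ (blkop_V C)) //; apply: nform_slot => //; apply: nfd_pullb (blkop_V C).
rewrite vee_BV // [bd (Md psi) B]bdD /Md /bracketd -(bt_swd0 _ (blkop_G C)) // mul1r.
rewrite (_ : veed c (slotd c 1 0 (@Bd m C) (swapd psi)) B = veed c (slotd c 1 0 (@Bd m C) (swd 0 psi)) B) //.
rewrite (_ : hd (swapd psi) B = hd (swd 0 psi) B) //.
rewrite (_ : Gd (bt c (swapd psi)) B = Gd (bt c (swd 0 psi)) B); last first.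
  apply: (dual_eq _ (blkop_G C)).
  - by apply: nform_bt; apply: nform_swapd.
  - exact: nform_bt.
  by move=> t st; apply: bt_eq => -[|x [|y [|]]] //; rewrite st.
rewrite (_ : bd (Gd (swapd psi)) B = bd (Gd (swd 0 psi)) B) //.
by ring.
Qed.

Lemma vee_Connes r i z k : (i < r)%N -> is_cycle c r k z ->
  is_boundary c r.+1 (k + 1) (extK 2 r.+1 (Connes_slot i) (extK 2 r (vee_slot i) z) +
    extK 2 r.+1 (sw i) (extK 2 r.+1 (Connes_slot i) (extK 2 r (vee_slot i) z)) + extK 3 r (bracket_slot i) z -
    extK 2 r (vee_slot i) (extK 2 r (Connes_slot i) z)).
Proof.
move=> ir zz; have sz := cycle_supp zz; have cz := cycle_chain zz.
have oV := chop_vee C ir; have oV' := chop_vee C (ltnW ir : (i < r.+1)%N).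
have oB := chop_Connes C ir; have oB' := chop_Connes C (ltnW ir : (i < r.+1)%N); have oL := chop_bracket C ir.
have oS : isop r.+1 r.+1 0 2 (sw i) by apply: isop_sw; rewrite ltnS.
have cV : is_chain c r.+1 k (extK 2 r (vee_slot i) z) by apply: (extK_chain oV _ cz); rewrite addr0.
have cBV : is_chain c r.+1 (k + 1) (extK 2 r.+1 (Connes_slot i) (extK 2 r (vee_slot i) z)).
  exact: (extK_chain oB' _ cV).
have cB : is_chain c r (k + 1) (extK 2 r (Connes_slot i) z) by apply: (extK_chain oB _ cz).
apply: (hom_slot_eq (blkop_M C) _ ir _ zz (D := vee_Connes_defect)) => //; first by rewrite addn2.
- apply: chainB; first apply: chainD; first apply: chainD => //.
  + by apply: (extK_chain oS _ cBV); rewrite addr0.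
  + exact: (extK_chain oL).
  + by apply: (extK_chain oV _ cB); rewrite addr0.
- by rewrite -addrA.
- exact: vee_Connes_defectE.
move=> phi gphi; have [nf _ _] := gphi.
rewrite pairBr !pairDr (pair_op2 oV oB') // (pair_op3 oV oB' oS) // (pair_op1 oL) // (pair_op2 oB oV) //.
have g1 := good_op2 oV oB' gphi; have g2 := good_op3 oV oB' oS gphi.
have g3 := good_op1 oL gphi; have g4 := good_op2 oB oV gphi.
rewrite -!pairDl //; last exact: goodD.
rewrite -mulN1r -pairZl // -pairDl //; [|by apply: goodD => //; apply: goodD|exact: goodZ].
congr (pair r _ z); apply/funext => w; rewrite /res; case: eqP => _; last by ring.
rewrite !dualw_slot dualw_sw mulN1r.
have n1 P : slotd c 0 i (pullb V) (slotd c 1 i (pullb Bb) P) w =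
    slotd c 1 i (fun psi => pullb V (slotd c 1 0 (pullb Bb) psi)) P w.
  by have := @slot_nest _ _ V 2 0 tV Bb 0 1 i 0 P w isT; rewrite addn0.
have n2 P : slotd c 1 i (pullb Bb) (slotd c 0 i (pullb V) P) w =
    slotd c 1 i (fun psi => pullb Bb (slotd c 0 0 (pullb V) psi)) P w.
  by have := @slot_nest _ _ Bb 1 1 tB V 1 0 i 0 P w isT; rewrite addn0.
rewrite !n1 n2 slotd_swd2; last first.
  move=> P Q B h; apply: (pullb_eq tV) => t st _.
  case: t st => [|x [|y [|]]] // _; rewrite !slotd0; apply: (pullb_eq tB) => t st _.
  by apply: h; rewrite size_cat st.
rewrite (@slotd_par _ _ (2 + 1) 1) // /slotd; case: (drop i w) => [|B v]; first by ring.
by rewrite /vee_Connes_defect; gring.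
Qed.

(** Naturality of the symmetry: a transposition before [vee] becomes a 3-cycle after it, and no
    further sign appears because [vee] has degree 0 on the shifted complex. *)
Lemma vee_swap0 psi t : size t = 2%N ->
  swd 0 (slotd c 0 0 (pullb V) psi) t = slotd c 0 1 (pullb V) (swd 0 (swd 1 psi)) t.
Proof.
case: t => [|x [|y [|]]] // _; rewrite swd0 slotd0 slotd1 mul0r expr0z mul1r -pullbZ.
apply: (pullb_eq tV) => -[|t1 [|t2 [|]]] // _; rewrite !word_deg_cons word_deg_nil => dt.
rewrite /= swd0 swdS swd0 mulrA -sgnD -mulrDr; congr (sgn _ * _).
by rewrite -[block_deg y - c]addr0 -dt addr0; ring.
Qed.

Lemma vee_swap1 psi t : size t = 2%N ->
  swd 0 (slotd c 0 1 (pullb V) psi) t = slotd c 0 0 (pullb V) (swd 1 (swd 0 psi)) t.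
Proof.
case: t => [|x [|y [|]]] // _; rewrite swd0 slotd0 slotd1 mul0r expr0z mul1r -pullbZ.
apply: (pullb_eq tV) => -[|t1 [|t2 [|]]] // _; rewrite !word_deg_cons word_deg_nil => dt.
rewrite /= swdS !swd0 mulrA -sgnD -mulrDl; congr (sgn _ * _).
by rewrite -[block_deg x - c]addr0 -dt addr0; ring.
Qed.

(** Of the two halves of L, [vee_hd] treats V0 h exactly. The 3-cycle of [vee_swap0] turns V0 s h
    into V1 h, for which [hd_vee] provides the homotopy. *)
Lemma bracket_vee_defect psi B : nform psi ->
  pullb V (slotd c 1 0 (pullb L) (swd 1 psi)) B + pullb V (slotd c 1 1 (pullb L) psi) B -
  pullb L (slotd c 0 0 (pullb V) psi) B =
  bd (kd c (swd 0 (swd 1 psi))) B - sgn 2 * kd c (swd 0 (swd 1 (bt c psi))) B.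
Proof.
move=> nf; have nf1 := nform_swd 1 nf; have nfr := nform_swd 0 nf1.
have nV j (chi : word C -> rat) : nform chi -> nform (slotd c 0 j (veed c) chi).
  by move=> nc; rewrite -(slotd_dual 0 j (blkop_V C) nc); apply: nform_slot => //; apply: nfd_pullb (blkop_V C).
have nh j (chi : word C -> rat) : nform chi -> nform (slotd c 1 j (@hd m C) chi).
  by move=> nc; rewrite -(slotd_dual 1 j (blkop_h C) nc); apply: nform_slot => //; apply: nfd_pullb (blkop_h C).
have eL j (chi : word C -> rat) : nform chi -> pullb V (slotd c 1 j (pullb L) chi) B =
    veed c (slotd c 1 j (@hd m C) chi) B + veed c (slotd c 1 j (@hd m C) (swd j chi)) B.
  move=> nc; have ncs := nform_swd j nc.
  rewrite -!(pullb_dual (blkop_V C)); try exact: nh.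
  rewrite -!(slotd_dual _ _ (blkop_h C)) // (_ : slotd c 1 j (pullb L) chi = fun w =>
    slotd c 1 j (pullb (@h_block m C)) chi w + slotd c 1 j (pullb (@h_block m C)) (swd j chi) w).
    by rewrite /pullb !fgliftE -big_split; apply: eq_bigr => t _; rewrite mulrDr.
  apply/funext => w; rewrite (slot_nest_sw (bk_tX (blkop_h C))) /slotd.
  case: (drop j w) => [|B' v]; first by rewrite addr0.
  by rewrite pullb_symm mulrDr.
rewrite !eL // pullb_symm (slotd_dual _ _ (blkop_V C)) // !(pullb_dual (blkop_h C)); try exact: nV; try by apply: nform_swd; exact: nV.
rewrite vee_hd //.
rewrite (_ : veed c (slotd c 1 0 (@hd m C) (sw12d psi)) B = veed c (slotd c 1 0 (@hd m C) (swd 1 psi)) B) //.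
rewrite (_ : hd (swd 0 (slotd c 0 0 (veed c) psi)) B = hd (slotd c 0 1 (veed c) (swd 0 (swd 1 psi))) B); last first.
  apply: (dual_eq _ (blkop_h C)); [by apply: nform_swd; exact: nV | exact: nV|].
  by move=> t st; rewrite -!(slotd_dual _ _ (blkop_V C)) // vee_swap0.
rewrite hd_vee //.
rewrite (_ : veed c (slotd c 1 1 (@hd m C) (sw01d (swd 0 (swd 1 psi)))) B = veed c (slotd c 1 1 (@hd m C) (swd 1 psi)) B); last first.
  rewrite (_ : veed c (slotd c 1 1 (@hd m C) (sw01d (swd 0 (swd 1 psi)))) B =
    veed c (slotd c 1 1 (@hd m C) (swd 0 (swd 0 (swd 1 psi)))) B) //.
  have nfrr := nform_swd 0 nfr.
  apply: (dual_eq _ (blkop_V C)); [exact: nh | exact: nh |].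
  case=> [|x [|y [|]]] // _; rewrite -!(slotd_dual _ _ (blkop_h C)) // !slotd1; congr (_ * _).
  apply: (pullb_eq (bk_tX (blkop_h C))) => -[|t1 [|t2 [|]]] // _ _.
  by rewrite !swd0 mulrA -sgnD (mulrC (block_deg t1 - c)) sgnD sgnMsgn mul1r.
rewrite (_ : kd c (bt c (swd 0 (swd 1 psi))) B = kd c (swd 0 (swd 1 (bt c psi))) B); last first.
  apply: (dual_eq _ (blkop_k C)); [exact: nform_bt | by do 2!apply: nform_swd; exact: nform_bt|].
  by case=> [|x [|y [|z [|]]]] // _; rewrite bt_swd // !swd0 bt_swd.
by rewrite mul1r; ring.
Qed.
End Rel2.

Section Rel3.
Variables (m : int) (C : dgOpenFrobenius m).
Local Notation c := (1 - m).
Local Notation fg := {freeg (word C) / rat}.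
Local Notation V := (@veeS_block m C c).
Local Notation Bb := (@B_block m C).
Local Notation L := (@bracket_block m C).
Local Notation sw := (@sw_word m C).
Local Notation vee_slot := (@vee_slot m C).
Local Notation Connes_slot := (@Connes_slot m C).
Local Notation bracket_slot := (@bracket_slot m C).
Implicit Types (phi psi P Q : word C -> rat) (B x y : block C) (w u v t : word C) (X : block C -> fg) (f g z : family C) (G H : word C -> fg).

Let tV := bk_tX (blkop_V C).
Let tB := bk_tX (blkop_B C).
Let tL := bk_tX (blkop_bracket C).

Lemma sw_sumn i w : supp (fun u => size u = size w /\ (word_deg c u = word_deg c w /\
  sumn (shape u) = sumn (shape w))) (sw i w).
Proof.
rewrite /sw_word; move: (cat_take_drop i w); case: (drop i w) => [|x [|y v]] ew; try exact: supp0.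
apply: suppZ; apply: suppU; rewrite -[in RHS]ew -[in X in _ /\ (_ = X /\ _)]ew -[in X in _ /\ (_ /\ _ = X)]ew.
rewrite !size_cat !word_deg_cat !word_deg_cons /shape !map_cat !sumn_cat /=; split=> //.
by split; [ring | lia].
Qed.

Lemma blkop_sw q e K X Xd i : (i.+1 < q)%N -> blkop q e K X Xd ->
  blkop q e K (fun B => fglift (sw i) (X B)) (fun psi => Xd (swd i psi)).
Proof.
move=> iq bX; have [tX dX nX] := bX; have oS := isop_sw C iq.
split=> [B|psi B nf|psi nf]; last by apply: nX; apply: nform_swd.
  apply: supp_fglift => w wX; have [sw dw zw] := tX B w wX.
  by apply: sub_supp (@sw_sumn i w) => u [-> [-> ->]].
rewrite fglift_comp -dX; last exact: nform_swd.
by apply: fglift_eq => w _; apply: swdE.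
Qed.

Lemma Connes_bracket z k : is_cycle c 1 k z ->
  is_boundary c 3 (k + 1) (extK 2 3 (sw 1) (extK 3 2 (bracket_slot 0) (extK 2 1 (vee_slot 0) z)) +
    extK 3 2 (bracket_slot 1) (extK 2 1 (vee_slot 0) z) - extK 2 2 (vee_slot 0) (extK 3 1 (bracket_slot 0) z)).
Proof.
move=> zz; have sz := cycle_supp zz; have cz := cycle_chain zz.
have oV : isop 1 2 0 2 (vee_slot 0) := chop_vee C (isT : (0 < 1)%N).
have oV' : isop 2 3 0 2 (vee_slot 0) := chop_vee C (isT : (0 < 2)%N).
have oL : isop 1 2 1 3 (bracket_slot 0) := chop_bracket C (isT : (0 < 1)%N).
have oL0 : isop 2 3 1 3 (bracket_slot 0) := chop_bracket C (isT : (0 < 2)%N).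
have oL1 : isop 2 3 1 3 (bracket_slot 1) := chop_bracket C (isT : (1 < 2)%N).
have oS : isop 3 3 0 2 (sw 1) by apply: isop_sw.
have cV : is_chain c 2 k (extK 2 1 (vee_slot 0) z) by apply: (extK_chain oV _ cz); rewrite addr0.
have cLV j : isop 2 3 1 3 (bracket_slot j) -> is_chain c 3 (k + 1) (extK 3 2 (bracket_slot j) (extK 2 1 (vee_slot 0) z)).
  by move=> o; exact: (extK_chain o _ cV).
(* The homotopy is k followed by the 3-cycle that relates V0 s to V1. *)
apply: (hom_slot_eq (r := 1) (i := 0) (blkop_sw (i := 1) _ (blkop_sw (i := 0) _ (blkop_k C))) _ _ _ zz
  (D := fun psi B => pullb V (slotd c 1 0 (pullb L) (swd 1 psi)) B + pullb V (slotd c 1 1 (pullb L) psi) B -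
  pullb L (slotd c 0 0 (pullb V) psi) B)) => //.
- apply: chainB; first apply: chainD.
  + by apply: (extK_chain oS _ (cLV 0 oL0)); rewrite addr0.
  + exact: cLV.
  + by apply: (extK_chain oV' _ (extK_chain oL _ cz)); rewrite ?addr0.
- by rewrite -addrA.
- by move=> psi B nf; rewrite bracket_vee_defect.
move=> phi gphi; have [nf _ _] := gphi.
rewrite pairBr !pairDr (pair_op3 oV oL0 oS) // (pair_op2 oV oL1) // (pair_op2 oL oV') //.
have g1 := good_op3 oV oL0 oS gphi; have g2 := good_op2 oV oL1 gphi; have g3 := good_op2 oL oV' gphi.
rewrite -!pairDl //.
rewrite -mulN1r -pairZl // -pairDl //; [|by apply: goodD|exact: goodZ].
congr (pair 1 _ z); apply/funext => w; rewrite /res; case: eqP => sw1; last by ring.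
rewrite !dualw_slot dualw_sw mulN1r; case: w sw1 => [|B [|]] // _.
by rewrite !slotd01.
Qed.
End Rel3.

(** * Relations that hold strictly on chains, up to null families *)

Section Rel4.
Variables (m : int) (C : dgOpenFrobenius m).
Local Notation c := (1 - m).
Local Notation fg := {freeg (word C) / rat}.
Local Notation V := (@veeS_block m C c).
Local Notation Bb := (@B_block m C).
Local Notation sw := (@sw_word m C).
Local Notation vee_slot := (@vee_slot m C).
Local Notation Connes_slot := (@Connes_slot m C).
Implicit Types (phi psi P Q : word C -> rat) (B x y : block C) (w u v t : word C) (X : block C -> fg) (f g z : family C) (G H : word C -> fg).

Let tV := bk_tX (blkop_V C).
Let tB := bk_tX (blkop_B C).

Lemma chop_chain r r' e K G k k' f : isop r r' e K G -> k' = k + e -> is_chain c r k f ->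
  is_chain c r' k' (extK K r G f).
Proof. exact: extK_chain. Qed.
Lemma chop_chain0 r r' K G k f : isop r r' 0 K G -> is_chain c r k f -> is_chain c r' k (extK K r G f).
Proof. by move=> oG cf; apply: (extK_chain oG _ cf); rewrite addr0. Qed.

Let oV r i (ir : (i < r)%N) : isop r r.+1 0 2 (vee_slot i) := chop_vee C ir.
Let oB r i (ir : (i < r)%N) : isop r r 1 2 (Connes_slot i) := chop_Connes C ir.
Let oS r i (ir : (i.+1 < r)%N) : isop r r 0 2 (sw i) := isop_sw C ir.

Lemma pullb_exchange (F : word C -> word C -> rat) X Y B B' :
  pullb X (fun t => pullb Y (F t) B') B = pullb Y (fun u => pullb X (F^~ u) B) B'.
Proof.
rewrite /pullb !fgliftE; under eq_bigr => t _ do rewrite fgliftE mulr_sumr.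
rewrite exchange_big /=; apply: eq_bigr => u _; rewrite fgliftE.
by rewrite mulr_sumr; apply: eq_bigr => t _; rewrite mulrCA.
Qed.

Ltac start := move=> zz; have sz := cycle_supp zz; have cz := cycle_chain zz.
Ltac chains := repeat first [assumption | apply: chop_chain0; [by first [eassumption | exact: oV | exact: oS]|]
  | apply: (chop_chain (k := _)); [by first [eassumption | exact: oB] | reflexivity |]].

Lemma vee_assoc z k : is_cycle c 1 k z ->
  is_boundary c 3 k (extK 2 2 (vee_slot 0) (extK 2 1 (vee_slot 0) z) - extK 2 2 (vee_slot 1) (extK 2 1 (vee_slot 0) z)).
Proof.
start; have o1 := oV (isT : (0 < 1)%N); have o2 := oV (isT : (0 < 2)%N); have o3 := oV (isT : (1 < 2)%N).
apply: boundary_of_pair_eq; [by chains | by chains |] => phi gphi; have [nf _ _] := gphi.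
rewrite (pair_op2 o1 o2) // (pair_op2 o1 o3) //; congr (pair _ _ z).
apply: res_eq => -[|x [|]] // _; rewrite !dualw_slot !slotd01.
have nV j : nform (slotd c 0 j (pullb V) phi) by apply: nform_slot => //; apply: nfd_pullb (blkop_V C).
by rewrite !(pullb_dual (blkop_V C)) // !(slotd_dual _ _ (blkop_V C)) // veed_coassoc.
Qed.

Lemma Connes_Connes z k : is_cycle c 1 k z ->
  is_boundary c 1 (k + 1 + 1) (extK 2 1 (Connes_slot 0) (extK 2 1 (Connes_slot 0) z)).
Proof.
start; have o1 := oB (isT : (0 < 1)%N); rewrite -[extK _ _ _ _]subr0.
apply: boundary_of_pair_eq; [by chains | exact: is_chain0 |] => phi gphi; have [nf _ _] := gphi.
rewrite (pair_op2 o1 o1) // /pair /pairN !big1 // => ns _; first exact: raddf0.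
apply: fglift_eq0 => w _; case: w => [|x [|y w]]; rewrite /res //= !dualw_slot slotd01.
have nB : nform (slotd c 1 0 (pullb Bb) phi) by apply: nform_slot => //; apply: nfd_pullb (blkop_B C).
by rewrite (pullb_dual (blkop_B C)) // (slotd_dual _ _ (blkop_B C)) // Bd_Bd.
Qed.

Lemma vee0_swap z k : is_cycle c 2 k z ->
  is_boundary c 3 k (extK 2 2 (vee_slot 0) (extK 2 2 (sw 0) z) - extK 2 3 (sw 1) (extK 2 3 (sw 0) (extK 2 2 (vee_slot 1) z))).
Proof.
start; have v0 := oV (isT : (0 < 2)%N); have v1 := oV (isT : (1 < 2)%N).
have s := oS (isT : (1 < 2)%N); have s0 := oS (isT : (1 < 3)%N); have s1 := oS (isT : (2 < 3)%N).
apply: boundary_of_pair_eq; [by chains | by chains |] => phi gphi.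
rewrite (pair_op2 s v0) // (pair_op3 v1 s0 s1) //; congr (pair _ _ z).
by apply: res_eq => w sw2; rewrite !dualw_slot !dualw_sw vee_swap0.
Qed.

Lemma vee1_swap z k : is_cycle c 2 k z ->
  is_boundary c 3 k (extK 2 2 (vee_slot 1) (extK 2 2 (sw 0) z) - extK 2 3 (sw 0) (extK 2 3 (sw 1) (extK 2 2 (vee_slot 0) z))).
Proof.
start; have v0 := oV (isT : (0 < 2)%N); have v1 := oV (isT : (1 < 2)%N).
have s := oS (isT : (1 < 2)%N); have s0 := oS (isT : (1 < 3)%N); have s1 := oS (isT : (2 < 3)%N).
apply: boundary_of_pair_eq; [by chains | by chains |] => phi gphi.
rewrite (pair_op2 s v1) // (pair_op3 v0 s1 s0) //; congr (pair _ _ z).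
by apply: res_eq => w sw2; rewrite !dualw_slot !dualw_sw vee_swap1.
Qed.

(** Operations on different factors commute, without sign because [vee] has degree 0 on the shifted
    complex. *)
Lemma Connes_vee z k : is_cycle c 2 k z ->
  is_boundary c 3 (k + 1) (extK 2 3 (Connes_slot 0) (extK 2 2 (vee_slot 1) z) - extK 2 2 (vee_slot 1) (extK 2 2 (Connes_slot 0) z)).
Proof.
start; have v1 := oV (isT : (1 < 2)%N).
have b := oB (isT : (0 < 2)%N); have b' := oB (isT : (0 < 3)%N).
apply: boundary_of_pair_eq; [by chains | by chains |] => phi gphi.
rewrite (pair_op2 v1 b') // (pair_op2 b v1) //; congr (pair _ _ z).
apply: res_eq => -[|x [|y [|]]] // _; rewrite !dualw_slot slotd0 slotd1 mul0r expr0z mul1r.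
transitivity (pullb V (fun t => pullb Bb (fun u => phi (u ++ t)) x) y).
  by apply: (pullb_eq tV) => t _ _; rewrite slotd0 cats0.
rewrite pullb_exchange; apply: (pullb_eq tB) => -[|u [|]] // _ _.
by rewrite /= slotd1 mul0r expr0z mul1r; apply: (pullb_eq tV) => t _ _; rewrite cats0.
Qed.

Lemma swdZ i a phi w : swd i (fun w => a * phi w) w = a * swd i phi w.
Proof. by rewrite -!swdE !fgliftE mulr_sumr; apply: eq_bigr => t _; rewrite mulrCA. Qed.

Lemma slot_swap i phi w : (i.+1 < size w)%N ->
  slotd c 1 i (pullb Bb) (swd i phi) w = swd i (slotd c 1 i.+1 (pullb Bb) phi) w.
Proof.
elim: i phi w => [|i IH] phi [|x w] //.
  case: w => [|y v] // _; rewrite slotd0 swd0 slotd1 mulrA -sgnD -pullbZ.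
  apply: (pullb_eq tB) => -[|t1 [|]] // _; rewrite word_deg_cons word_deg_nil => dt.
  by rewrite /= swd0; congr (sgn _ * _); rewrite -[block_deg t1 - c]addr0 dt; ring.
move=> iw; rewrite swdS slotdS.
rewrite (_ : (fun w0 => slotd c 1 i.+2 (pullb Bb) phi (x :: w0)) =
  (fun w0 => sgn (1 * (block_deg x - c)) * slotd c 1 i.+1 (pullb Bb) (fun w => phi (x :: w)) w0)).
  by rewrite swdZ -IH.
by apply/funext => w0; rewrite slotdS.
Qed.

Lemma Connes_swap r i z k : (i.+1 < r)%N -> is_cycle c r k z ->
  is_boundary c r (k + 1) (extK 2 r (sw i) (extK 2 r (Connes_slot i) z) - extK 2 r (Connes_slot i.+1) (extK 2 r (sw i) z)).
Proof.
move=> ir; start; have s := oS ir; have b := oB (ltnW ir); have b1 := oB ir.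
apply: boundary_of_pair_eq; [by chains | by chains |] => phi gphi.
rewrite (pair_op2 b s) // (pair_op2 s b1) //; congr (pair _ _ z).
by apply: res_eq => w sw2; rewrite !dualw_slot !dualw_sw slot_swap // sw2.
Qed.

Lemma Connes0_swap z k : is_cycle c 3 k z ->
  is_boundary c 3 (k + 1) (extK 2 3 (sw 1) (extK 2 3 (Connes_slot 0) z) - extK 2 3 (Connes_slot 0) (extK 2 3 (sw 1) z)).
Proof.
start; have s := oS (isT : (2 < 3)%N); have b := oB (isT : (0 < 3)%N).
apply: boundary_of_pair_eq; [by chains | by chains |] => phi gphi.
rewrite (pair_op2 b s) // (pair_op2 s b) //; congr (pair _ _ z).
apply: res_eq => -[|x [|y [|t [|]]]] // _; rewrite !dualw_slot !dualw_sw swdS swd0 !slotd0 -pullbZ.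
by apply: (pullb_eq tB) => -[|t1 [|]].
Qed.

Lemma swap_swap r i z k : (i.+1 < r)%N -> is_cycle c r k z ->
  is_boundary c r k (extK 2 r (sw i) (extK 2 r (sw i) z) - z).
Proof.
move=> ir; start; have s := oS ir.
apply: boundary_of_pair_eq; [by chains | by chains |] => phi gphi.
rewrite (pair_op2 s s) // -[in RHS](res_good gphi); congr (pair _ _ z).
apply: res_eq => w sw2; rewrite !dualw_sw; have : (i.+1 < size w)%N by rewrite sw2.
elim: i w phi {ir s sw2 gphi} => [|i IH] [|x w] phi //.
  by case: w => [|y v] // _; rewrite !swd0 mulrA -sgnD (mulrC (block_deg y - c)) sgnD sgnMsgn mul1r.
by move=> iw; rewrite swdS; apply: (IH _ (fun w => phi (x :: w))).
Qed.

Lemma braid z k : is_cycle c 3 k z ->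
  is_boundary c 3 k (extK 2 3 (sw 0) (extK 2 3 (sw 1) (extK 2 3 (sw 0) z)) -
    extK 2 3 (sw 1) (extK 2 3 (sw 0) (extK 2 3 (sw 1) z))).
Proof.
start; have s0 := oS (isT : (1 < 3)%N); have s1 := oS (isT : (2 < 3)%N).
apply: boundary_of_pair_eq; [by chains | by chains |] => phi gphi.
rewrite (pair_op3 s0 s1 s0) // (pair_op3 s1 s0 s1) //; congr (pair _ _ z).
apply: res_eq => -[|x [|y [|t [|]]]] // _; rewrite !dualw_sw !(swdS, swd0) !mulrA -!sgnD.
by congr (sgn _ * _); ring.
Qed.

Lemma rot_swap z k : is_cycle c 3 k z ->
  is_boundary c 3 k (extK 2 3 (@rot_word m C c) z - extK 2 3 (sw 0) (extK 2 3 (sw 1) z)).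
Proof.
start; have s0 := oS (isT : (1 < 3)%N); have s1 := oS (isT : (2 < 3)%N).
have o : isop 3 3 0 2 (@rot_word m C c) := chop_rot C.
apply: boundary_of_pair_eq; [by apply: (chop_chain0 o) | by chains |] => phi gphi.
rewrite (pair_op1 o) // (pair_op2 s1 s0) //; congr (pair _ _ z).
by apply: res_eq => w sw3; rewrite !dualw_sw /dualw rot_wordE // fglift_comp -swdE; apply: fglift_eq => u _; rewrite swdE.
Qed.
End Rel4.

(** * Formal derivation of the seven-term relation *)

Lemma zmod_BV (M : zmodType) (u s t b0 b1 b2 : M) :
  b0 + b1 + b2 = s + t + u - (u + b2 + (s - (b0 + b2) + (t - (b1 + b2)))).
Proof.
apply/eqP; rewrite eq_sym subr_eq !opprD !addrA.
(* The permutation puts each term next to its opposite and leaves s, t, u at the end. *)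
rewrite [X in _ == X](ACl (1*7*2*10*3*8*5*11*6*9*4))%AC /=.
by rewrite !(subrr, add0r).
Qed.

Lemma addDKl (M : zmodType) (x y : M) : x + y - x = y.
Proof. by rewrite addrC addKr. Qed.

Section FormalBV.
(** Primed groups and maps stand for the degree raised by one. *)
Variables (M1 M1' M2 M2' M3 M3' : zmodType).
Variables (V : M1 -> M2) (V' : M1' -> M2') (V0 V1 : M2 -> M3) (V0' V1' : M2' -> M3').
Variables (S : M2 -> M2) (S' : M2' -> M2') (S0 S1 : M3 -> M3) (S0' S1' T' : M3' -> M3').
Variables (D : M1 -> M1') (D20 D21 : M2 -> M2') (D30 D31 D32 : M3 -> M3').
Variables (L : M1 -> M2') (L0 L1 : M2 -> M3').
Hypotheses (V0'D : {morph V0' : x y / x + y}) (S1'D : {morph S1' : x y / x + y}).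
Hypotheses (S_V : forall a, S (V a) = V a) (S0_V0 : forall y, S0 (V0 y) = V0 y).
Hypotheses (S1_V1 : forall y, S1 (V1 y) = V1 y) (S0_V0' : forall y, S0' (V0' y) = V0' y).
Hypotheses (V0_V : forall a, V0 (V a) = V1 (V a)).
Hypotheses (V0_S : forall y, V0' (S' y) = S1' (S0' (V1' y))) (V1_S : forall y, V1' (S' y) = S0' (S1' (V0' y))).
Hypotheses (D30_V1 : forall y, D30 (V1 y) = V1' (D20 y)) (S_D20 : forall y, S' (D20 y) = D21 (S y)).
Hypotheses (S0_D30 : forall w, S0' (D30 w) = D31 (S0 w)) (S1_D31 : forall w, S1' (D31 w) = D32 (S1 w)).
Hypotheses (S1_D30 : forall w, S1' (D30 w) = D30 (S1 w)) (S1_S1 : forall w, S1' (S1' w) = w).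
Hypotheses (S_braid : forall w, S0' (S1' (S0' w)) = S1' (S0' (S1' w))) (T_S : forall w, T' w = S0' (S1' w)).
Hypotheses (V_D : forall a, D20 (V a) + S' (D20 (V a)) + L a = V' (D a)).
Hypotheses (V0_D20 : forall y, D30 (V0 y) + S0' (D30 (V0 y)) + L0 y = V0' (D20 y)).
Hypotheses (V1_D21 : forall y, D31 (V1 y) + S1' (D31 (V1 y)) + L1 y = V1' (D21 y)).
Hypotheses (V0_L : forall a, S1' (L0 (V a)) + L1 (V a) = V0' (L a)).

Lemma formal_BV a : let vv := V0 (V a) in let u := V0' (D20 (V a)) in
  D30 vv + D31 vv + D32 vv = T' (T' u) + T' u + u - V0' (V' (D a)).
Proof.
move=> W u.
(* Cocommutativity in each slot, with coassociativity, makes W invariant under both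
   transpositions. *)
have S0W : S0 W = W by rewrite S0_V0.
have S1W : S1 W = W by rewrite /W V0_V S1_V1.
(* By the braid relation the square of the 3-cycle is S1 S0, and S0 fixes u by cocommutativity. *)
have TTu : T' (T' u) = S1' u by rewrite !T_S S_braid S1_S1 S0_V0'.
(* B is carried from the first slot to the last through two transpositions, which W absorbs. *)
have e1 : V0' (S' (D20 (V a))) = D32 W.
  by rewrite V0_S -D30_V1 -V0_V S0_D30 S0W S1_D31 S1W.
(* This and [e3] solve the defect relation in the first and in the second slot for the terms
   containing L; so L is eliminated. *)
have e2 : S1' (L0 (V a)) = S1' u - (D30 W + D32 W).
  by rewrite /u -V0_D20 !S1'D S1_D30 S1W S0_D30 S0W S1_D31 S1W addDKl.
have e3 : L1 (V a) = T' u - (D31 W + D32 W).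
  have := V1_D21 (V a); rewrite -{4}[V a]S_V -S_D20 V1_S -T_S -V0_V S1_D31 S1W => <-.
  by rewrite addDKl.
by rewrite TTu -V_D !V0'D e1 -V0_L e2 e3; apply: zmod_BV.
Qed.
End FormalBV.

(** * The operations on homology *)

Section Homology.
Variables (m : int) (C : dgOpenFrobenius m).
Local Notation c := (1 - m).
Local Notation fg := {freeg (word C) / rat}.
Local Notation sw := (@sw_word m C).
Implicit Types (f g : family C) (G : word C -> fg).

(** Classes are followed through explicit cycles, so an identity in homology becomes the statement
    that a difference of families is a boundary. *)
Definition repr_by r k (a : HHt C c r k) f := exists x : subsp (cycles C c r k),
  val x = f /\ subq_class (boundaries C c r k) x = a.

Lemma repr_ex r k (a : HHt C c r k) : exists2 f, is_cycle c r k f & repr_by a f.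
Proof.
exists (val (repr a)); first exact: subspP.
by exists (repr a); rewrite -subq_classE.
Qed.

Lemma repr_eq r k (a b : HHt C c r k) f g : repr_by a f -> repr_by b g ->
  is_boundary c r k (f - g) -> a = b.
Proof. by move=> [x [<- <-]] [y [<- <-]]; exact: cls_eq. Qed.

Lemma reprD r k (a b : HHt C c r k) f g : repr_by a f -> repr_by b g -> repr_by (a + b) (f + g).
Proof. by move=> [x [<- <-]] [y [<- <-]]; exists (x + y); rewrite subq_classD raddfD. Qed.

Definition hom_op r r' e K G (cG : chop r r' e K G) k k' (ek : k' = k + e) :
  {linear HHt C c r k -> HHt C c r' k'} := projT1 (cid (hmap_ex cG ek)).

Lemma hom_opP r r' e K G (cG : chop r r' e K G) k k' (ek : k' = k + e) :
  induced (extK K r G) (hom_op cG ek).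
Proof. by rewrite /hom_op; case: cid. Qed.

Lemma repr_op r r' e K G (cG : chop r r' e K G) k k' (ek : k' = k + e) a f :
  repr_by a f -> repr_by (hom_op cG ek a) (extK K r G f).
Proof. by move=> [x [<- <-]]; have [y <- ->] := hom_opP cG ek x; exists y. Qed.

Lemma deg0 k : k = k + 0 :> int. Proof. by rewrite addr0. Qed.

Definition op0 r r' K G (cG : chop r r' 0 K G) k := hom_op cG (deg0 k).
Definition op1 r r' K G (cG : chop r r' 1 K G) k := hom_op cG (erefl (k + 1)).

Let V := op0 (chop_vee C (isT : (0 < 1)%N)).
Let V0 := op0 (chop_vee C (isT : (0 < 2)%N)).
Let V1 := op0 (chop_vee C (isT : (1 < 2)%N)).
Let S := op0 (chop_swap C).
Let T := op0 (chop_rot C).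
Let S0 := op0 (chop_sw C (isT : (1 < 3)%N)).
Let S1 := op0 (chop_sw C (isT : (2 < 3)%N)).
Let D := op1 (chop_Connes C (isT : (0 < 1)%N)).
Let D20 := op1 (chop_Connes C (isT : (0 < 2)%N)).
Let D21 := op1 (chop_Connes C (isT : (1 < 2)%N)).
Let D30 := op1 (chop_Connes C (isT : (0 < 3)%N)).
Let D31 := op1 (chop_Connes C (isT : (1 < 3)%N)).
Let D32 := op1 (chop_Connes C (isT : (2 < 3)%N)).
Let L := op1 (chop_bracket C (isT : (0 < 1)%N)).
Let L0 := op1 (chop_bracket C (isT : (0 < 2)%N)).
Let L1 := op1 (chop_bracket C (isT : (1 < 2)%N)).

(** [bv_swap] is induced by [swap_word], whereas the relations use [sw_word 0]; the two agree on
    words with two factors. *)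
Lemma repr_S k (y : HHt C c 2 k) f : is_cycle c 2 k f -> repr_by y f -> repr_by (S k y) (extK 2 2 (sw 0) f).
Proof.
move=> zf yf; have [x [ex cx]] := repr_op (chop_sw C (isT : (1 < 2)%N)) (deg0 k) yf.
have [x' [ex' cx']] := repr_op (chop_swap C) (deg0 k) yf.
exists x; split=> //; rewrite cx; apply: (repr_eq (f := extK 2 2 (sw 0) f) (g := extK 2 2 (swap_word c) f)).
- exact: repr_op.
- exact: repr_op.
have sf := cycle_supp zf; have cf := cycle_chain zf.
have o := chop_sw C (isT : (1 < 2)%N); have o' := chop_swap C.
apply: boundary_of_pair_eq; [exact: (chop_chain0 o) | exact: (chop_chain0 o') |] => phi gphi.
rewrite (pair_ext o) // (pair_ext o') //; congr (pair _ _ f).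
by apply/funext => w; rewrite /pull; case: eqP => // sw2; rewrite swap_wordE.
Qed.

Ltac rop := repeat first [eassumption | apply: repr_S | apply: reprD | apply: repr_op].

Lemma S_V k (a : HHt C c 1 k) : S k (V k a) = V k a.
Proof.
have [z zz az] := repr_ex a; have vz := chop_cycle (chop_vee C (isT : (0 < 1)%N)) (deg0 k) zz.
by apply: repr_eq (swap_vee (isT : (0 < 1)%N) zz); rop.
Qed.
Lemma S0_V0 k (y : HHt C c 2 k) : S0 k (V0 k y) = V0 k y.
Proof.
by have [z zz az] := repr_ex y; apply: repr_eq (swap_vee (isT : (0 < 2)%N) zz); rop.
Qed.
Lemma S1_V1 k (y : HHt C c 2 k) : S1 k (V1 k y) = V1 k y.
Proof.
by have [z zz az] := repr_ex y; apply: repr_eq (swap_vee (isT : (1 < 2)%N) zz); rop.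
Qed.
Lemma V0_V k (a : HHt C c 1 k) : V0 k (V k a) = V1 k (V k a).
Proof. by have [z zz az] := repr_ex a; apply: repr_eq (vee_assoc zz); rop. Qed.
Lemma D_D k (a : HHt C c 1 k) : D (k + 1) (D k a) = 0.
Proof.
have [z zz az] := repr_ex a; apply: (repr_eq (g := 0)); last first.
- by rewrite subr0; apply: Connes_Connes zz.
- by exists 0; split=> //; rewrite /subq_class raddf0.
by rop.
Qed.
Lemma V0_S k (y : HHt C c 2 k) : V0 k (S k y) = S1 k (S0 k (V1 k y)).
Proof. by have [z zz az] := repr_ex y; apply: repr_eq (vee0_swap zz); rop. Qed.
Lemma V1_S k (y : HHt C c 2 k) : V1 k (S k y) = S0 k (S1 k (V0 k y)).
Proof. by have [z zz az] := repr_ex y; apply: repr_eq (vee1_swap zz); rop. Qed.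
Lemma D30_V1 k (y : HHt C c 2 k) : D30 k (V1 k y) = V1 (k + 1) (D20 k y).
Proof. by have [z zz az] := repr_ex y; apply: repr_eq (Connes_vee zz); rop. Qed.
Lemma S_D20 k (y : HHt C c 2 k) : S (k + 1) (D20 k y) = D21 k (S k y).
Proof.
have [z zz az] := repr_ex y.
have dz := chop_cycle (chop_Connes C (isT : (0 < 2)%N)) (erefl (k + 1)) zz.
by apply: repr_eq (Connes_swap (isT : (1 < 2)%N) zz); rop.
Qed.
Lemma S0_D30 k (w : HHt C c 3 k) : S0 (k + 1) (D30 k w) = D31 k (S0 k w).
Proof. by have [z zz az] := repr_ex w; apply: repr_eq (Connes_swap (isT : (1 < 3)%N) zz); rop. Qed.
Lemma S1_D31 k (w : HHt C c 3 k) : S1 (k + 1) (D31 k w) = D32 k (S1 k w).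
Proof. by have [z zz az] := repr_ex w; apply: repr_eq (Connes_swap (isT : (2 < 3)%N) zz); rop. Qed.
Lemma S1_D30 k (w : HHt C c 3 k) : S1 (k + 1) (D30 k w) = D30 k (S1 k w).
Proof. by have [z zz az] := repr_ex w; apply: repr_eq (Connes0_swap zz); rop. Qed.
Lemma S1_S1 k (w : HHt C c 3 k) : S1 k (S1 k w) = w.
Proof. by have [z zz az] := repr_ex w; apply: repr_eq (swap_swap (isT : (2 < 3)%N) zz); rop. Qed.
Lemma S_braid k (w : HHt C c 3 k) : S0 k (S1 k (S0 k w)) = S1 k (S0 k (S1 k w)).
Proof. by have [z zz az] := repr_ex w; apply: repr_eq (braid zz); rop. Qed.
Lemma T_S k (w : HHt C c 3 k) : T k w = S0 k (S1 k w).
Proof. by have [z zz az] := repr_ex w; apply: repr_eq (rot_swap zz); rop. Qed.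

Lemma V_D k (a : HHt C c 1 k) : D20 k (V k a) + S (k + 1) (D20 k (V k a)) + L k a = V (k + 1) (D k a).
Proof.
have [z zz az] := repr_ex a; have vz := chop_cycle (chop_vee C (isT : (0 < 1)%N)) (deg0 k) zz.
have dvz := chop_cycle (chop_Connes C (isT : (0 < 2)%N)) (erefl (k + 1)) vz.
by apply: repr_eq (vee_Connes (isT : (0 < 1)%N) zz); rop.
Qed.
Lemma V0_D20 k (y : HHt C c 2 k) :
  D30 k (V0 k y) + S0 (k + 1) (D30 k (V0 k y)) + L0 k y = V0 (k + 1) (D20 k y).
Proof. by have [z zz az] := repr_ex y; apply: repr_eq (vee_Connes (isT : (0 < 2)%N) zz); rop. Qed.
Lemma V1_D21 k (y : HHt C c 2 k) :
  D31 k (V1 k y) + S1 (k + 1) (D31 k (V1 k y)) + L1 k y = V1 (k + 1) (D21 k y).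
Proof. by have [z zz az] := repr_ex y; apply: repr_eq (vee_Connes (isT : (1 < 2)%N) zz); rop. Qed.
Lemma V0_L k (a : HHt C c 1 k) :
  S1 (k + 1) (L0 k (V k a)) + L1 k (V k a) = V0 (k + 1) (L k a).
Proof. by have [z zz az] := repr_ex a; apply: repr_eq (Connes_bracket zz); rop. Qed.

Lemma BV_relation k (a : HHt C c 1 k) :
  let vv := V0 k (V k a) in let u := V0 (k + 1) (D20 k (V k a)) in
  D30 k vv + D31 k vv + D32 k vv =
  T (k + 1) (T (k + 1) u) + T (k + 1) u + u - V0 (k + 1) (V (k + 1) (D k a)).
Proof.
by apply: (formal_BV (raddfD (V0 (k + 1))) (raddfD (S1 (k + 1))) (@S_V k) (@S0_V0 k) (@S1_V1 k)
  (@S0_V0 (k + 1)) (@V0_V k) (@V0_S (k + 1)) (@V1_S (k + 1)) (@D30_V1 k) (@S_D20 k) (@S0_D30 k)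
  (@S1_D31 k) (@S1_D30 k) (@S1_S1 (k + 1)) (@S_braid (k + 1)) (@T_S (k + 1)) (@V_D k) (@V0_D20 k)
  (@V1_D21 k) (@V0_L k)).
Qed.

Definition hochschild_ops : bvOps (HHt C c 1) (HHt C c 2) (HHt C c 3) := BVOps V V0 V1 S T D D20 D30 D31 D32.
End Homology.

Theorem theorem8 (m : int) (C : dgOpenFrobenius m) :
  exists S : bvOps (HHt C (1 - m) 1) (HHt C (1 - m) 2) (HHt C (1 - m) 3),
    induced_by_vee_and_B S /\ is_BV_coalgebra S.
Proof.
exists (hochschild_ops C); split; split=> k.
- exact: (hom_opP (chop_vee C (isT : (0 < 1)%N)) (deg0 k)).
- exact: (hom_opP (chop_vee C (isT : (0 < 2)%N)) (deg0 k)).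
- exact: (hom_opP (chop_vee C (isT : (1 < 2)%N)) (deg0 k)).
- exact: (hom_opP (chop_swap C) (deg0 k)).
- exact: (hom_opP (chop_rot C) (deg0 k)).
- exact: (hom_opP (chop_Connes C (isT : (0 < 1)%N)) (erefl (k + 1))).
- exact: (hom_opP (chop_Connes C (isT : (0 < 2)%N)) (erefl (k + 1))).
- exact: (hom_opP (chop_Connes C (isT : (0 < 3)%N)) (erefl (k + 1))).
- exact: (hom_opP (chop_Connes C (isT : (1 < 3)%N)) (erefl (k + 1))).
- exact: (hom_opP (chop_Connes C (isT : (2 < 3)%N)) (erefl (k + 1))).
- exact: S_V.
- exact: V0_V.
- exact: D_D.
- exact: BV_relation.
Qed.
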